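(* Let $\phi:G\times Q\to Q$ be a free and proper action of a Lie group $G$ such that $\eta=\Pi^*(dt)$ is $G$-invariant, let $h:V^*\Pi\to T^*Q$ be a $G$-equivariant Hamiltonian section of $\mu$, and assume that $\ker\omega_h(\alpha_q)\cap T_{\alpha_q}(G\cdot\alpha_q)=\{0\}$ for all $\alpha_q\in T^*Q$. Then $(T^*Q,\omega_h,T^*\phi,J)$ is a symmetric presymplectic Hamiltonian system with $Ad^*$-equivariant momentum map $J:T^*Q\to\mathfrak g^*$ given by $$J(\alpha_q)(\xi)=\alpha_q(\xi_Q(q))-F_h(\alpha_q)\,c_\phi(\xi),\qquad \alpha_q\in T_q^*Q,\ \xi\in\mathfrak g.$$
   Context: Setting: $Q$ is a connected smooth manifold of dimension $n+1$, $\Pi:Q\to\mathbb R$ is a fibration (surjective submersion), $\eta=\Pi^*(dt)\in\Omega^1(Q)$, and $V\Pi=\{u\in TQ\mid \eta(u)=0\}$ is the vertical bundle, with dual bundle $V^*\Pi$. $\pi_Q:T^*Q\to Q$ is the projection. $\mu:T^*Q\to V^*\Pi$ is the dual of the inclusion $V\Pi\hookrightarrow TQ$ (restriction of covectors to $V\Pi$); it is a principal $\mathbb R$-bundle with action $\psi(s,\alpha_q)=\alpha_q+s\,\eta(q)$. $\omega_Q=-d\lambda_Q$ is the canonical symplectic form ($\lambda_Q$ the Liouville 1-form), $i_X\omega=\omega(X,\cdot)$, and $\eta_0=(\Pi\circ\pi_Q)^*(dt)$. A Hamiltonian section is a smooth section $h:V^*\Pi\to T^*Q$ of $\mu$. Its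 extended Hamiltonian function $F_h:T^*Q\to\mathbb R$ is determined by $\alpha_q-h(\mu(\alpha_q))=F_h(\alpha_q)\eta(q)$ for all $\alpha_q\in T^*_qQ$. Put $\omega_h=\omega_Q+dF_h\wedge\eta_0$ (a presymplectic form on $T^*Q$). Group actions: $\mathfrak g$ is the Lie algebra of $G$. $T^*\phi$ is the cotangent lift, $(T_g^*\phi(\alpha_q))(u)=\alpha_q(T_{\phi_g(q)}\phi_{g^{-1}}(u))$ for $u\in T_{\phi_g(q)}Q$; when $\eta$ is $G$-invariant ($\phi_g^*\eta=\eta$ for all $g$), $V^*\phi$ is the action on $V^*\Pi$ given by the same formula for $u\in V_{\phi_g(q)}\Pi$. $\xi_Q$, $\xi_{T^*Q}$ denote infinitesimal generators of $\xi\in\mathfrak g$. $h$ is $G$-equivariant if $T_g^*\phi\circ h=h\circ V_g^*\phi$ for all $g\in G$. $G$-invariance of $\eta$ gives a smooth function $m:G\to\mathbb R$ with $m(gh)=m(g)+m(h)$ and $\Pi\circ\phi_g=\Pi+m(g)$; put $c_\phi=dm(e)\in\mathfrak g^*$. Definitions: a presymplectic structure on a manifold $M$ is a closed 2-form of constant rank. $(M,\omega,\Phi,J)$ is a symmetric presymplectic Hamiltonian system if $\omega$ is a presymplectic structure on $M$, $\Phi:G\times M\to M$ is an action with (i) $\Phi_g^*\omega=\omega$ for all $g\in G$; (ii) $\ker\omega(x)\cap T_x(G\cdot x)=\{0\}$ for all $x\in M$; (iii) $J:M\to\mathfrak g^*$ is smooth (the momentum map) with $i_{\xi_M}\omega=dJ_\xi$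 for all $\xi\in\mathfrak g$, where $J_\xi(x)=J(x)(\xi)$. $J$ is $Ad^*$-equivariant if $J\circ\Phi_g=Ad^*_{g^{-1}}\circ J$ for all $g\in G$, where $(Ad^*_{g^{-1}}\nu)(\xi)=\nu(Ad_{g^{-1}}\xi)$. *)

(* Defs.v *)
From HB Require Import structures.
From mathcomp Require Import all_boot all_order all_algebra.
From mathcomp Require Import all_classical all_reals all_analysis.

Set Implicit Arguments.
Unset Strict Implicit.
Unset Printing Implicit Defensive.

Import Order.TTheory GRing.Theory Num.Theory.
Import numFieldNormedType.Exports.

Local Open Scope classical_set_scope.
Local Open Scope ring_scope.

(* Smooth manifolds modelled on 'rV[R]_m.  A [smooth_structure] is bare data;   *)
(* [manifold] says that these data form a smooth atlas whose topology is        *)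
(* Hausdorff and second countable.  A chart [i] is given by its domain,         *)
(* the coordinate map, its image in 'rV[R]_m and the inverse parametrization    *)
(* ([cmap] and [cinv] are meaningful only on [cdom] and [cimg]).  As in Lean's  *)
(* Mathlib, each point has a preferred chart [chart_at], so that the tangent    *)
(* space at x is 'rV[R]_m, a tangent vector being identified with its           *)
(* components in the chart [chart_at x].                                        *)

Section SmoothMaps.
Context {R : realType} {V W : normedModType R}.

Fixpoint Ck_on (k : nat) (U : set V) (f : V -> W) : Prop :=
  if k is k'.+1 then
    (forall x, U x -> differentiable f x) /\ (forall v, Ck_on k' U ('D_v f))
  else forall x, U x -> {for x, continuous f}.

(* Meant for open U. *)
Definition smooth_on (U : set V) (f : V -> W) := forall k, Ck_on k U f.

End SmoothMaps.

Record smooth_structure (R : realType) (m : nat) (M : Type) := SmoothStructure {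
  cidx : Type;
  chart_at : M -> cidx;
  cdom : cidx -> set M;
  cimg : cidx -> set 'rV[R]_m;
  cmap : cidx -> M -> 'rV[R]_m;
  cinv : cidx -> 'rV[R]_m -> M }.

(* A set is open when its trace in each chart is relatively open. *)
Definition mtop (R : realType) (m : nat) (M : Type)
  (A : smooth_structure R m M) : Type := M.

Section ManifoldTopology.
Context {R : realType} {m : nat} {M : choiceType} (A : smooth_structure R m M).

Definition mopen : set_system M := fun V => forall (i : cidx A) x,
  cimg i x -> V (cinv i x) -> \forall y \near x, cimg i y -> V (cinv i y).

Fact mopenT : mopen setT.
Proof. by move=> i x _ _; apply: filterE => y. Qed.

Fact mopenI : setI_closed mopen.
Proof.
move=> U V oU oV i x ix [Ux Vx].
apply: filterS2 (oU i x ix Ux) (oV i x ix Vx) => y hU hV iy.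
by split; [exact: hU | exact: hV].
Qed.

Fact mopen_bigU (I : Type) (f : I -> set M) :
  (forall i, mopen (f i)) -> mopen (\bigcup_i f i).
Proof.
move=> of_ i x ix [j _ fjx].
by apply: filterS (of_ j i x ix fjx) => y /[apply] fjy; exists j.
Qed.

HB.instance Definition _ := Choice.copy (mtop A) M.
HB.instance Definition _ :=
  @isOpenTopological.Build (mtop A) mopen mopenT mopenI mopen_bigU.

Record manifold : Prop := Manifold {
  manifold_cimg_open : forall i : cidx A, open (cimg i);
  manifold_cmap : forall (i : cidx A) x, cdom i x -> cimg i (cmap i x);
  manifold_cinv : forall (i : cidx A) y, cimg i y -> cdom i (cinv i y);
  manifold_cmapK : forall (i : cidx A) x, cdom i x -> cinv i (cmap i x) = x;
  manifold_cinvK : forall (i : cidx A) y, cimg i y -> cmap i (cinv i y) = y;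
  manifold_chart_at : forall x, cdom (chart_at A x) x;
  manifold_overlap : forall i j : cidx A,
    open (cimg i `&` cinv i @^-1` cdom j);
  manifold_transition : forall i j : cidx A,
    smooth_on (cimg i `&` cinv i @^-1` cdom j) (cmap j \o cinv i);
  manifold_hausdorff : hausdorff_space (mtop A);
  manifold_second_countable : @second_countable (mtop A) }.

Definition smooth_fun (W : normedModType R) (f : M -> W) :=
  forall i : cidx A, smooth_on (cimg i) (f \o cinv i).

(* The differential at y of the parametrization of chart i, and the            *)
(* differential at x of the coordinate map of chart i; they convert between     *)
(* components in chart i and elements of the tangent space.                     *)
Definition tvec (i : cidx A) (y : 'rV[R]_m) : 'Hom('rV[R]_m, 'rV[R]_m) :=
  linfun ('d (cmap (chart_at A (cinv i y)) \o cinv i) y).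

Definition tcoord (i : cidx A) (x : M) : 'Hom('rV[R]_m, 'rV[R]_m) :=
  linfun ('d (cmap i \o cinv (chart_at A x)) (cmap (chart_at A x) x)).

Definition fdiff (f : M -> R) (x : M) : 'Hom('rV[R]_m, R^o) :=
  linfun ('d (f \o cinv (chart_at A x) : 'rV[R]_m -> R^o)
             (cmap (chart_at A x) x)).

End ManifoldTopology.

Section MapsBetweenManifolds.
Context {R : realType} {m n : nat} {M N : choiceType}.
Variables (A : smooth_structure R m M) (B : smooth_structure R n N).

(* The openness clause says that f is continuous. *)
Definition smooth_map (f : M -> N) := forall (i : cidx A) (j : cidx B),
  let U := cimg i `&` (f \o cinv i) @^-1` cdom j in
  open U /\ smooth_on U (cmap j \o f \o cinv i).

Definition tmap (f : M -> N) (x : M) : 'Hom('rV[R]_m, 'rV[R]_n) :=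
  linfun ('d (cmap (chart_at B (f x)) \o f \o cinv (chart_at A x))
             (cmap (chart_at A x) x)).

Definition prod_structure : smooth_structure R (m + n) (M * N)%type :=
  {| cidx := (cidx A * cidx B)%type;
     chart_at p := (chart_at A p.1, chart_at B p.2);
     cdom i := cdom i.1 `*` cdom i.2;
     cimg i := [set y | cimg i.1 (lsubmx y) /\ cimg i.2 (rsubmx y)];
     cmap i p := row_mx (cmap i.1 p.1) (cmap i.2 p.2);
     cinv i y := (cinv i.1 (lsubmx y), cinv i.2 (rsubmx y)) |}.

End MapsBetweenManifolds.

Section Forms.
Context {R : realType} {m : nat} {M : choiceType} (A : smooth_structure R m M).

Definition form1 := M -> 'Hom('rV[R]_m, R^o).
Definition form2 := M -> 'rV[R]_m -> 'rV[R]_m -> R.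

Definition wedge11 (a b : form1) : form2 :=
  fun x u v => a x u * b x v - a x v * b x u.

Definition local1 (a : form1) (i : cidx A) (v y : 'rV[R]_m) : R^o :=
  a (cinv i y) (tvec i y v).

Definition local2 (w : form2) (i : cidx A) (u v y : 'rV[R]_m) : R^o :=
  w (cinv i y) (tvec i y u) (tvec i y v).

(* Exterior derivatives, computed at x in the preferred chart at x. *)
Definition d1 (a : form1) : form2 := fun x u v =>
  let i := chart_at A x in let y := cmap i x in
  'D_u (local1 a i v) y - 'D_v (local1 a i u) y.

Definition d2 (w : form2) (x : M) (u v z : 'rV[R]_m) : R :=
  let i := chart_at A x in let y := cmap i x in
  'D_u (local2 w i v z) y + 'D_v (local2 w i z u) y + 'D_z (local2 w i u v) y.

Record is_form2 (w : form2) : Prop := IsForm2 {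
  form2_linear : forall x u, linear (w x u : 'rV[R]_m -> R^o);
  form2_alternating : forall x u, w x u u = 0;
  form2_skew : forall x u v, w x u v = - w x v u;
  form2_smooth : forall (i : cidx A) u v, smooth_on (cimg i) (local2 w i u v) }.

Definition form2_rank (w : form2) (x : M) : nat :=
  \rank (\matrix_(i < m, j < m) w x (delta_mx 0 i) (delta_mx 0 j)).

Definition form2_ker (w : form2) (x : M) : set 'rV[R]_m :=
  [set u | forall v, w x u v = 0].

Record presymplectic (w : form2) : Prop := Presymplectic {
  presymplectic_manifold : manifold A;
  presymplectic_form : is_form2 w;
  presymplectic_closed : forall x u v z, d2 w x u v z = 0;
  presymplectic_rank : exists r, forall x, form2_rank w x = r }.

End Forms.

Section LieGroups.
Context {R : realType} {k : nat} {G : groupType} (AG : smooth_structure R k G).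

Record lie_group : Prop := LieGroup {
  lie_group_manifold : manifold AG;
  lie_group_mul :
    smooth_map (prod_structure AG AG) AG (fun p => (p.1 * p.2)%g);
  lie_group_inv : smooth_map AG AG (fun g => (g^-1)%g) }.

(* The Lie algebra is the tangent space 'rV[R]_k at 1. *)
Definition Ad (g : G) : 'Hom('rV[R]_k, 'rV[R]_k) :=
  tmap AG AG (fun x => (g * x * g^-1)%g) 1%g.

Context {m : nat} {M : choiceType} (A : smooth_structure R m M).

Record smooth_action (Phi : G -> M -> M) : Prop := SmoothAction {
  smooth_action1 : forall x, Phi 1%g x = x;
  smooth_actionM : forall g h x, Phi (g * h)%g x = Phi g (Phi h x);
  smooth_action_smooth :
    smooth_map (prod_structure AG A) A (fun p => Phi p.1 p.2) }.

Definition free_action (Phi : G -> M -> M) :=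
  forall g x, Phi g x = x -> g = 1%g.

Definition proper_action (Phi : G -> M -> M) :=
  forall K : set (mtop (prod_structure A A)), compact K ->
    compact ([set p | K (Phi p.1 p.2, p.2)]
             : set (mtop (prod_structure AG A))).

(* [infgen Phi x xi] is the value at x of the infinitesimal generator of xi. *)
Definition infgen (Phi : G -> M -> M) (x : M) : 'Hom('rV[R]_k, 'rV[R]_m) :=
  tmap AG A (fun g => Phi g x) 1%g.

Definition orbit_tangent (Phi : G -> M -> M) (x : M) : set 'rV[R]_m :=
  range (infgen Phi x).

(* The dual of the Lie algebra is 'Hom('rV[R]_k, R^o), given the smooth         *)
(* structure of its linear coordinates.                                         *)
Record symmetric_presymplectic (w : form2) (Phi : G -> M -> M)
    (J : M -> 'Hom('rV[R]_k, R^o)) : Prop := SymmetricPresymplectic {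
  sps_presymplectic : presymplectic A w;
  sps_action : smooth_action Phi;
  sps_invariant : forall g x u v,
    w (Phi g x) (tmap A A (Phi g) x u) (tmap A A (Phi g) x v) = w x u v;
  sps_transverse : forall x,
    form2_ker w x `&` orbit_tangent Phi x = [set 0];
  sps_smooth :
    smooth_fun A (fun x => \row_(j < k) J x (delta_mx 0 j) : 'rV[R]_k);
  sps_momentum : forall xi x v,
    w x (infgen Phi x xi) v = fdiff A (fun y => J y xi) x v }.

Definition Ad_equivariant (Phi : G -> M -> M)
    (J : M -> 'Hom('rV[R]_k, R^o)) :=
  forall g x xi, J (Phi g x) xi = J x (Ad g^-1%g xi).

End LieGroups.

Section CotangentBundle.
Context {R : realType} {m : nat} {Q : choiceType} (A : smooth_structure R m Q).

Definition cotangent : choiceType := (Q * 'Hom('rV[R]_m, R^o))%type.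

Definition covector (p : 'rV[R]_m) : 'Hom('rV[R]_m, R^o) :=
  linfun (fun u : 'rV[R]_m => (\sum_j p 0 j * u 0 j : R^o)).

(* Canonical coordinates (q, p) induced by the charts of Q. *)
Definition cotangent_structure : smooth_structure R (m + m) cotangent :=
  {| cidx := cidx A;
     chart_at (a : cotangent) := chart_at A a.1;
     cdom i := [set a : cotangent | cdom i a.1];
     cimg i := [set y | cimg i (lsubmx y)];
     cmap i (a : cotangent) := row_mx (cmap i a.1)
       (\row_j a.2 (tvec i (cmap i a.1) (delta_mx 0 j)));
     cinv i y := let q := cinv i (lsubmx y) in
       (q, (covector (rsubmx y) \o tcoord i q)%VF) : cotangent |}.

Definition liouville : @form1 R (m + m) cotangent :=
  fun a => (a.2 \o tmap cotangent_structure A fst a)%VF.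

Definition canonical_form : @form2 R (m + m) cotangent :=
  fun a u v => - d1 cotangent_structure liouville a u v.

Definition cotangent_lift (G : groupType) (phi : G -> Q -> Q)
    (g : G) (a : cotangent) : cotangent :=
  (phi g a.1, (a.2 \o tmap A A (phi g^-1%g) (phi g a.1))%VF).

End CotangentBundle.

Section Fibration.
Context {R : realType} {n : nat} {Q : choiceType}.
Variables (A : smooth_structure R n.+1 Q) (Pi : Q -> R).

(* The 1-form Pi^* dt. *)
Definition eta : @form1 R n.+1 Q := fdiff A Pi.

Record fibration : Prop := Fibration {
  fibration_smooth : smooth_fun A (Pi : Q -> R^o);
  fibration_surjective : forall t, exists q, Pi q = t;
  fibration_submersion : forall q (t : R), exists v, eta q v = t }.

Definition vertical (q : Q) : {vspace 'rV[R]_n.+1} := lker (eta q).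

Definition vdual : choiceType := {q : Q & 'Hom(subvs_of (vertical q), R^o)}.

(* Bundle charts of the dual of the vertical bundle.  For a chart i of Q, with  *)
(* coordinate fields d_0, ..., d_n, and an index l, on the open set where       *)
(* d_l Pi <> 0 the vertical bundle has the smooth frame                         *)
(*   d_j - (d_j Pi / d_l Pi) d_l,   j <> l,                                     *)
(* and the fibre coordinates of nu are its values on that frame.  The           *)
(* components of a vertical vector in the frame are its chart components of     *)
(* index j <> l.                                                                *)
Definition dPi (i : cidx A) (q : Q) (j : 'I_n.+1) : R :=
  eta q (tvec i (cmap i q) (delta_mx 0 j)).

Definition vframe (i : cidx A) (l : 'I_n.+1) (q : Q) (j : 'I_n)
    : subvs_of (vertical q) :=
  vsproj (vertical q) (tvec i (cmap i q)
    (delta_mx 0 (lift l j) - (dPi i q (lift l j) / dPi i q l) *: delta_mx 0 l)).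

Definition vdual_structure : smooth_structure R (n.+1 + n) vdual :=
  {| cidx := (cidx A * 'I_n.+1)%type;
     chart_at (nu : vdual) := let i := chart_at A (tag nu) in
       (i, odflt ord0 [pick l | dPi i (tag nu) l != 0]);
     cdom i := [set nu : vdual | cdom i.1 (tag nu) /\ dPi i.1 (tag nu) i.2 != 0];
     cimg i := [set y | cimg i.1 (lsubmx y) /\
                        dPi i.1 (cinv i.1 (lsubmx y)) i.2 != 0];
     cmap i (nu : vdual) := row_mx (cmap i.1 (tag nu))
       (\row_j tagged nu (vframe i.1 i.2 (tag nu) j));
     cinv i y := let q := cinv i.1 (lsubmx y) in
       existT (fun q => 'Hom(subvs_of (vertical q), R^o)) q
         (linfun (fun u : subvs_of (vertical q) =>
            (\sum_(j < n) (rsubmx y) 0 j *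
                          (tcoord i.1 q (vsval u)) 0 (lift i.2 j) : R^o))) |}.

(* The dual of the inclusion of the vertical bundle. *)
Definition mu (a : @cotangent R n.+1 Q) : vdual :=
  existT (fun q => 'Hom(subvs_of (vertical q), R^o)) a.1
    (a.2 \o linfun (vsval : subvs_of (vertical a.1) -> 'rV[R]_n.+1))%VF.

Record hamiltonian_section (h : vdual -> @cotangent R n.+1 Q) : Prop :=
  HamiltonianSection {
    hsection_smooth : smooth_map vdual_structure (cotangent_structure A) h;
    hsection_mu : cancel h mu }.

(* The number F_h(a) with a - h(mu(a)) = F_h(a) eta. *)
Definition extended_hamiltonian (h : vdual -> @cotangent R n.+1 Q)
    (a : @cotangent R n.+1 Q) : R :=
  xget 0 [set s : R | a.2 - (h (mu a)).2 = s *: eta a.1].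

Definition eta0 : @form1 R (n.+1 + n.+1) (@cotangent R n.+1 Q) :=
  fdiff (cotangent_structure A) (fun a => Pi a.1).

Definition omega (h : vdual -> @cotangent R n.+1 Q)
    : @form2 R (n.+1 + n.+1) (@cotangent R n.+1 Q) :=
  fun a u v => canonical_form A a u v +
    wedge11 (fdiff (cotangent_structure A) (extended_hamiltonian h)) eta0 a u v.

Context {k : nat} {G : groupType} (AG : smooth_structure R k G).
Variable phi : G -> Q -> Q.

Definition eta_invariant :=
  forall g q u, eta (phi g q) (tmap A A (phi g) q u) = eta q u.

(* Under [eta_invariant] the tangent map preserves vertical vectors, so that    *)
(* [vsproj] only changes the type.                                              *)
Definition vdual_lift (g : G) (nu : vdual) : vdual :=
  let q := tag nu in let q' := phi g q in
  existT (fun q => 'Hom(subvs_of (vertical q), R^o)) q'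
    (tagged nu \o linfun (vsproj (vertical q)) \o tmap A A (phi g^-1%g) q'
       \o linfun (vsval : subvs_of (vertical q') -> 'rV[R]_n.+1))%VF.

Definition section_equivariant (h : vdual -> @cotangent R n.+1 Q) :=
  forall g nu, cotangent_lift A phi g (h nu) = h (vdual_lift g nu).

(* The function m with Pi (phi g q) = Pi q + m g; it exists when Q is connected *)
(* and eta is invariant.                                                        *)
Definition translation (g : G) : R :=
  xget 0 [set s : R | forall q, Pi (phi g q) = Pi q + s].

Definition c_phi : 'Hom('rV[R]_k, R^o) := fdiff AG translation 1%g.

End Fibration.

(* Main.v *)
From HB Require Import structures.
Require Import Defs.
From mathcomp Require Import all_boot all_order all_algebra.
From mathcomp Require Import zify ring lra.
From mathcomp Require Import all_classical all_reals all_analysis.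

Set Implicit Arguments.
Unset Strict Implicit.
Unset Printing Implicit Defensive.

Import Order.TTheory GRing.Theory Num.Theory.
Import numFieldNormedType.Exports.

Local Open Scope classical_set_scope.
Local Open Scope ring_scope.

(* Lifts of diffeomorphisms of Q preserve the Liouville form: in charts such a  *)
(* lift is (q, p) |-> (q', p') with p' . D_v q' = p . v_q.  Differentiating     *)
(* once more along T^*Q and using the symmetry of second derivatives shows that *)
(* it preserves the canonical form, which is therefore the standard symplectic  *)
(* form in every chart (a change of charts is the lift of the identity).        *)
(* Differentiating the same identity along G shows that the vector field        *)
(* xi_{T^*Q} is the Hamiltonian vector field of alpha |-> alpha(xi_Q).          *)
(*   Since F_h is G-invariant and Pi \o phi_g = Pi + m(g), contracting          *)
(* dF_h /\ eta_0 with xi_{T^*Q} gives - c_phi(xi) dF_h, hence the correction in *)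
(* J.  Translating a covector by s eta raises F_h by s, so dF_h takes the value *)
(* -1 on the symplectic gradient of Pi \o pi_Q; the kernel of omega_h is then  *)
(* spanned by the symplectic gradients of F_h and of Pi \o pi_Q, and the rank  *)
(* is constant.  Smoothness of F_h is read off a local frame of V Pi.           *)

(** * Calculus *)

(** Write F for [extended_hamiltonian h] and P for Pi \o pi_Q, so that omega_h = omega_Q + dF /\ dP.
    Everything follows from the shape of omega_Q in charts and from the behaviour of F and P along
    the fibres and along the orbits.

    Form. Since [liouville] reads p . dq in every cotangent chart ([local1_liouville]), omega_Q has
    the constant coefficients of [std_symplectic] there ([canonical_formE],
    [local2_canonical_form]). Hence omega_h is closed as soon as F and P are smooth
    ([perturbed_closed], [smooth_extended_hamiltonian]). The vector [sharp] dP is vertical and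
    translates covectors along - eta, whence dF (sharp dP) = -1 ([extended_hamiltonian_sharp]). This
    single relation makes the kernel exactly two-dimensional ([rank_symplectic_wedge]), so the rank
    is 2n everywhere.

    Invariance. A cotangent lift preserves [liouville] ([liouville_colift]), hence omega_Q
    ([canonical_form_preserved]); it fixes F because h and mu are equivariant
    ([extended_hamiltonian_invariant]) and shifts P by the constant m(g), which exists because Q is
    connected ([translationP]).

    Momentum. Let X be the generator of xi on T^*Q and J_0 = lambda_Q(X), that is alpha(xi_Q). From
    L_X lambda_Q = 0 and Cartan's formula, i_X omega_Q = dJ_0 ([exact_momentumP]). Moreover dF(X) =
    0 and dP(X) = c_phi(xi), so i_X omega_h = d(J_0 - c_phi(xi) F) ([momentumP]). Equivariance
    combines [infgen_Ad], the invariance of F and the invariance of c_phi under Ad ([c_phi_Ad]), the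
    latter because m is a homomorphism to an abelian group.

    Tangent vectors are components in a preferred chart that varies with the point, so the
    computations are made on local representatives [rep] between arbitrary charts, and changes of
    chart are treated as the identity map seen in two charts. *)

Section Calculus.
Context {R : realType}.
Implicit Types V W : normedModType R.

(** The differential depends only on the germ: the first-order expansion of [f] at [x] is also one
    for [g], and the linear part of such an expansion is unique. *)
Lemma differentiable_near_eq V W (f g : V -> W) x :
  (\near x, f x = g x) -> differentiable f x ->
  differentiable g x /\ 'd g x = 'd f x :> (V -> W).
Proof.
move=> fg df.
have E : g \o shift x = cst (g x) + 'd f x +o_ 0 id.
  have fgx : f x = g x by exact: (nbhs_singleton fg).
  rewrite -fgx.
  apply/eqaddoP => e e0.
  have /eqaddoP/(_ e e0) := diff_locally df.
  have : \forall y \near (0 : V), f (y + x) = g (y + x).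
    by move: fg; rewrite (near_shift 0) subr0.
  apply: filterS2 => y /= h1.
  by rewrite -![(_ + _ : _ -> _) _]/(_ + _) -![(- _ : _ -> _) _]/(- _) /= h1.
have D : 'd g x = 'd f x :> (V -> W).
  by apply: diff_unique => //; exact: diff_continuous.
split => //; apply/diff_locallyP; split.
  by rewrite D; exact: diff_continuous.
by rewrite D.
Qed.

Lemma rV_linear_continuous m W (f : {linear 'rV[R]_m -> W}) : continuous f.
Proof.
have -> : (f : _ -> _) = \sum_(j < m) (fun x : 'rV[R]_m => x 0 j *: f (delta_mx 0 j)).
  apply/funext => x; rewrite fct_sumE {1}[x]row_sum_delta linear_sum.
  by apply: eq_bigr => j _; rewrite linearZ.
move=> x; apply: differentiable_continuous.
apply: differentiable_sum => j.
apply: differentiableZl; exact: differentiable_coord.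
Qed.

Lemma linear_fun_differentiable m W (f : 'rV[R]_m -> W) x : linear f -> differentiable f x.
Proof.
move=> lf; pose fM := GRing.isLinear.Build _ _ _ _ _ lf.
pose fL : {linear _ -> _} := HB.pack f fM.
exact: (@linear_differentiable _ _ _ fL x (@rV_linear_continuous _ _ fL)).
Qed.

Lemma linear_fun_derive m W (f : 'rV[R]_m -> W) x v : linear f -> 'D_v f x = f v.
Proof.
move=> lf; rewrite deriveE; last exact: linear_fun_differentiable.
pose fM := GRing.isLinear.Build _ _ _ _ _ lf.
pose fL : {linear _ -> _} := HB.pack f fM.
by rewrite (@diff_lin _ _ _ fL x (@rV_linear_continuous _ _ fL)).
Qed.

Lemma Ck_on_succ V W k (U : set V) (f : V -> W) : Ck_on k.+1 U f -> Ck_on k U f.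
Proof.
elim: k f => [|k IH] f /= [df Df].
  by move=> x Ux; apply: differentiable_continuous; exact: df.
by split => // v; apply: IH; exact: Df.
Qed.

(** In [Ck_on] the set only says at which points the conditions are imposed; the derivatives are
    those of the function on the whole space. The condition is therefore pointwise. *)
Lemma Ck_on_local V W k (U : set V) (f : V -> W) :
  (forall x, U x -> exists2 U' : set V, U' x & Ck_on k U' f) -> Ck_on k U f.
Proof.
elim: k f => [|k IH] f /= H.
  by move=> x /H[U' U'x]; exact.
split=> [x /H[U' U'x [df _]]|v]; first exact: df.
by apply: IH => x /H[U' U'x [_ Df]]; exists U'.
Qed.

Lemma Ck_onS V W k (U U' : set V) (f : V -> W) :
  U' `<=` U -> Ck_on k U f -> Ck_on k U' f.
Proof. by move=> UU' Uf; apply: Ck_on_local => x U'x; exists U => //; exact: UU'. Qed.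

Lemma near_open (T : topologicalType) (U : set T) (P : T -> Prop) x :
  open U -> U x -> (forall y, U y -> P y) -> \forall y \near x, P y.
Proof. by move=> oU Ux H; apply: filterS (open_nbhs_nbhs (conj oU Ux)) => y; exact: H. Qed.

(** Openness turns equality on [U] into equality near each of its points, which is what derivatives
    see. *)
Lemma Ck_on_eq V W k (U : set V) (f g : V -> W) : open U ->
  (forall x, U x -> f x = g x) -> Ck_on k U f -> Ck_on k U g.
Proof.
move=> oU; elim: k f g => [|k IH] f g fg /=.
  move=> cf x Ux; have := cf x Ux; rewrite /prop_for /continuous_at -(fg x Ux).
  by apply: cvg_trans; apply: near_eq_cvg; apply: near_open Ux _ => // y /fg.
move=> [df Df]; split=> [x Ux|v].
  have := @differentiable_near_eq _ _ f g x; case=> //; last exact: df.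
  exact: near_open Ux fg.
apply: IH (Df v) => x Ux; apply: near_eq_derive; exact: near_open Ux fg.
Qed.

Lemma Ck_on_cst V W k (U : set V) (a : W) : Ck_on k U (cst a : V -> W).
Proof.
elim: k a => [|k IH] a /=; first by move=> x _; exact: cvg_cst.
split=> [x _|v]; first exact: differentiable_cst.
by rewrite (_ : 'D_v _ = cst 0) //; apply/funext => x; rewrite derive_cst.
Qed.

Lemma Ck_onD V W k (U : set V) (f g : V -> W) : open U ->
  Ck_on k U f -> Ck_on k U g -> Ck_on k U (f + g).
Proof.
move=> oU; elim: k f g => [|k IH] f g /=.
  by move=> cf cg x Ux; apply: continuousD; [exact: cf|exact: cg].
move=> [df Df] [dg Dg]; split=> [x Ux|v].
  by apply: differentiableD; [exact: df|exact: dg].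
apply: Ck_on_eq (IH _ _ (Df v) (Dg v)) => // x Ux.
by rewrite deriveD //; apply: diff_derivable; [exact: df|exact: dg].
Qed.

Lemma Ck_onN V W k (U : set V) (f : V -> W) : open U ->
  Ck_on k U f -> Ck_on k U (- f).
Proof.
move=> oU; elim: k f => [|k IH] f /=.
  by move=> cf x Ux; apply: continuousN; exact: cf.
move=> [df Df]; split=> [x Ux|v]; first by apply: differentiableN; exact: df.
apply: Ck_on_eq (IH _ (Df v)) => // x Ux.
by rewrite deriveN //; apply: diff_derivable; exact: df.
Qed.

Lemma Ck_onM V k (U : set V) (f g : V -> R) : open U ->
  Ck_on k U f -> Ck_on k U g -> Ck_on k U (f * g).
Proof.
move=> oU; elim: k f g => [|k IH] f g.
  by move=> cf cg x Ux; apply: continuousM; [exact: cf|exact: cg].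
move=> Cf Cg; have := Ck_on_succ Cf; have := Ck_on_succ Cg.
case: Cf => df Df; case: Cg => dg Dg Cg Cf; split=> [x Ux|v].
  by apply: differentiableM; [exact: df|exact: dg].
apply: (@Ck_on_eq _ _ _ _ (f * 'D_v g + g * 'D_v f)) => // [x Ux|].
  by rewrite deriveM //; apply: diff_derivable; [exact: df|exact: dg].
exact: (Ck_onD oU (IH _ _ Cf (Dg v)) (IH _ _ Cg (Df v))).
Qed.

Lemma Ck_on_sum V W k (U : set V) n (f : 'I_n -> V -> W) : open U ->
  (forall i, Ck_on k U (f i)) -> Ck_on k U (\sum_i f i).
Proof.
move=> oU Cf; elim/big_ind : _ => //; first exact: (Ck_on_cst _ _ 0).
by move=> g1 g2; exact: Ck_onD.
Qed.

Lemma Ck_onV V k (U : set V) (f : V -> R) : open U ->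
  (forall x, U x -> f x != 0) ->
  Ck_on k U f -> Ck_on k U (fun x => (f x)^-1).
Proof.
move=> oU f0; elim: k => [|k IH].
  by move=> cf x Ux; apply: continuousV; [exact: f0|exact: cf].
move=> Cf; have /IH Cf' := Ck_on_succ Cf.
case: Cf => df Df; split=> [x Ux|v].
  by apply: differentiableV; [exact: df|exact: f0].
apply: (@Ck_on_eq _ _ _ _
  (- ((fun x => (f x)^-1) * (fun x => (f x)^-1) * 'D_v f))) => // [x Ux|].
  rewrite deriveV ?f0 //; last by apply: diff_derivable; exact: df.
  by rewrite expr2 invfM scaleNr.
exact: (Ck_onN oU (Ck_onM oU (Ck_onM oU Cf' Cf') (Df v))).
Qed.

Lemma Ck_on_linear m W k (U : set 'rV[R]_m) (f : 'rV[R]_m -> W) :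
  linear f -> Ck_on k U f.
Proof.
move=> lf; case: k => [|k].
  by move=> x _; apply: differentiable_continuous; exact: linear_fun_differentiable.
split=> [x _|v]; first exact: linear_fun_differentiable.
rewrite (_ : 'D_v f = cst (f v)); first exact: Ck_on_cst.
by apply/funext => x; rewrite linear_fun_derive.
Qed.

Lemma differentiable_row V m (f : V -> 'rV[R]_m) x :
  (forall j, differentiable (fun y => f y 0 j : R) x) -> differentiable f x.
Proof.
move=> df.
have -> : f = \sum_(j < m) (fun y => (f y 0 j) *: (delta_mx 0 j : 'rV[R]_m)).
  by apply/funext => y; rewrite fct_sumE {1}[f y]row_sum_delta.
by apply: differentiable_sum => j; exact: differentiableZl.
Qed.

Lemma differentiable_rowP V m (f : V -> 'rV[R]_m) x :
  differentiable f x -> forall j, differentiable (fun y => f y 0 j : R) x.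
Proof.
move=> df j; apply: (@differentiable_comp _ _ _ _ f (fun M : 'rV[R]_m => M 0 j : R)) => //.
exact: differentiable_coord.
Qed.

Lemma derive_row V m (f : V -> 'rV[R]_m) x v j :
  differentiable f x -> ('D_v f x) 0 j = 'D_v (fun y => f y 0 j : R) x.
Proof. by move=> df; rewrite derive_mx ?mxE //; exact: diff_derivable. Qed.

Lemma Ck_on_row V k (U : set V) m (f : V -> 'rV[R]_m) : open U ->
  (forall j, Ck_on k U (fun x => f x 0 j : R)) -> Ck_on k U f.
Proof.
move=> oU; elim: k f => [|k IH] f Cf.
  move=> x Ux; have -> : f = \sum_(j < m) (fun y => (f y 0 j) *: (delta_mx 0 j : 'rV[R]_m)).
    by apply/funext => y; rewrite fct_sumE {1}[f y]row_sum_delta.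
  elim/big_ind : _ => [|g1 g2|j _]; first exact: cvg_cst.
    exact: continuousD.
  by apply: (@continuousZr_tmp _ _ _ (fun y => f y 0 j : R)); exact: Cf.
have df x : U x -> differentiable f x.
  by move=> Ux; apply: differentiable_row => j; apply (Cf j).1.
split => // v; apply: IH => j.
by apply: Ck_on_eq ((Cf j).2 v) => // x Ux; rewrite derive_row //; exact: df.
Qed.

Lemma Ck_on_coord V k (U : set V) m (f : V -> 'rV[R]_m) j : open U ->
  Ck_on k U f -> Ck_on k U (fun x => f x 0 j : R).
Proof.
move=> oU; elim: k f => [|k IH] f Cf.
  move=> x Ux; apply: (@continuous_comp _ _ _ f (fun M : 'rV[R]_m => M 0 j : R)).
    exact: Cf.
  exact: coord_continuous.
case: Cf => df Df; split=> [x Ux|v].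
  by apply: differentiable_rowP; exact: df.
by apply: Ck_on_eq (IH _ (Df v)) => // x Ux; rewrite derive_row //; exact: df.
Qed.

Lemma derive_comp V m W (f : V -> 'rV[R]_m) (g : 'rV[R]_m -> W) x v :
  differentiable f x -> differentiable g (f x) ->
  'D_v (g \o f) x = 'D_('D_v f x) g (f x).
Proof.
move=> df dg; rewrite deriveE; last exact: differentiable_comp.
by rewrite diff_comp //= -deriveE // -deriveE.
Qed.

Lemma derive_sum_delta m W (g : 'rV[R]_m -> W) x v : differentiable g x ->
  'D_v g x = \sum_(j < m) v 0 j *: 'D_(delta_mx 0 j) g x.
Proof.
move=> dg; rewrite deriveE // {1}[v]row_sum_delta linear_sum.
by apply: eq_bigr => j _; rewrite linearZ deriveE.
Qed.

(** In coordinates the chain rule writes D_v (g \o f) as the sum over j of D_v f_j times (d_j g) \o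
    f; the induction hypothesis applies to the partial derivatives d_j g. *)
Lemma Ck_on_comp V m k (U : set V) (U' : set 'rV[R]_m)
    (f : V -> 'rV[R]_m) (g : 'rV[R]_m -> R) : open U ->
  (forall x, U x -> U' (f x)) ->
  Ck_on k U f -> Ck_on k U' g -> Ck_on k U (g \o f).
Proof.
move=> oU fU; elim: k g => [|k IH] g.
  move=> cf cg x Ux; apply: continuous_comp; first exact: cf.
  by apply: cg; exact: fU.
move=> Cf Cg; have Cf' := Ck_on_succ Cf; case: Cf => df Df; case: Cg => dg Dg.
have df' x : U x -> differentiable f x by exact: df.
split=> [x Ux|v]; first by apply: differentiable_comp; [exact: df|exact/dg/fU].
apply: (@Ck_on_eq _ _ _ _ (\sum_(j < m)
   ((fun x => ('D_v f x) 0 j : R) * ('D_(delta_mx 0 j) g \o f)))) => // [x Ux|].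
  have dgx := dg _ (fU _ Ux).
  by rewrite (derive_comp v (df' _ Ux) dgx) (derive_sum_delta _ dgx) fct_sumE.
apply: (Ck_on_sum oU) => j.
exact: (Ck_onM oU (Ck_on_coord j oU (Df v)) (IH _ Cf' (Dg _))).
Qed.

Lemma Ck_on_compr V m p k (U : set V) (U' : set 'rV[R]_m)
    (f : V -> 'rV[R]_m) (g : 'rV[R]_m -> 'rV[R]_p) : open U -> open U' ->
  (forall x, U x -> U' (f x)) ->
  Ck_on k U f -> Ck_on k U' g -> Ck_on k U (g \o f).
Proof.
move=> oU oU' fU Cf Cg; apply: Ck_on_row => // j.
by apply: (@Ck_on_comp _ _ _ _ U' f (fun x => g x 0 j)) => //; exact: Ck_on_coord.
Qed.

(** * Mean value theorem on segments and symmetry of second derivatives *)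

Lemma derive_shiftr V W (f : V -> W) c x v : 'D_v (fun y => f (y + c)) x = 'D_v f (x + c).
Proof.
by rewrite /derive; under eq_fun do rewrite /= /shift -addrA.
Qed.

Lemma differentiable_shiftr V W (f : V -> W) c x :
  differentiable f (x + c) -> differentiable (fun y => f (y + c)) x.
Proof.
move=> df; apply: (@differentiable_comp _ _ _ _ (fun y => y + c) f) => //.
Qed.

Lemma line_derive V W (f : V -> W) y w (t : R) : differentiable f (y + t *: w) ->
  is_derive t 1 (fun s : R => f (y + s *: w)) ('D_w f (y + t *: w)).
Proof.
move=> df.
have dl : is_diff t (fun s : R => y + s *: w) (fun s => s *: w).
  have dw : is_diff t (fun s : R => s *: w) (fun s => s *: w).
    by split; [exact: (@differentiableZl _ _ _ id)|rewrite (@diffZl _ _ _ id) // diff_val].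
  have := is_diffD (is_diff_cst y t) dw.
  by rewrite add0r.
have dc : differentiable (fun s : R => f (y + s *: w)) t.
  by apply: (@differentiable_comp _ _ _ _ (fun s : R => y + s *: w) f) => //; case: dl.
split; first exact: diff_derivable.
rewrite deriveE // [RHS]deriveE //.
rewrite (_ : 'd _ t = 'd f (y + t *: w) \o 'd (fun s : R => y + s *: w) t :> (R -> W)) /=.
  by rewrite (@diff_val _ _ _ _ _ _ _ dl) scale1r.
by apply: (@diff_comp _ _ _ _ (fun s : R => y + s *: w) f) => //; case: dl.
Qed.

Lemma MVT_line V (f : V -> R) y w (s : R) : 0 < s ->
  (forall t : R, 0 <= t <= s -> differentiable f (y + t *: w)) ->
  exists2 t : R, 0 <= t <= s & f (y + s *: w) - f y = s * 'D_w f (y + t *: w).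
Proof.
move=> s0 df.
have D t : 0 <= t <= s -> is_derive t 1 (fun s : R => f (y + s *: w)) ('D_w f (y + t *: w)).
  by move=> /df; exact: line_derive.
have := @MVT R (fun s : R => f (y + s *: w)) (fun t => 'D_w f (y + t *: w)) 0 s s0.
case=> [t||t].
- by rewrite in_itv /= => /andP[t0 ts]; apply: D; rewrite !ltW.
- apply: derivable_within_continuous => t; rewrite in_itv /= => ts.
  by have [] := D t ts.
- rewrite in_itv /= => /andP[t0 ts] E; exists t; first by rewrite !ltW.
  by move: E; rewrite scale0r addr0 subr0 mulrC.
Qed.

(** Two uses of the mean value theorem: along [u] for y |-> f (y + s v) - f y, then along [v] for
    D_u f. *)
Lemma second_difference V (f : V -> R) x u v (s : R) (U : set V) :
  0 < s -> Ck_on 2 U f ->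
  (forall t t' : R, 0 <= t <= s -> 0 <= t' <= s -> U (x + t *: u + t' *: v)) ->
  exists t t' : R, [/\ 0 <= t <= s, 0 <= t' <= s &
    f (x + s *: u + s *: v) - f (x + s *: u) - (f (x + s *: v) - f x)
    = s * (s * 'D_v ('D_u f) (x + t *: u + t' *: v))].
Proof.
move=> s0 [df Df] xU.
have s0s : 0 <= s <= s by rewrite lexx ltW.
have s00 : 0 <= (0 : R) <= s by rewrite lexx ltW.
have dfx t t' : 0 <= t <= s -> 0 <= t' <= s -> differentiable f (x + t *: u + t' *: v).
  by move=> ht ht'; apply: df; exact: xU.
have dfx0 t : 0 <= t <= s -> differentiable f (x + t *: u).
  by move=> ht; rewrite -[_ + _]addr0 -(scale0r v); exact: dfx.
have [t ht E] : exists2 t : R, 0 <= t <= s &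
    (f (x + s *: u + s *: v) - f (x + s *: u)) - (f (x + s *: v) - f x) =
    s * 'D_u ((fun y => f (y + s *: v)) - f) (x + t *: u).
  apply: (@MVT_line _ ((fun y => f (y + s *: v)) - f)) => // t ht.
  apply: differentiableB; last exact: dfx0.
  by apply: differentiable_shiftr; exact: dfx.
exists t.
have [t' ht' E'] : exists2 t' : R, 0 <= t' <= s &
    'D_u f (x + t *: u + s *: v) - 'D_u f (x + t *: u) =
    s * 'D_v ('D_u f) (x + t *: u + t' *: v).
  by apply: (@MVT_line _ ('D_u f)) => // t' ht'; apply (Df u).1; exact: xU.
exists t'; split => //; rewrite E deriveB ?derive_shiftr ?E' //.
  by apply: diff_derivable; apply: differentiable_shiftr; exact: dfx.
by apply: diff_derivable; exact: dfx0.
Qed.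

(** Schwarz's theorem. The second difference is symmetric in [u] and [v], so D_v D_u f and D_u D_v f
    take a common value at two points of a small parallelogram at [x]; continuity brings both points
    to [x]. *)
Lemma derive_swap V (f : V -> R) x u v (U : set V) :
  open U -> U x -> Ck_on 2 U f -> 'D_u ('D_v f) x = 'D_v ('D_u f) x.
Proof.
move=> oU Ux Cf.
have dist_half (a b c e : R) : `|a - c| < e / 2 -> `|b - c| < e / 2 -> `|b - a| <= e.
  by rewrite ler_norml !ltr_norml => /andP[? ?] /andP[? ?]; apply/andP; split; lra.
have cancel_sq (a b c y z : R) :
    c != 0 -> y = c * (c * a) -> z = c * (c * b) -> y = z -> a = b.
  by move=> c0 -> -> /(mulfI c0)/(mulfI c0).
have cf a b : {for x, continuous ('D_a ('D_b f))}.
  by have [_ /(_ b)[_ /(_ a)]] := Cf; exact.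
apply/eqP; rewrite -subr_eq0 -normr_eq0; apply/eqP/le_anti/andP; split => //.
apply/ler_addgt0Pr => e e0; rewrite add0r.
have e20 : 0 < e / 2 by rewrite divr_gt0.
have /cvgrPdist_lt/(_ _ e20) h1 := cf u v.
have /cvgrPdist_lt/(_ _ e20) h2 := cf v u.
have /nbhs_ballP[r /= r0 hr] : nbhs x [set y | U y /\
    (`|'D_u ('D_v f) x - 'D_u ('D_v f) y| < e / 2 /\
     `|'D_v ('D_u f) x - 'D_v ('D_u f) y| < e / 2)].
  by apply: filterI (open_nbhs_nbhs (conj oU Ux)) _; exact: filterI h1 h2.
(* With this side the parallelogram stays in the ball of radius [r]; the term 1 keeps the
   denominator positive when [u] and [v] vanish. *)
pose s := r / 2 / (`|u| + `|v| + 1).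
have n0 : 0 < `|u| + `|v| + 1 by rewrite ltr_wpDl ?addr_ge0.
have s0 : 0 < s by rewrite !divr_gt0.
(* Stated for [a] and [b] so as to serve both orders of [u] and [v]. *)
have B a b (t t' : R) : `|a| + `|b| = `|u| + `|v| -> 0 <= t <= s -> 0 <= t' <= s ->
    ball x r (x + t *: a + t' *: b).
  move=> Eab /andP[t0 ts] /andP[t'0 t's]; rewrite -ball_normE /=.
  rewrite -addrA opprD addNKr normrN.
  apply: le_lt_trans (ler_normD _ _) _; rewrite !normrZ !ger0_norm //.
  have sr : s * (`|u| + `|v| + 1) < r.
    by rewrite /s divfK ?gt_eqF // ltr_pdivrMr // ltr_pMr // ltr1n.
  apply: le_lt_trans sr; rewrite -Eab mulrDr mulr1 mulrDr.
  apply: (@le_trans _ _ (s * `|a| + s * `|b|)); first by rewrite lerD // ler_wpM2r.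
  by rewrite lerDl ltW.
have [t1 [t1' [ht1 ht1' E1]]] := @second_difference _ f x u v s _ s0 Cf
  (fun t t' ht ht' => (hr _ (B u v t t' erefl ht ht')).1).
have [t2 [t2' [ht2 ht2' E2]]] := @second_difference _ f x v u s _ s0 Cf
  (fun t t' ht ht' => (hr _ (B v u t t' (addrC _ _) ht ht')).1).
have {E1 E2}E : 'D_v ('D_u f) (x + t1 *: u + t1' *: v) =
                'D_u ('D_v f) (x + t2 *: v + t2' *: u).
  have sn0 : s != 0 by rewrite gt_eqF.
  refine (cancel_sq _ _ _ _ _ sn0 E1 E2 _).
  by rewrite (addrAC x (s *: u)); ring.
have [_ [_ /= B1]] := hr _ (B _ _ _ _ erefl ht1 ht1').
have [_ [/= B2 _]] := hr _ (B _ _ _ _ (addrC _ _) ht2 ht2').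
move: B1 B2; rewrite E; move: ('D_v _ x) ('D_u _ x) ('D_u _ _) => a b c h1' h2'.
exact: dist_half h1' h2'.
Qed.

Lemma derive_swap_row V m (f : V -> 'rV[R]_m) x u v (U : set V) :
  open U -> U x -> Ck_on 2 U f -> 'D_u ('D_v f) x = 'D_v ('D_u f) x.
Proof.
move=> oU Ux Cf; apply/rowP => j.
have df y : U y -> differentiable f y by have [df _] := Cf; exact: df.
have dDf w : differentiable ('D_w f) x by have [_ /(_ w)[dDf _]] := Cf; exact: dDf.
etransitivity; first exact: (derive_row u j (dDf v)).
apply/esym; etransitivity; first exact: (derive_row v j (dDf u)).
have E w : \near x, ('D_w f x) 0 j = 'D_w (fun y => f y 0 j : R) x.
  by apply: near_open Ux _ => // y Uy; rewrite derive_row //; exact: df.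
rewrite (near_eq_derive _ (E u)) (near_eq_derive _ (E v)).
by apply: derive_swap (Ux) _ => //; exact: Ck_on_coord.
Qed.

Lemma ball_cst V (f : V -> R) x (r : R) :
  (forall y, ball x r y -> differentiable f y) ->
  (forall y v, ball x r y -> 'D_v f y = 0) ->
  forall y, ball x r y -> f y = f x.
Proof.
move=> df Df y xy.
have B t : 0 <= t <= (1 : R) -> ball x r (x + t *: (y - x)).
  move=> /andP[t0 t1]; move: xy; rewrite -!ball_normE /=.
  rewrite opprD addNKr normrN normrZ ger0_norm // distrC.
  by apply: le_lt_trans; rewrite ler_piMl.
have [|t ht] := @MVT_line _ f x (y - x) 1 ltr01; first by move=> t ht; apply/df/B.
by rewrite scale1r [x + _]addrC subrK Df ?mulr0; [move=> /eqP; rewrite subr_eq0 => /eqP|exact: B].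
Qed.

Section Smooth.
Context {V W : normedModType R}.
Implicit Types (U : set V).

Lemma smooth_onS U U' (f : V -> W) : U' `<=` U -> smooth_on U f -> smooth_on U' f.
Proof. by move=> UU' sf k; exact: Ck_onS (sf k). Qed.

Lemma smooth_on_local U (f : V -> W) :
  (forall x, U x -> exists2 U' : set V, U' x & smooth_on U' f) -> smooth_on U f.
Proof. by move=> H k; apply: Ck_on_local => x /H[U' U'x sf]; exists U'. Qed.

Lemma smooth_on_eq U (f g : V -> W) : open U ->
  (forall x, U x -> f x = g x) -> smooth_on U f -> smooth_on U g.
Proof. by move=> oU fg sf k; exact: Ck_on_eq (sf k). Qed.

Lemma smooth_on_cst U (a : W) : smooth_on U (cst a : V -> W).
Proof. by move=> k; exact: Ck_on_cst. Qed.

Lemma smooth_onD U (f g : V -> W) : open U ->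
  smooth_on U f -> smooth_on U g -> smooth_on U (fun x => f x + g x).
Proof. by move=> oU sf sg k; exact: (Ck_onD oU (sf k) (sg k)). Qed.

Lemma smooth_onN U (f : V -> W) : open U ->
  smooth_on U f -> smooth_on U (fun x => - f x).
Proof. by move=> oU sf k; exact: (Ck_onN oU (sf k)). Qed.

Lemma smooth_onB U (f g : V -> W) : open U ->
  smooth_on U f -> smooth_on U g -> smooth_on U (fun x => f x - g x).
Proof. by move=> oU sf sg; apply: smooth_onD => //; exact: smooth_onN. Qed.

Lemma smooth_on_derive U (f : V -> W) v : smooth_on U f -> smooth_on U ('D_v f).
Proof. by move=> sf k; have [_] := sf k.+1; exact. Qed.

Lemma smooth_on_differentiable U (f : V -> W) x : U x -> smooth_on U f -> differentiable f x.
Proof. by move=> Ux /(_ 1)[df _]; exact: df. Qed.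

Lemma smooth_on_continuous U (f : V -> W) x : U x -> smooth_on U f -> {for x, continuous f}.
Proof. by move=> Ux /(_ 0)/(_ x Ux). Qed.

End Smooth.

Section SmoothReal.
Context {V : normedModType R}.
Implicit Types (U : set V).

Lemma smooth_onM U (f g : V -> R) : open U ->
  smooth_on U f -> smooth_on U g -> smooth_on U (fun x => f x * g x).
Proof. by move=> oU sf sg k; exact: (Ck_onM oU (sf k) (sg k)). Qed.

Lemma smooth_onV U (f : V -> R) : open U -> (forall x, U x -> f x != 0) ->
  smooth_on U f -> smooth_on U (fun x => (f x)^-1).
Proof. by move=> oU f0 sf k; exact: (Ck_onV oU f0 (sf k)). Qed.

Lemma smooth_on_sum U n (f : 'I_n -> V -> R) : open U ->
  (forall i, smooth_on U (f i)) -> smooth_on U (fun x => \sum_i f i x).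
Proof.
move=> oU sf k; have := Ck_on_sum oU (fun i => sf i k).
by rewrite (_ : \sum_i f i = fun x => \sum_i f i x) //; apply/funext => x; rewrite fct_sumE.
Qed.

Lemma smooth_on_row U m (f : V -> 'rV[R]_m) : open U ->
  (forall j, smooth_on U (fun x => f x 0 j : R)) -> smooth_on U f.
Proof. by move=> oU sf k; apply: Ck_on_row => // j; exact: sf. Qed.

Lemma smooth_on_coord U m (f : V -> 'rV[R]_m) j : open U ->
  smooth_on U f -> smooth_on U (fun x => f x 0 j : R).
Proof. by move=> oU sf k; exact: Ck_on_coord. Qed.

Lemma smooth_on_comp U m (U' : set 'rV[R]_m) (f : V -> 'rV[R]_m) (g : 'rV[R]_m -> R) :
  open U -> (forall x, U x -> U' (f x)) ->
  smooth_on U f -> smooth_on U' g -> smooth_on U (g \o f).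
Proof. by move=> oU fU sf sg k; exact: (@Ck_on_comp _ _ _ _ U'). Qed.

Lemma smooth_on_compr U m p (U' : set 'rV[R]_m) (f : V -> 'rV[R]_m)
    (g : 'rV[R]_m -> 'rV[R]_p) :
  open U -> open U' -> (forall x, U x -> U' (f x)) ->
  smooth_on U f -> smooth_on U' g -> smooth_on U (g \o f).
Proof. by move=> oU oU' fU sf sg k; exact: (@Ck_on_compr _ _ _ _ _ U'). Qed.

End SmoothReal.

Lemma smooth_on_linear m (W : normedModType R) U (f : 'rV[R]_m -> W) :
  linear f -> smooth_on U f.
Proof. by move=> lf k; exact: Ck_on_linear. Qed.

Lemma smooth_on_id m U : smooth_on U (id : 'rV[R]_m -> 'rV[R]_m).
Proof. exact: smooth_on_linear. Qed.

Lemma smooth_derive_swap V m (f : V -> 'rV[R]_m) x u v (U : set V) :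
  open U -> U x -> smooth_on U f -> 'D_u ('D_v f) x = 'D_v ('D_u f) x.
Proof. by move=> oU Ux /(_ 2); exact: derive_swap_row. Qed.

Lemma smooth_derive_swapR V (f : V -> R) x u v (U : set V) :
  open U -> U x -> smooth_on U f -> 'D_u ('D_v f) x = 'D_v ('D_u f) x.
Proof. by move=> oU Ux /(_ 2); exact: derive_swap. Qed.

End Calculus.

Section EuclideanMaps.
Context {R : realType}.

Lemma diff_compE (U V W : normedModType R) (f : U -> V) (g : V -> W) x v :
  differentiable f x -> differentiable g (f x) ->
  'd (g \o f) x v = 'd g (f x) ('d f x v).
Proof. by move=> df dg; rewrite diff_comp. Qed.

Lemma open_preimage_on (V W : topologicalType) (U : set V) (O : set W) (f : V -> W) :
  open U -> open O -> (forall x, U x -> {for x, continuous f}) ->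
  open (U `&` f @^-1` O).
Proof.
move=> oU oO cf; rewrite openE => x [Ux Ofx]; rewrite /interior.
apply: filterI; first exact: open_nbhs_nbhs.
by apply: (cf x Ux); exact: open_nbhs_nbhs.
Qed.

Lemma smooth_lsubmx m n (U : set 'rV[R]_(m + n)) :
  smooth_on U (lsubmx : 'rV[R]_(m + n) -> 'rV[R]_m).
Proof. by apply: smooth_on_linear; exact: linearP. Qed.

Lemma smooth_rsubmx m n (U : set 'rV[R]_(m + n)) :
  smooth_on U (rsubmx : 'rV[R]_(m + n) -> 'rV[R]_n).
Proof. by apply: smooth_on_linear; exact: linearP. Qed.

Lemma smooth_row_mx (V : normedModType R) m n (U : set V) (f : V -> 'rV[R]_m)
    (g : V -> 'rV[R]_n) : open U ->
  smooth_on U f -> smooth_on U g -> smooth_on U (fun x => row_mx (f x) (g x)).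
Proof.
move=> oU sf sg; apply: smooth_on_row => // j; rewrite -(splitK j).
case: (fintype.split j) => l /=.
  by under [X in smooth_on _ X]eq_fun do rewrite row_mxEl; exact: smooth_on_coord.
by under [X in smooth_on _ X]eq_fun do rewrite row_mxEr; exact: smooth_on_coord.
Qed.

Lemma open_lsubmx m n (U : set 'rV[R]_m) : open U ->
  open [set y : 'rV[R]_(m + n) | U (lsubmx y)].
Proof. by move=> oU; apply: open_comp => // x _; exact: continuous_lsubmx. Qed.

Lemma open_rsubmx m n (U : set 'rV[R]_n) : open U ->
  open [set y : 'rV[R]_(m + n) | U (rsubmx y)].
Proof. by move=> oU; apply: open_comp => // x _; exact: continuous_rsubmx. Qed.

End EuclideanMaps.

Section EuclideanDerivatives.
Context {R : realType}.

Lemma derive_ext (V W : normedModType R) (f g : V -> W) x v :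
  (forall y, f y = g y) -> 'D_v f x = 'D_v g x.
Proof. by move=> fg; have -> : f = g by apply/funext. Qed.

(** The two difference quotients are the same function of the step. *)
Lemma derive_slice1 (W : normedModType R) k m (g : 'rV[R]_(k + m) -> W) x z v :
  'D_v (fun y => g (row_mx y z)) x = 'D_(row_mx v 0) g (row_mx x z).
Proof.
rewrite /derive; set F := fun s => _; set G := (X in _ = lim (X @ _)).
suff -> : F = G by []; apply/funext => s; rewrite /F /G /=.
by rewrite scale_row_mx scaler0 add_row_mx add0r.
Qed.

Lemma derive_slice2 (W : normedModType R) k m (g : 'rV[R]_(k + m) -> W) x z v :
  'D_v (fun y => g (row_mx z y)) x = 'D_(row_mx 0 v) g (row_mx z x).
Proof.
rewrite /derive; set F := fun s => _; set G := (X in _ = lim (X @ _)).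
suff -> : F = G by []; apply/funext => s; rewrite /F /G /=.
by rewrite scale_row_mx scaler0 add_row_mx add0r.
Qed.

(** This is the shape of the fibre coordinates of a cotangent lift: momenta [p] contracted with
    partial derivatives of the inverse map [g], taken at a moving point [s]. *)
Lemma smooth_fiber (V : normedModType R) k m n (U : set V) (U' : set 'rV[R]_k)
    (p : V -> 'rV[R]_m) (s : V -> 'rV[R]_k) (g : 'rV[R]_k -> 'rV[R]_m)
    (e : 'I_n -> 'rV[R]_k) : open U -> open U' -> (forall x, U x -> U' (s x)) ->
  smooth_on U p -> smooth_on U s -> smooth_on U' g ->
  smooth_on U (fun y => \row_l \sum_t p y 0 t * ('D_(e l) g (s y)) 0 t).
Proof.
move=> oU oU' sU sp ss sg; apply: smooth_on_row => // l.
under [X in smooth_on _ X]eq_fun do rewrite mxE.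
apply: smooth_on_sum => // t; apply: smooth_onM => //; first exact: smooth_on_coord.
apply: (@smooth_on_comp _ _ U _ U' s (fun z => ('D_(e l) g z) 0 t : R)) => //.
by apply: smooth_on_coord => //; exact: smooth_on_derive.
Qed.

End EuclideanDerivatives.

(** * The pairing of momenta with velocities and the standard symplectic form *)

Section LinearDerivatives.
Context {R : realType}.

Lemma derive_linear_comp (V W : normedModType R) m (l : 'rV[R]_m -> W) (f : V -> 'rV[R]_m) x v :
  linear l -> differentiable f x -> 'D_v (fun y => l (f y)) x = l ('D_v f x).
Proof.
move=> ll df; apply: etrans (derive_comp v df (linear_fun_differentiable _ ll)) _.
exact: linear_fun_derive.
Qed.

Lemma differentiable_linear_comp (V W : normedModType R) m (l : 'rV[R]_m -> W)
    (f : V -> 'rV[R]_m) x :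
  linear l -> differentiable f x -> differentiable (fun y => l (f y)) x.
Proof.
move=> ll df; apply: (@differentiable_comp _ _ _ _ f l) => //.
exact: linear_fun_differentiable.
Qed.

Definition dot m (p v : 'rV[R]_m) : R := \sum_j p 0 j * v 0 j.

Lemma dotC m (p v : 'rV[R]_m) : dot p v = dot v p.
Proof. by apply: eq_bigr => j _; rewrite mulrC. Qed.

Lemma dot_linear m (p : 'rV[R]_m) : linear (dot p : 'rV[R]_m -> R).
Proof.
move=> a u v; rewrite /dot scaler_sumr -big_split /=; apply: eq_bigr => j _.
by rewrite !mxE mulrDr; congr (_ + _); rewrite mulrCA.
Qed.

Lemma dot0l m (v : 'rV[R]_m) : dot 0 v = 0.
Proof. by rewrite /dot big1 // => j _; rewrite mxE mul0r. Qed.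

Lemma dot0r m (v : 'rV[R]_m) : dot v 0 = 0.
Proof. by rewrite dotC dot0l. Qed.

Lemma derive_dot (V : normedModType R) m (f g : V -> 'rV[R]_m) x v :
  differentiable f x -> differentiable g x ->
  'D_v (fun y => dot (f y) (g y)) x = dot ('D_v f x) (g x) + dot (f x) ('D_v g x).
Proof.
move=> df dg.
have E : (fun y => dot (f y) (g y)) =
    \sum_(j < m) ((fun y => f y 0 j : R) * (fun y => g y 0 j : R)).
  by apply/funext => y; rewrite fct_sumE.
have dj (h : V -> 'rV[R]_m) j : differentiable h x -> derivable (fun y => h y 0 j : R) x v.
  by move=> dh; apply: diff_derivable; exact: differentiable_rowP.
rewrite E derive_sum => [|j]; last by apply: derivableM; exact: dj.
rewrite /dot -big_split /=; apply: eq_bigr => j _.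
rewrite deriveM; [|exact: dj|exact: dj].
by rewrite !derive_row // addrC; congr (_ + _); rewrite -[_ *: _]/(_ * _) mulrC.
Qed.

Lemma smooth_dot (V : normedModType R) m (U : set V) (f g : V -> 'rV[R]_m) : open U ->
  smooth_on U f -> smooth_on U g -> smooth_on U (fun y => dot (f y) (g y)).
Proof.
move=> oU sf sg; apply: smooth_on_sum => // j.
by apply: smooth_onM => //; exact: smooth_on_coord.
Qed.

(* In the coordinates (q, p), as in [cotangent_structure]. *)
Definition std_symplectic m (u v : 'rV[R]_(m + m)) : R :=
  dot (lsubmx u) (rsubmx v) - dot (rsubmx u) (lsubmx v).

(* Differentiate the hypothesis along u, antisymmetrize in (u, v): the second   *)
(* derivatives of f cancel.                                                     *)
Lemma liouville_preserving_symplectic m (U : set 'rV[R]_(m + m))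
    (f : 'rV[R]_(m + m) -> 'rV[R]_(m + m)) y u v :
  open U -> smooth_on U f ->
  (forall z w, U z -> dot (rsubmx (f z)) (lsubmx ('D_w f z)) = dot (rsubmx z) (lsubmx w)) ->
  U y -> std_symplectic ('D_u f y) ('D_v f y) = std_symplectic u v.
Proof.
move=> oU sf H Uy.
have key a b : dot (rsubmx a) (lsubmx b) =
    dot (rsubmx ('D_a f y)) (lsubmx ('D_b f y)) + dot (rsubmx (f y)) (lsubmx ('D_a ('D_b f) y)).
  have df : differentiable f y by exact: smooth_on_differentiable Uy sf.
  have dDf : differentiable ('D_b f) y.
    by apply: (smooth_on_differentiable Uy); exact: smooth_on_derive.
  have lr : linear (rsubmx : 'rV[R]_(m + m) -> 'rV[R]_m) by exact: linearP.
  have ll : linear (lsubmx : 'rV[R]_(m + m) -> 'rV[R]_m) by exact: linearP.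
  have E1 : 'D_a (fun z => dot (rsubmx (f z)) (lsubmx ('D_b f z))) y =
      dot (rsubmx ('D_a f y)) (lsubmx ('D_b f y)) + dot (rsubmx (f y)) (lsubmx ('D_a ('D_b f) y)).
    have Er : 'D_a (fun z => rsubmx (f z)) y = rsubmx ('D_a f y) by exact: derive_linear_comp.
    have El : 'D_a (fun z => lsubmx ('D_b f z)) y = lsubmx ('D_a ('D_b f) y).
      exact: derive_linear_comp.
    rewrite -Er -El; apply: derive_dot; first exact: differentiable_linear_comp.
    exact: differentiable_linear_comp.
  rewrite -E1; symmetry.
  have l2 : linear (fun z : 'rV[R]_(m + m) => dot (rsubmx z) (lsubmx b) : R).
    by move=> c z w; rewrite linearP dotC dot_linear ![dot (lsubmx b) _]dotC.
  apply: etrans _ (linear_fun_derive y a l2).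
  by apply: near_eq_derive; apply: filterS (open_nbhs_nbhs (conj oU Uy)) => z; exact: H.
have S := congr1 (fun w => dot (rsubmx (f y)) (lsubmx w)) (smooth_derive_swap u v oU Uy sf).
have comb (a b c d s t : R) : c = a + s -> d = b + t -> s = t -> b - a = d - c.
  by move=> -> -> ->; ring.
rewrite /std_symplectic (dotC (lsubmx u)) (dotC (lsubmx ('D_u f y))).
exact: comb (key u v) (key v u) S.
Qed.

End LinearDerivatives.

(** * Maps between manifolds in charts *)

(* What the calculus in charts uses of [manifold]; it is immediate for products. *)
Record charted (R : realType) (m : nat) (M : choiceType)
  (A : smooth_structure R m M) : Prop := Charted {
  charted_open : forall i : cidx A, open (cimg i);
  charted_cmap : forall (i : cidx A) x, cdom i x -> cimg i (cmap i x);
  charted_cinv : forall (i : cidx A) y, cimg i y -> cdom i (cinv i y);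
  charted_cmapK : forall (i : cidx A) x, cdom i x -> cinv i (cmap i x) = x;
  charted_cinvK : forall (i : cidx A) y, cimg i y -> cmap i (cinv i y) = y;
  charted_chart_at : forall x, cdom (chart_at A x) x }.

Arguments charted_open {R m M A} _ i.
Arguments manifold_overlap {R m M A} _ i j.
Arguments manifold_transition {R m M A} _ i j.

Lemma manifold_charted (R : realType) (m : nat) (M : choiceType)
  (A : smooth_structure R m M) : manifold A -> charted A.
Proof. by case. Qed.

Lemma prod_charted (R : realType) (m n : nat) (M N : choiceType)
    (A : smooth_structure R m M) (B : smooth_structure R n N) :
  charted A -> charted B -> charted (prod_structure A B).
Proof.
move=> cA cB; split.
- move=> [i j]; apply: openI; first exact/open_lsubmx/charted_open.
  exact/open_rsubmx/charted_open.
- move=> [i j] [x y] [/= ix jy]; rewrite row_mxKl row_mxKr.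
  by split; exact: charted_cmap.
- by move=> [i j] y [/= iy jy]; split; exact: charted_cinv.
- by move=> [i j] [x y] [/= ix jy]; rewrite row_mxKl row_mxKr !charted_cmapK.
- by move=> [i j] y [/= iy jy]; rewrite !charted_cinvK // hsubmxK.
- by move=> [x y]; split; exact: charted_chart_at.
Qed.

Section SmoothMap.
Context {R : realType} {m n : nat} {M N : choiceType}.
Context {A : smooth_structure R m M} {B : smooth_structure R n N}.
Implicit Types (i : cidx A) (j : cidx B).

Definition rep (f : M -> N) i j : 'rV[R]_m -> 'rV[R]_n := cmap j \o f \o cinv i.

Definition rep_dom (f : M -> N) i j : set 'rV[R]_m :=
  cimg i `&` (f \o cinv i) @^-1` cdom j.

Lemma rep_open (f : M -> N) i j : smooth_map A B f -> open (rep_dom f i j).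
Proof. by move=> /(_ i j)[]. Qed.

Lemma rep_smooth (f : M -> N) i j : smooth_map A B f -> smooth_on (rep_dom f i j) (rep f i j).
Proof. by move=> /(_ i j)[]. Qed.
Arguments rep_open {f} i j _.
Arguments rep_smooth {f} i j _.

Lemma rep_dom_cmap (f : M -> N) i j x : charted A -> cdom i x -> cdom j (f x) ->
  rep_dom f i j (cmap i x).
Proof. by move=> cA ix jfx; split; [exact: charted_cmap|rewrite /= charted_cmapK]. Qed.

(** The differential between arbitrary charts; [tmap] is the case of the preferred charts
    ([tmapE]). *)
Definition ldiff (f : M -> N) i j (x : M) : 'rV[R]_m -> 'rV[R]_n :=
  'd (rep f i j) (cmap i x).

Lemma rep_differentiable (f : M -> N) i j x : charted A -> smooth_map A B f ->
  cdom i x -> cdom j (f x) -> differentiable (rep f i j) (cmap i x).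
Proof.
move=> cA sf ix jfx; apply: smooth_on_differentiable (rep_smooth i j sf).
exact: rep_dom_cmap.
Qed.

Lemma ldiffE (f : M -> N) i j x v : charted A -> smooth_map A B f ->
  cdom i x -> cdom j (f x) -> ldiff f i j x v = 'D_v (rep f i j) (cmap i x).
Proof. by move=> cA sf ix jfx; rewrite deriveE //; exact: rep_differentiable. Qed.

Lemma tmapE (f : M -> N) x v :
  tmap A B f x v = ldiff f (chart_at A x) (chart_at B (f x)) x v.
Proof. by rewrite lfunE. Qed.

End SmoothMap.

Arguments rep_open {R m n M N A B f} i j _.
Arguments rep_smooth {R m n M N A B f} i j _.

Section Charts.
Context {R : realType} {m : nat} {M : choiceType} {A : smooth_structure R m M}.
Hypothesis mA : manifold A.
Let cA := manifold_charted mA.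

(** Smoothness of the identity is the compatibility of the charts. Through it every change of chart
    becomes an instance of the chain rule. *)
Lemma smooth_map_id : smooth_map A A id.
Proof.
move=> i j; split; first exact: (manifold_overlap mA).
exact: (manifold_transition mA).
Qed.

Lemma ldiff_id (i : cidx A) x v : cdom i x -> @ldiff R m m M M A A id i i x v = v.
Proof.
move=> ix; rewrite /ldiff.
have := @differentiable_near_eq _ _ _ id (rep (id : M -> M) i i) (cmap i x).
case=> [||_ ->] //; last by rewrite diff_val.
refine (near_open (charted_open cA i) (charted_cmap cA ix) _) => y iy.
by rewrite /rep /= charted_cinvK.
Qed.

(** [tvec], and likewise [tcoord] below, is the differential of the identity read in two charts. *)
Lemma tvecE (i : cidx A) x v : cdom i x ->
  tvec i (cmap i x) v = @ldiff R m m M M A A id i (chart_at A x) x v.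
Proof. by move=> ix; rewrite lfunE /= charted_cmapK. Qed.

Lemma tcoordE (i : cidx A) x v :
  tcoord i x v = @ldiff R m m M M A A id (chart_at A x) i x v.
Proof. by rewrite lfunE. Qed.

End Charts.

Section Composition.
Context {R : realType} {m n p : nat} {M N P : choiceType}.
Context {A : smooth_structure R m M} {B : smooth_structure R n N}.
Context {C : smooth_structure R p P}.

Lemma smooth_map_comp (f : M -> N) (g : N -> P) : charted B ->
  smooth_map A B f -> smooth_map B C g -> smooth_map A C (g \o f).
Proof.
move=> cB sf sg i l.
(* The points whose image by [f] is seen in the intermediate chart [j]: these open sets cover the
   domain of the composite, and on each the composite is a composite of representatives. *)
pose U (j : cidx B) : set 'rV[R]_m := rep_dom f i j `&` rep f i j @^-1` (rep_dom g j l).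
have oU j : open (U j).
  apply: open_preimage_on; [exact: rep_open|exact: rep_open|].
  by move=> y Uy; apply: smooth_on_continuous Uy _; exact: rep_smooth.
have UE y : cimg i y -> cdom l (g (f (cinv i y))) -> U (chart_at B (f (cinv i y))) y.
  move=> iy ly; have jy := charted_chart_at cB (f (cinv i y)).
  do ![split => //=]; first exact: charted_cmap.
  by rewrite charted_cmapK.
have UV j y : U j y -> cimg i y /\ cdom l (g (f (cinv i y))).
  by move=> [[iy jy] [_]]; rewrite /rep /= charted_cmapK.
split.
  rewrite openE => y [iy ly]; rewrite /interior.
  apply: filterS (open_nbhs_nbhs (conj (oU _) (UE _ iy ly))) => z /UV[iz lz].
  by split.
apply: smooth_on_local => y [iy ly]; exists (U (chart_at B (f (cinv i y)))).
  exact: UE.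
set j := chart_at B _.
apply: (@smooth_on_eq _ _ _ _ (rep g j l \o rep f i j)) => // [z [[iz jz] _]|].
  by rewrite /rep /= charted_cmapK.
apply: (@smooth_on_compr _ _ _ _ _ (rep_dom g j l)) => //.
- exact: rep_open.
- by move=> z [].
- by apply: smooth_onS (rep_smooth i j sf) => z [].
- exact: rep_smooth.
Qed.

Lemma ldiff_comp (f : M -> N) (g : N -> P) i j l x v : charted A -> charted B ->
  smooth_map A B f -> smooth_map B C g ->
  cdom i x -> cdom j (f x) -> cdom l (g (f x)) ->
  ldiff (A := A) (B := C) (g \o f) i l x v
  = ldiff (A := B) (B := C) g j l (f x) (ldiff (A := A) (B := B) f i j x v).
Proof.
move=> cA cB sf sg ix jx lx.
have df := rep_differentiable cA sf ix jx.
have fE : rep (A := A) (B := B) f i j (cmap i x) = cmap j (f x).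
  by rewrite /rep /= charted_cmapK.
have dg : differentiable (rep (A := B) (B := C) g j l) (rep (A := A) (B := B) f i j (cmap i x)).
  by rewrite fE; exact: rep_differentiable.
have := @differentiable_near_eq _ _ _ (rep (A := B) (B := C) g j l \o rep (A := A) (B := B) f i j)
  (rep (A := A) (B := C) (g \o f) i l) (cmap i x).
case=> [||_ E].
- refine (near_open (rep_open i j sf) (rep_dom_cmap cA ix jx) _) => y [iy jy].
  by rewrite /rep /= charted_cmapK.
- exact: differentiable_comp.
- rewrite /ldiff; apply: etrans (congr1 (@^~ v) E) _.
  by rewrite -fE; exact: diff_compE.
Qed.

Lemma tmap_comp (f : M -> N) (g : N -> P) x v : charted A -> charted B -> charted C ->
  smooth_map A B f -> smooth_map B C g ->
  tmap A C (g \o f) x v = tmap B C g (f x) (tmap A B f x v).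
Proof.
move=> cA cB cC sf sg; rewrite !tmapE.
by apply: ldiff_comp => //; exact: charted_chart_at.
Qed.

End Composition.

(* Unification otherwise unfolds these without end. *)
#[local] Opaque derive diff tvec tcoord tmap fun_of_lfun.

Section Conversions.
Context {R : realType} {m : nat} {M : choiceType}.
Context {A : smooth_structure R m M}.
Hypotheses (mA : manifold A).
Let cA := manifold_charted mA.
Implicit Types (i : cidx A).

Lemma tvecK i x v : cdom i x -> tcoord i x (tvec i (cmap i x) v) = v.
Proof.
move=> ix; have xx := charted_chart_at cA x.
apply: etrans (congr1 (tcoord i x) (tvecE mA v ix)) _; apply: etrans (tcoordE _ _ _) _.
apply: etrans _ (ldiff_id mA v ix); apply/esym.
by apply: (@ldiff_comp _ _ _ _ _ _ _ A A A id id) => //; exact: smooth_map_id.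
Qed.

Lemma tcoordK i x v : cdom i x -> tvec i (cmap i x) (tcoord i x v) = v.
Proof.
move=> ix; have xx := charted_chart_at cA x.
apply: etrans (congr1 (tvec i (cmap i x)) (tcoordE _ _ _)) _.
apply: etrans (tvecE mA _ ix) _.
apply: etrans _ (ldiff_id mA v xx); apply/esym.
by apply: (@ldiff_comp _ _ _ _ _ _ _ A A A id id) => //; exact: smooth_map_id.
Qed.

Lemma tvec_chart_at x v : tvec (chart_at A x) (cmap (chart_at A x) x) v = v.
Proof.
by have xx := charted_chart_at cA x; rewrite tvecE // ldiff_id.
Qed.

Lemma tcoord_chart_at x v : tcoord (chart_at A x) x v = v.
Proof.
by have xx := charted_chart_at cA x; rewrite tcoordE ldiff_id.
Qed.

Lemma tmap_id x v : tmap A A id x v = v.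
Proof. by rewrite tmapE ldiff_id //; exact: charted_chart_at. Qed.

End Conversions.

Section TangentMaps.
Context {R : realType} {m n : nat} {M N : choiceType}.
Context {A : smooth_structure R m M} {B : smooth_structure R n N}.
Hypotheses (mA : manifold A) (mB : manifold B).
Let cA := manifold_charted mA.
Let cB := manifold_charted mB.
Implicit Types (i : cidx A) (j : cidx B).

(** Both sides differentiate [f] from chart [i] to the preferred chart at [f x], factored as
    [f \o id] on the left and as [id \o f] on the right. *)
Lemma tmap_tvec (f : M -> N) i j x v : smooth_map A B f -> cdom i x -> cdom j (f x) ->
  tmap A B f x (tvec i (cmap i x) v) = tvec j (cmap j (f x)) (ldiff f i j x v).
Proof.
move=> sf ix jx; have xx := charted_chart_at cA x; have fx := charted_chart_at cB (f x).
rewrite tmapE !tvecE //.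
rewrite -(@ldiff_comp _ _ _ _ _ _ _ A A B id f) //; last exact: smooth_map_id.
by rewrite -(@ldiff_comp _ _ _ _ _ _ _ A B B f id) //; exact: smooth_map_id.
Qed.

Lemma tcoord_tmap (f : M -> N) i j x v : smooth_map A B f -> cdom i x -> cdom j (f x) ->
  tcoord j (f x) (tmap A B f x (tvec i (cmap i x) v)) = ldiff f i j x v.
Proof.
move=> sf ix jx; rewrite (tmap_tvec _ sf ix jx).
have fx := charted_chart_at cB (f x); exact: tvecK.
Qed.

End TangentMaps.

Section ScalarFunctions.
Context {R : realType} {m n : nat} {M N : choiceType}.
Context {A : smooth_structure R m M} {B : smooth_structure R n N}.
Implicit Types (i : cidx A) (j : cidx B).

Lemma smooth_fun_comp (f : M -> N) (g : N -> R) : charted A -> charted B ->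
  smooth_map A B f -> smooth_fun B g -> smooth_fun A (g \o f).
Proof.
move=> cA cB sf sg i; apply: smooth_on_local => y iy.
set j := chart_at B (f (cinv i y)); exists (rep_dom f i j).
  by split => //; exact: charted_chart_at.
apply: (@smooth_on_eq _ _ _ _ ((g \o cinv j) \o rep f i j)) => [|z [iz jz]|].
- exact: rep_open.
- by rewrite /rep /= charted_cmapK.
- apply: (@smooth_on_comp _ _ _ _ (cimg j)) => //.
  + exact: rep_open.
  + by move=> z [iz jz]; exact: charted_cmap.
  + exact: rep_smooth.
Qed.

Lemma derive_fun_comp (f : M -> N) (g : N -> R) i j x v : charted A -> charted B ->
  smooth_map A B f -> smooth_fun B g -> cdom i x -> cdom j (f x) ->
  'D_v (g \o f \o cinv i) (cmap i x) = 'D_(ldiff f i j x v) (g \o cinv j) (cmap j (f x)).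
Proof.
move=> cA cB sf sg ix jx.
have df := rep_differentiable cA sf ix jx.
have fE : rep f i j (cmap i x) = cmap j (f x) by rewrite /rep /= charted_cmapK.
have dg : differentiable (g \o cinv j) (rep f i j (cmap i x)).
  rewrite fE; apply: smooth_on_differentiable (sg j).
  exact: charted_cmap.
rewrite ldiffE // -fE -derive_comp //.
apply: near_eq_derive.
apply: filterS (open_nbhs_nbhs (conj (rep_open i j sf) (rep_dom_cmap cA ix jx))).
by move=> y [iy jy]; rewrite /rep /= charted_cmapK.
Qed.

Lemma smooth_fun_differentiable (g : M -> R) i x : charted A -> smooth_fun A g ->
  cdom i x -> differentiable (g \o cinv i) (cmap i x).
Proof.
by move=> cA sg ix; apply: smooth_on_differentiable (sg i); exact: charted_cmap.
Qed.

Lemma fdiffE (g : M -> R) x v : charted A -> smooth_fun A g ->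
  fdiff A g x v = 'D_v (g \o cinv (chart_at A x)) (cmap (chart_at A x) x).
Proof.
move=> cA sg; rewrite lfunE /= deriveE //.
by apply: smooth_fun_differentiable => //; exact: charted_chart_at.
Qed.

End ScalarFunctions.

Section FdiffComp.
Context {R : realType} {m n : nat} {M N : choiceType}.
Context {A : smooth_structure R m M} {B : smooth_structure R n N}.

Lemma fdiff_comp (f : M -> N) (g : N -> R) x v : charted A -> charted B ->
  smooth_map A B f -> smooth_fun B g ->
  fdiff A (g \o f) x v = fdiff B g (f x) (tmap A B f x v).
Proof.
move=> cA cB sf sg; have sgf := smooth_fun_comp cA cB sf sg.
rewrite (fdiffE _ _ cA sgf) (fdiffE _ _ cB sg) tmapE -derive_fun_comp //; exact: charted_chart_at.
Qed.

Lemma fdiff_tvec (g : M -> R) (i : cidx A) x v : manifold A -> smooth_fun A g -> cdom i x ->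
  fdiff A g x (tvec i (cmap i x) v) = 'D_v (g \o cinv i) (cmap i x).
Proof.
move=> mA sg ix; have cA := manifold_charted mA.
have xx := charted_chart_at cA x.
rewrite fdiffE // tvecE //.
by rewrite -(@derive_fun_comp _ _ _ _ _ A A id) //; exact: smooth_map_id.
Qed.

End FdiffComp.

Section FdiffLemmas.
Context {R : realType} {m : nat} {M : choiceType} {A : smooth_structure R m M}.
Hypothesis cA : charted A.

Lemma smooth_fun_cst (c : R) : smooth_fun A (fun=> c : R).
Proof. by move=> i; exact: smooth_on_cst. Qed.

Lemma smooth_fun_add (f g : M -> R) : smooth_fun A f -> smooth_fun A g ->
  smooth_fun A (fun x => f x + g x).
Proof. by move=> sf sg i; apply: smooth_onD; [exact: (charted_open cA)|exact: sf|exact: sg]. Qed.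

Lemma smooth_fun_mul (f g : M -> R) : smooth_fun A f -> smooth_fun A g ->
  smooth_fun A (fun x => f x * g x).
Proof. by move=> sf sg i; apply: smooth_onM; [exact: (charted_open cA)|exact: sf|exact: sg]. Qed.

Let fr (f : M -> R) x : 'rV[R]_m -> R := f \o cinv (chart_at A x).

Let dfr (f : M -> R) x v : smooth_fun A f -> derivable (fr f x) (cmap (chart_at A x) x) v.
Proof.
move=> sf; apply: diff_derivable.
exact: (smooth_fun_differentiable cA sf (charted_chart_at cA x)).
Qed.

Lemma fdiff_cst (c : R) x v : fdiff A (fun=> c : R) x v = 0.
Proof.
apply: etrans (fdiffE _ _ cA (smooth_fun_cst c)) _; exact: (derive_cst c).
Qed.

Lemma fdiff_add (f g : M -> R) x v : smooth_fun A f -> smooth_fun A g ->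
  fdiff A (fun x => f x + g x) x v = fdiff A f x v + fdiff A g x v.
Proof.
move=> sf sg; apply: etrans (fdiffE _ _ cA (smooth_fun_add sf sg)) _.
apply: etrans (deriveD (f := fr f x) (g := fr g x) (@dfr f x v sf) (@dfr g x v sg)) _.
exact: (esym (congr2 +%R (fdiffE x v cA sf) (fdiffE x v cA sg))).
Qed.

Lemma fdiff_mulr (f : M -> R) (c : R) x v : smooth_fun A f ->
  fdiff A (fun x => f x * c) x v = fdiff A f x v * c.
Proof.
move=> sf; apply: etrans (fdiffE _ _ cA (smooth_fun_mul sf (smooth_fun_cst c))) _.
apply: etrans (deriveM (f := fr f x) (g := cst c) (@dfr f x v sf) (derivable_cst c _ _)) _.
have key (a b d e : R) : d = 0 -> e = b -> a * d + c * b = e * c by move=> -> ->; ring.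
exact: (key _ _ _ _ (derive_cst c _ _) (fdiffE x v cA sf)).
Qed.

End FdiffLemmas.

Section SmoothMapConstructions.
Context {R : realType} {m n p : nat} {M N P : choiceType}.
Context {A : smooth_structure R m M} {B : smooth_structure R n N}.
Context {C : smooth_structure R p P}.

Lemma smooth_map_cst (y : N) : charted A -> smooth_map A B (fun=> y).
Proof.
move=> cA i j U.
have oU : open U.
  rewrite /U; case: (pselect (cdom j y)) => jy.
    rewrite (_ : _ `&` _ = cimg i); first exact: (charted_open cA i).
    by apply/seteqP; split => z // [].
  rewrite (_ : _ `&` _ = set0); first exact: open0.
  by apply/seteqP; split => z // [].
by split => //; exact: (smooth_on_cst U (cmap j y)).
Qed.

Lemma smooth_map_pair (f : M -> N) (g : M -> P) :
  smooth_map A B f -> smooth_map A C g ->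
  smooth_map A (prod_structure B C) (fun x => (f x, g x)).
Proof.
move=> sf sg i [j l] U.
have UE : U = rep_dom f i j `&` rep_dom g i l.
  apply/seteqP; split=> [z [iz [jz lz]]|z [[iz jz] [_ lz]]]; first by split.
  by split.
have oU : open U by rewrite UE; apply: openI; exact: rep_open.
split => //; apply: (smooth_row_mx oU).
  by apply: smooth_onS (rep_smooth i j sf) => z; rewrite UE => -[].
by apply: smooth_onS (rep_smooth i l sg) => z; rewrite UE => -[].
Qed.

Lemma smooth_map_fst : manifold A -> charted B ->
  smooth_map (prod_structure A B) A fst.
Proof.
move=> mA cB [i j] l U.
have UE : U = [set y | rep_dom id i l (lsubmx y)] `&` [set y | cimg j (rsubmx y)].
  by apply/seteqP; split=> z; [move=> [[iz jz] lz]|move=> [[iz lz] jz]].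
have oU : open U.
  rewrite UE; apply: openI; last exact/open_rsubmx/charted_open.
  exact/open_lsubmx/rep_open/smooth_map_id.
split => //.
apply: (@smooth_on_compr _ _ U _ _ (rep_dom id i l) lsubmx (rep id i l)) => //.
- exact/rep_open/smooth_map_id.
- by move=> x; rewrite UE => -[].
- exact: smooth_lsubmx.
- exact/rep_smooth/smooth_map_id.
Qed.

Lemma smooth_map_snd : charted A -> manifold B ->
  smooth_map (prod_structure A B) B snd.
Proof.
move=> cA mB [i j] l U.
have UE : U = [set y | cimg i (lsubmx y)] `&` [set y | rep_dom id j l (rsubmx y)].
  by apply/seteqP; split=> z; [move=> [[iz jz] lz]|move=> [iz [jz lz]]].
have oU : open U.
  rewrite UE; apply: openI; first exact/open_lsubmx/charted_open.
  exact/open_rsubmx/rep_open/smooth_map_id.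
split => //.
apply: (@smooth_on_compr _ _ U _ _ (rep_dom id j l) rsubmx (rep id j l)) => //.
- exact/rep_open/smooth_map_id.
- by move=> x; rewrite UE => -[].
- exact: smooth_rsubmx.
- exact/rep_smooth/smooth_map_id.
Qed.

End SmoothMapConstructions.

Section ChartTopology.
Context {R : realType} {m n : nat} {M N : choiceType}.
Context {A : smooth_structure R m M} {B : smooth_structure R n N}.

(** Phrased with smoothness of the identity, so as to apply to T^*Q while its manifold axioms are
    being established. *)
Lemma mopen_chart (i : cidx A) (O : set 'rV[R]_m) : smooth_map A A id -> open O ->
  mopen A [set x | cdom i x /\ O (cmap i x)].
Proof.
move=> sid oO j y jy [iy Oy].
have cU : open (rep_dom id j i `&` rep id j i @^-1` O).
  apply: (open_preimage_on (rep_open j i sid) oO).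
  by move=> z Uz; apply: smooth_on_continuous Uz _; exact: rep_smooth.
by apply: filterS (open_nbhs_nbhs (conj cU _)) => [z [[jz iz] Oz]|].
Qed.

Lemma mopen_preimage (f : M -> N) (O : set N) : charted B -> smooth_map A B f ->
  mopen B O -> mopen A (f @^-1` O).
Proof.
move=> cB sf oO i y iy Oy.
have jy := charted_chart_at cB (f (cinv i y)).
set j := chart_at B _ in jy.
have Uy : rep_dom f i j y by [].
have cf : {for y, continuous (rep f i j)}.
  by apply: smooth_on_continuous Uy _; exact: rep_smooth.
have Fy : cinv j (rep f i j y) = f (cinv i y) by rewrite /rep /= charted_cmapK.
have /oO/(_ _) : cimg j (rep f i j y) by exact: charted_cmap.
rewrite Fy => /(_ Oy)/cf.
apply: filterS2 (open_nbhs_nbhs (conj (rep_open i j sf) Uy)) => z [iz jz] /= H _.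
move: H; rewrite {1}/rep /= => /(_ (charted_cmap cB jz)).
by rewrite /rep /= charted_cmapK.
Qed.

End ChartTopology.

(** * The cotangent bundle *)

Section AtlasTopology.
Context {R : realType} {m : nat} {M : choiceType} {A : smooth_structure R m M}.
Hypotheses (cA : charted A) (sid : smooth_map A A id).

Lemma chart_separated (i : cidx A) x y : cdom i x -> cdom i y -> x != y ->
  exists U V : set M, [/\ mopen A U, mopen A V, U x, V y & U `&` V = set0].
Proof.
move=> ix iy xy.
have cxy : cmap i x != cmap i y.
  by apply: contra_neq xy => e; rewrite -(charted_cmapK cA ix) e charted_cmapK.
have : hausdorff_space 'rV[R]_m by exact: norm_hausdorff.
rewrite open_hausdorff => /(_ _ _ cxy)[] [P1 P2] /= [/set_mem x1 /set_mem y2] [w1 w2 /eqP w12].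
exists [set z | cdom i z /\ P1 (cmap i z)], [set z | cdom i z /\ P2 (cmap i z)].
split => //; [exact: mopen_chart|exact: mopen_chart|].
apply/seteqP; split=> z // [[_ z1] [_ z2]].
by have : (P1 `&` P2) (cmap i z) by []; rewrite w12.
Qed.

Lemma separated_hausdorff :
  (forall x y : M, x != y ->
     exists U V : set M, [/\ mopen A U, mopen A V, U x, V y & U `&` V = set0]) ->
  hausdorff_space (mtop A).
Proof.
move=> H; rewrite open_hausdorff => x y /H[U [V [oU oV Ux Vy UV]]].
by exists (U, V); [split; exact/mem_set|split => //; apply/eqP].
Qed.

Lemma hausdorff_separated : hausdorff_space (mtop A) -> forall x y : M, x != y ->
  exists U V : set M, [/\ mopen A U, mopen A V, U x, V y & U `&` V = set0].
Proof.
rewrite open_hausdorff => H x y /H[] [U V] /= [/set_mem Ux /set_mem Vy] [oU oV /eqP UV].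
by exists U, V.
Qed.

(** Once 1/(k+1) < r/2, a ball of that radius containing [x] lies within [r] of [x]; a rational
    centre exists by density in each coordinate. *)
Lemma rational_ball (x : 'rV[R]_m) (r : R) : 0 < r ->
  exists (c : 'rV[rat]_m) (k : nat), ball (map_mx ratr c : 'rV[R]_m) k.+1%:R^-1 x /\
    ball (map_mx ratr c : 'rV[R]_m) k.+1%:R^-1 `<=` ball x r.
Proof.
move=> r0.
have [k hk] : exists k : nat, (k.+1%:R^-1 : R) < r / 2.
  have := near_infty_natSinv_lt (PosNum (divr_gt0 r0 (ltr0n R 2))).
  by move=> [k _ /(_ k (leqnn k))]; exists k.
have k0 : 0 < (k.+1%:R^-1 : R) by rewrite invr_gt0.
have Q (y : R) : {q : rat | `|ratr q - y| < k.+1%:R^-1}.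
  apply: cid; have [|q] := @rat_in_itvoo R (y - k.+1%:R^-1) (y + k.+1%:R^-1).
    by rewrite ltrBlDr -addrA ltrDl addr_gt0.
  by rewrite in_itv /= => hq; exists q; rewrite ltr_distl.
exists (\row_j sval (Q (x 0 j))), k.
have xB : ball (map_mx ratr (\row_j sval (Q (x 0 j))) : 'rV[R]_m) k.+1%:R^-1 x.
  split => // i j; rewrite !mxE ord1 -ball_normE /=; exact: svalP (Q _).
split => // y yB; have := ball_splitl; move=> /(_ R 'rV[R]_m).
apply.
  apply: ball_sym; apply: le_ball xB; exact: ltW.
by apply: ball_sym; apply: le_ball yB; exact: ltW.
Qed.

(** Second countability is carried from Q to T^*Q as the existence of a countable cover by chart
    domains. Each basic open set contained in a chart domain selects one such chart, and [None]
    stands for the other basic sets. *)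
Lemma second_countable_charts :
  second_countable (T := mtop A) ->
  exists I : set (option (cidx A)), countable I /\
    forall x, exists i, I (Some i) /\ cdom i x.
Proof.
move=> [B cB [Bo Bb]].
pose ch (b : set M) : option (cidx A) :=
  if pselect (exists i, b `<=` cdom (s := A) i) is left e then Some (projT1 (cid e)) else None.
exists (ch @` B); split; first exact: sub_countable (card_image_le _ _) cB.
move=> x; have xx := charted_chart_at cA x.
have oD : mopen A (cdom (chart_at A x)).
  rewrite (_ : cdom _ = [set y | cdom (chart_at A x) y /\ setT (cmap (chart_at A x) y)]).
    by apply: mopen_chart => //; exact: openT.
  by apply/seteqP; split=> y // [].
have /Bb [b [Bb' bx] bD] : nbhs (x : mtop A) (cdom (chart_at A x)).
  by apply: open_nbhs_nbhs.
have e : exists i, b `<=` cdom (s := A) i by exists (chart_at A x).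
have [i chi] : exists i, ch b = Some i /\ b `<=` cdom i.
  rewrite /ch; case: pselect => // e'; exists (projT1 (cid e')); split => //.
  exact: projT2 (cid e').
by exists i; split; [exists b => //; case: chi|apply chi.2].
Qed.

Lemma charts_second_countable :
  (exists I : set (option (cidx A)), countable I /\
    forall x, exists i, I (Some i) /\ cdom i x) ->
  second_countable (T := mtop A).
Proof.
move=> [I [cI covI]].
(* The countable base: rational balls pulled back by the countably many charts. *)
pose F (p : option (cidx A) * ('rV[rat]_m * nat)) : set M := if p.1 is Some i then
   [set x | cdom i x /\ ball (map_mx ratr p.2.1 : 'rV[R]_m) p.2.2.+1%:R^-1 (cmap i x)]
   else set0.
exists (F @` (I `*` setT)).
  apply: sub_countable (card_image_le _ _) _; exact: countableX.
split.
  move=> _ [[[i|] [c k]] _ <-] /=; last exact: open0.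
  by apply: (mopen_chart sid); exact: ball_open.
move=> x N; rewrite /= nbhsE => -[W [oO Ox] ON].
have [i [Ii ix]] := covI x.
have := oO i (cmap i x) (charted_cmap cA ix); rewrite charted_cmapK // => /(_ Ox).
move=> /nbhs_ballP[r /= r0 hr].
have [c [k [cx cr]]] := rational_ball (cmap i x) r0.
exists (F (Some i, (c, k))); first by split => //; exists (Some i, (c, k)).
move=> y [iy /cr/hr] /(_ (charted_cmap cA iy)); rewrite charted_cmapK //.
exact: ON.
Qed.

End AtlasTopology.

Lemma linfunE (K : fieldType) (aT rT : vectType K) (f : aT -> rT) u :
  linear f -> linfun f u = f u.
Proof.
move=> lf; pose fM := GRing.isLinear.Build _ _ _ _ _ lf.
pose fL : {linear _ -> _} := HB.pack f fM.
exact: (lfunE fL).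
Qed.

Lemma lformB (R : realType) m (a : 'Hom('rV[R]_m, R^o)) u (c : R) v :
  a (u - c *: v) = a u - c * a v :> R.
Proof. by rewrite linearB linearZ. Qed.

Lemma lformZ (R : realType) (aT : vectType R) (a : 'Hom(aT, R^o)) (c : R) v :
  a (c *: v) = c * a v :> R.
Proof. exact: linearZ. Qed.

Lemma lformP (R : realType) (aT : vectType R) (a : 'Hom(aT, R^o)) (c : R) u v :
  a (c *: u + v) = c * a u + a v :> R.
Proof. exact: linearP. Qed.

Section LinearForms.
Context {R : realType}.

Lemma covectorE m (p u : 'rV[R]_m) : covector p u = \sum_j p 0 j * u 0 j.
Proof.
apply: linfunE => a w z; rewrite scaler_sumr -big_split; apply: eq_bigr => l _ /=.
by rewrite !mxE mulrDr mulrCA.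
Qed.

Lemma covector_delta m (p : 'rV[R]_m) j : covector p (delta_mx 0 j) = p 0 j.
Proof.
rewrite covectorE (bigD1 j) //= mxE !eqxx mulr1 big1 ?addr0 // => l lj.
by rewrite mxE (negbTE lj) andbF mulr0.
Qed.

Lemma lform_sum m (a : 'Hom('rV[R]_m, R^o)) (u : 'rV[R]_m) :
  \sum_j a (delta_mx 0 j) * u 0 j = a u.
Proof.
rewrite {2}[u]row_sum_delta linear_sum; apply: eq_bigr => j _.
by rewrite linearZ /= mulrC.
Qed.

Lemma hom_sum m k (a : 'Hom('rV[R]_m, R^o)) (f : 'Hom('rV[R]_k, 'rV[R]_m)) (u : 'rV[R]_k) :
  \sum_j a (f (delta_mx 0 j)) * u 0 j = a (f u).
Proof.
rewrite {2}[u]row_sum_delta !linear_sum; apply: eq_bigr => j _.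
by rewrite !linearZ /= mulrC.
Qed.

End LinearForms.

(** * Canonical coordinates and cotangent lifts *)

Section CotangentCharts.
Context {R : realType} {m : nat} {Q : choiceType} {A : smooth_structure R m Q}.
Hypothesis mA : manifold A.
Let cA := manifold_charted mA.
Notation T := (cotangent_structure A).
Notation cotQ := (@cotangent R m Q).

Lemma cotangent_eq (a b : cotQ) : a.1 = b.1 -> (forall u, a.2 u = b.2 u) -> a = b.
Proof. by case: a b => [q a] [q' b] /= -> ab; congr pair; apply/lfunP. Qed.

Lemma cotangent_cinv1 (i : cidx A) (y : 'rV[R]_(m + m)) :
  (@cinv _ _ _ T i y).1 = cinv i (lsubmx y).
Proof. by []. Qed.

Lemma cotangent_cinv2 (i : cidx A) (y : 'rV[R]_(m + m)) u :
  (@cinv _ _ _ T i y).2 u = covector (rsubmx y) (tcoord i (cinv i (lsubmx y)) u).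
Proof. exact: comp_lfunE. Qed.

Lemma cotangent_cinv_tvec (i : cidx A) (y : 'rV[R]_(m + m)) u : cimg i (lsubmx y) ->
  (@cinv _ _ _ T i y).2 (tvec i (lsubmx y) u) = covector (rsubmx y) u.
Proof.
move=> iy; have iq : cdom i (cinv i (lsubmx y)) by exact: charted_cinv.
apply: etrans (cotangent_cinv2 _ _ _) _.
apply: (congr1 (covector (rsubmx y))).
by have := tvecK mA u iq; rewrite charted_cinvK.
Qed.

Lemma cotangent_charted : charted T.
Proof.
split=> [i|i a|i y|i a|i y|a].
- exact/open_lsubmx/charted_open.
- by move=> ia; rewrite /= row_mxKl; exact: charted_cmap.
- by move=> iy; exact: (charted_cinv cA iy).
- move=> ia; have ia' : @cdom _ _ _ A i a.1 := ia; apply: cotangent_eq => [|u].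
    by rewrite cotangent_cinv1 /= row_mxKl charted_cmapK.
  apply: etrans (cotangent_cinv2 _ _ _) _.
  rewrite covectorE /= row_mxKl row_mxKr charted_cmapK //.
  under eq_bigr do rewrite mxE.
  apply: etrans (hom_sum _ _ _) _; apply: (congr1 a.2); exact: tcoordK.
- move=> iy; have iy' : @cimg _ _ _ A i (lsubmx y) := iy.
  rewrite -[RHS]hsubmxK; congr row_mx; first by rewrite /= charted_cinvK.
  apply/rowP => j; rewrite mxE /= charted_cinvK //.
  apply: etrans (cotangent_cinv_tvec _ iy') _.
  exact: covector_delta.
- exact: (charted_chart_at cA a.1).
Qed.

(* [f'] stands for the inverse of [f]. *)
Definition colift (f f' : Q -> Q) (a : cotQ) : cotQ :=
  (f a.1, (a.2 \o tmap A A f' (f a.1))%VF).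

Lemma colift2 (f f' : Q -> Q) (a : cotQ) u : (colift f f' a).2 u = a.2 (tmap A A f' (f a.1) u).
Proof. exact: comp_lfunE. Qed.

Lemma colift_id (a : cotQ) : colift id id a = a.
Proof.
by apply: cotangent_eq => // u; apply: etrans (colift2 _ _ _ _) _; rewrite tmap_id.
Qed.

(** The classical formula q' = f(q), p' = p . (dq/dq'), the Jacobian being that of the inverse [f']
    at q'. *)
Lemma rep_colift (f f' : Q -> Q) (i j : cidx A) (y : 'rV[R]_(m + m)) :
  smooth_map A A f' -> cancel f f' ->
  cimg i (lsubmx y) -> cdom j (f (cinv i (lsubmx y))) ->
  @rep _ _ _ _ _ T T (colift f f') i j y =
  row_mx (rep f i j (lsubmx y))
    (\row_l \sum_s (rsubmx y) 0 s *
      ('D_(delta_mx 0 l) (rep f' j i) (rep f i j (lsubmx y))) 0 s).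
Proof.
move=> sf' fK iy jq; rewrite {1}/rep /=; congr row_mx.
apply/rowP => l; rewrite !mxE.
apply: etrans (comp_lfunE _ _ _) _; apply: etrans (comp_lfunE _ _ _) _.
have iq : cdom i (f' (f (cinv i (lsubmx y)))) by rewrite fK; exact: charted_cinv.
rewrite covectorE; apply: eq_bigr => s _; congr (_ * _).
have := tcoord_tmap mA mA (delta_mx 0 l) sf' jq iq; rewrite {1}fK => ->.
by rewrite ldiffE.
Qed.

Lemma smooth_map_cotangent_fst : smooth_map T A fst.
Proof.
move=> i j U.
have UE : U = [set y | @rep_dom _ _ _ _ _ A A id i j (lsubmx y)] by [].
have oU : open U by rewrite UE; exact/open_lsubmx/rep_open/smooth_map_id.
split => //.
apply: (@smooth_on_compr _ _ U _ _ (@rep_dom _ _ _ _ _ A A id i j) lsubmx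
  (@rep _ _ _ _ _ A A id i j)) => //.
- exact/rep_open/smooth_map_id.
- exact: smooth_lsubmx.
- exact/rep_smooth/smooth_map_id.
Qed.

Lemma smooth_map_colift (f f' : Q -> Q) : smooth_map A A f -> smooth_map A A f' ->
  cancel f f' -> cancel f' f -> smooth_map T T (colift f f').
Proof.
move=> sf sf' fK f'K i j U.
have UE : U = [set y | @rep_dom _ _ _ _ _ A A f i j (lsubmx y)] by [].
have oU : open U by rewrite UE; exact/open_lsubmx/rep_open.
split => //.
apply: (@smooth_on_eq _ _ _ _ (fun y => row_mx (rep f i j (lsubmx y))
    (\row_l \sum_s (rsubmx y) 0 s *
      ('D_(delta_mx 0 l) (rep f' j i) (rep f i j (lsubmx y))) 0 s))) => //.
  by move=> y [iy jy]; rewrite -rep_colift.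
have sl : smooth_on U (fun y => rep f i j (lsubmx y)).
  apply: (@smooth_on_compr _ _ U _ _ (rep_dom f i j) lsubmx (rep f i j)) => //.
  - exact/rep_open.
  - exact: smooth_lsubmx.
  - exact/rep_smooth.
apply: smooth_row_mx => //.
apply: (@smooth_fiber _ _ _ _ _ U (rep_dom f' j i)) => //.
- exact: rep_open.
- move=> y [iy jy]; split; first exact: charted_cmap.
  by rewrite /rep /= charted_cmapK // fK; exact: charted_cinv.
- exact: smooth_rsubmx.
- exact: rep_smooth.
Qed.

(** A change of canonical coordinates is the lift of the identity of Q. *)
Lemma smooth_map_cotangent_id : smooth_map T T id.
Proof.
rewrite (_ : id = colift id id); last by apply/funext => a; rewrite colift_id.
by apply: smooth_map_colift => //; exact: smooth_map_id.
Qed.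

Lemma cotangent_manifold : manifold T.
Proof.
have cT := cotangent_charted; have sT := smooth_map_cotangent_id.
have [To Tm Ti TmK TiK Tc] := cT; split => //.
- by move=> i j; exact: (sT i j).1.
- by move=> i j; exact: (sT i j).2.
- apply: separated_hausdorff => a b ab.
  (* Covectors at one point share a chart and are separated in it; covectors at distinct points are
     separated by preimages of open sets of Q. *)
  have [e|ne] := eqVneq a.1 b.1.
    apply: (@chart_separated _ _ _ T cT sT (chart_at T a)) => //.
    by rewrite /= e; exact: charted_chart_at.
  have [U [V [oU oV Ua Vb UV]]] := hausdorff_separated (manifold_hausdorff mA) ne.
  exists (fst @^-1` U), (fst @^-1` V); split => //.
  + exact: (mopen_preimage cA smooth_map_cotangent_fst).
  + exact: (mopen_preimage cA smooth_map_cotangent_fst).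
  + by rewrite -preimage_setI UV preimage_set0.
- apply: (charts_second_countable cT sT).
  have [I [cI covI]] := second_countable_charts cA (smooth_map_id mA)
    (manifold_second_countable mA).
  by exists I; split => // a; exact: covI a.1.
Qed.

End CotangentCharts.

Section CotangentAction.
Context {R : realType} {k m : nat} {S : choiceType} {Q : choiceType}.
Context {B : smooth_structure R k S} {A : smooth_structure R m Q}.
Hypotheses (cB : charted B) (mA : manifold A).
Let cA := manifold_charted mA.
Notation T := (cotangent_structure A).
Variables (f f' : S * Q -> Q).
Hypotheses (sf : smooth_map (prod_structure B A) A f).
Hypotheses (sf' : smooth_map (prod_structure B A) A f').
Hypothesis fK : forall s q, f' (s, f (s, q)) = q.

Lemma smooth_map_slice s : smooth_map A (prod_structure B A) (fun q => (s, q)).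
Proof.
apply: smooth_map_pair; last exact: smooth_map_id.
exact: smooth_map_cst.
Qed.

(** The formula of [rep_colift] with a parameter: the Jacobian of f'(s, .) is a partial derivative
    of [f'] in the directions (0, e_l), hence smooth in the parameter as well. It makes the lifted
    action of a Lie group smooth. *)
Lemma smooth_map_colift_family : smooth_map (prod_structure B T) T
  (fun p => colift (A := A) (fun q => f (p.1, q)) (fun q => f' (p.1, q)) p.2 : @cotangent R m Q).
Proof.
move=> [c i] j U.
pose ci : cidx (prod_structure B A) := (c, i).
pose cj : cidx (prod_structure B A) := (c, j).
(* Forgets the momenta: (s, q, p) |-> (s, q). *)
pose z (Y : 'rV[R]_(k + (m + m))) : 'rV[R]_(k + m) :=
  row_mx (lsubmx Y) (lsubmx (rsubmx Y)).
have sz (O : set 'rV[R]_(k + (m + m))) : smooth_on O z.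
  apply: smooth_on_linear => a u v.
  by rewrite /z !linearP /= scale_row_mx add_row_mx.
have UE : U = setT `&` z @^-1` (rep_dom f ci j).
  apply/seteqP; split=> [Y [[cY iY] jY]|Y [_ [[]]]].
    do ![split => //=]; rewrite ?row_mxKl ?row_mxKr //.
  rewrite /z /= row_mxKl row_mxKr => cY iY jY; split => //.
have oU : open U.
  rewrite UE; apply: (open_preimage_on openT (rep_open _ _ sf)) => Y _.
  exact: (smooth_on_continuous (I : setT Y)).
split => //.
have sr : smooth_on U (rep f ci j \o z).
  apply: (@smooth_on_compr _ _ U _ _ (rep_dom f ci j)) => //.
  - exact: rep_open.
  - by move=> Y; rewrite UE => -[].
  - exact: rep_smooth.
apply: (@smooth_on_eq _ _ _ _ (fun Y => row_mx (rep f ci j (z Y))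
    (\row_l \sum_s (rsubmx (rsubmx Y)) 0 s *
      ('D_(row_mx 0 (delta_mx 0 l)) (rep f' cj i)
          (row_mx (lsubmx Y) (rep f ci j (z Y)))) 0 s))) => // [Y|].
  move=> [[cY iY] jY].
  have sf's : smooth_map A A (fun q => f' (cinv c (lsubmx Y), q)).
    apply: (@smooth_map_comp _ _ _ _ _ _ _ A (prod_structure B A) A
      (fun q => (cinv c (lsubmx Y), q)) f') => //.
      exact: prod_charted.
    exact: smooth_map_slice.
  have fKs : cancel (fun q => f (cinv c (lsubmx Y), q)) (fun q => f' (cinv c (lsubmx Y), q)).
    by move=> q; rewrite fK.
  have := @rep_colift _ _ _ _ mA _ _ i j (rsubmx Y) sf's fKs iY jY.
  rewrite /rep /= => ->; congr row_mx; first by rewrite /z row_mxKl row_mxKr.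
  apply/rowP => l; rewrite !mxE; apply: eq_bigr => s _; congr (_ * (_ : 'rV_m) 0 s).
  have zl : lsubmx (z Y) = lsubmx Y by rewrite row_mxKl.
  have zr : rsubmx (z Y) = lsubmx (rsubmx Y) by rewrite row_mxKr.
  rewrite zl zr; apply: etrans (esym (derive_slice2 _ _ _ _)) _.
  by apply: derive_ext => y; rewrite /= row_mxKl row_mxKr.
apply: smooth_row_mx => //.
apply: (@smooth_fiber _ _ _ _ _ U (rep_dom f' cj i)) => //.
- exact: rep_open.
- move=> Y; rewrite UE => -[_ [[]]]; rewrite /z /= row_mxKl row_mxKr => cY iY jY.
  have fE : rep f ci j (row_mx (lsubmx Y) (lsubmx (rsubmx Y))) =
      @cmap _ _ _ A j (f (cinv c (lsubmx Y), @cinv _ _ _ A i (lsubmx (rsubmx Y)))).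
    by rewrite /rep /= row_mxKl row_mxKr.
  rewrite fE; split.
    by split; rewrite /= ?row_mxKl ?row_mxKr //; exact: (charted_cmap (manifold_charted mA) jY).
  rewrite /= row_mxKl row_mxKr (charted_cmapK (manifold_charted mA) jY) fK.
  exact: (charted_cinv (manifold_charted mA) iY).
- apply: (@smooth_on_compr _ _ U _ _ setT rsubmx rsubmx) => //; try exact: openT.
    exact: smooth_rsubmx.
  exact: smooth_rsubmx.
- apply: smooth_row_mx => //; exact: smooth_lsubmx.
- exact: rep_smooth.
Qed.

End CotangentAction.

(** * The canonical form and the momentum of a lifted action *)

Section CanonicalForm.
Context {R : realType} {m : nat} {Q : choiceType} {A : smooth_structure R m Q}.
Hypothesis mA : manifold A.
Let cA := manifold_charted mA.
Notation T := (cotangent_structure A).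
Notation cotQ := (@cotangent R m Q).
Let mT := cotangent_manifold mA.
Let cT := cotangent_charted mA.

Lemma liouvilleE (a : cotQ) v : liouville A a v = a.2 (tmap T A fst a v).
Proof. exact: comp_lfunE. Qed.

(** In canonical coordinates the Liouville form is p . dq. *)
Lemma local1_liouville (i : cidx A) v y : cimg i (lsubmx y) ->
  @local1 R _ _ T (liouville A) i v y = dot (rsubmx y) (lsubmx v).
Proof.
move=> iy; rewrite /local1; apply: etrans (liouvilleE _ _) _.
have iT : @cdom _ _ _ T i (@cinv _ _ _ T i y) by exact: (charted_cinv cT).
have iA : cdom i (@cinv _ _ _ T i y).1 by exact: (charted_cinv cA iy).
have := tmap_tvec mT mA v (smooth_map_cotangent_fst mA) iT iA.
rewrite (charted_cinvK cT) // => E; apply: etrans (congr1 _ E) _.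
rewrite cotangent_cinv1 charted_cinvK //.
apply: etrans (cotangent_cinv_tvec mA _ iy) _.
rewrite covectorE /dot; apply: eq_bigr => j _; congr (_ * (_ : 'rV_m) 0 j).
rewrite ldiffE // ?(charted_cinvK cT) //; last exact: smooth_map_cotangent_fst.
apply: etrans _ (linear_fun_derive y v (linearP _)).
apply: near_eq_derive.
have oT : open (@cimg _ _ _ T i) by exact: (charted_open cT i).
apply: filterS (open_nbhs_nbhs (conj oT (iy : @cimg _ _ _ T i y))) => z iz.
by rewrite /rep /= charted_cinvK.
Qed.

(** Here - d(p . dq) = dq /\ dp is computed in the preferred chart, where components and tangent
    vectors coincide. *)
Lemma canonical_formE (a : cotQ) u v : canonical_form A a u v = std_symplectic u v.
Proof.
rewrite /canonical_form /d1.
set i := chart_at T a; set y := cmap i a.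
have iy : @cimg _ _ _ T i y.
  by apply: (charted_cmap cT); exact: (charted_chart_at cT).
have key w z : 'D_w (local1 (A := T) (liouville A) i z) y = dot (rsubmx w) (lsubmx z).
  have l2 : linear (fun x : 'rV[R]_(m + m) => dot (rsubmx x) (lsubmx z) : R).
    by move=> c x x'; rewrite linearP dotC dot_linear ![dot (lsubmx z) _]dotC.
  apply: etrans _ (linear_fun_derive y w l2).
  apply: near_eq_derive.
  apply: filterS (open_nbhs_nbhs (conj (charted_open cT i) iy)) => x ix.
  exact: local1_liouville.
by rewrite !key /std_symplectic [dot (lsubmx u) _]dotC; ring.
Qed.

Section Preserving.
Variable f : cotQ -> cotQ.
Hypotheses (sf : smooth_map T T f)
  (fl : forall a v, liouville A (f a) (tmap T T f a v) = liouville A a v).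

Lemma rep_liouville (i j : cidx A) y v : @rep_dom _ _ _ _ _ T T f i j y ->
  dot (rsubmx (@rep _ _ _ _ _ T T f i j y)) (lsubmx ('D_v (@rep _ _ _ _ _ T T f i j) y))
  = dot (rsubmx y) (lsubmx v).
Proof.
move=> [iy jy].
have iT : @cdom _ _ _ T i (@cinv _ _ _ T i y) by exact: (charted_cinv cT).
have jT : @cimg _ _ _ T j (@rep _ _ _ _ _ T T f i j y) by exact: (charted_cmap cT).
have yK : @cmap _ _ _ T i (@cinv _ _ _ T i y) = y by exact: (charted_cinvK cT).
rewrite -(local1_liouville v iy) /local1.
rewrite -(local1_liouville ('D_v (@rep _ _ _ _ _ T T f i j) y) jT) /local1.
have E := tmap_tvec mT mT v sf iT jy; rewrite ldiffE // yK in E.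
apply: etrans _ (fl _ _); apply: etrans _ (congr1 (liouville A _) (esym E)).
have fK : @cinv _ _ _ T j (@rep _ _ _ _ _ T T f i j y) = f (@cinv _ _ _ T i y).
  exact: (charted_cmapK cT jy).
exact: (congr1 (fun x => liouville A x (@tvec _ _ _ T j (@rep _ _ _ _ _ T T f i j y)
  ('D_v (@rep _ _ _ _ _ T T f i j) y))) fK).
Qed.

Lemma canonical_form_rep (i j : cidx A) y u v : @rep_dom _ _ _ _ _ T T f i j y ->
  std_symplectic ('D_u (@rep _ _ _ _ _ T T f i j) y) ('D_v (@rep _ _ _ _ _ T T f i j) y)
  = std_symplectic u v.
Proof.
move=> Uy; apply: (@liouville_preserving_symplectic _ _ (@rep_dom _ _ _ _ _ T T f i j)) => //.
  exact: rep_open.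
  exact: rep_smooth.
by move=> z w; exact: rep_liouville.
Qed.

Lemma canonical_form_preserved (a : cotQ) u v :
  canonical_form A (f a) (tmap T T f a u) (tmap T T f a v) = canonical_form A a u v.
Proof.
rewrite !canonical_formE !tmapE.
have aa := charted_chart_at cT a; have fa := charted_chart_at cT (f a).
rewrite !ldiffE //; apply: canonical_form_rep.
exact: rep_dom_cmap.
Qed.

End Preserving.

(** [canonical_formE] uses the preferred chart of each point; passing to a fixed chart is the
    representative of the identity, which preserves the Liouville form and hence
    [std_symplectic]. *)
Lemma local2_canonical_form (i : cidx A) u v y : cimg i (lsubmx y) ->
  @local2 R _ _ T (canonical_form A) i u v y = std_symplectic u v.
Proof.
move=> iy; rewrite /local2 canonical_formE.
have iT : @cdom _ _ _ T i (@cinv _ _ _ T i y) by exact: (charted_cinv cT).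
have yK : @cmap _ _ _ T i (@cinv _ _ _ T i y) = y by exact: (charted_cinvK cT).
have jT := charted_chart_at cT (@cinv _ _ _ T i y).
have sid := smooth_map_cotangent_id mA.
rewrite -[in LHS]yK !(tvecE mT _ iT) !ldiffE // yK.
apply: canonical_form_rep => //.
by move=> a w; rewrite (tmap_id mT).
Qed.

(** The projection intertwines the lift with [f], so the vector is pushed by T f, and the lifted
    covector precomposes with T f', which undoes it. *)
Lemma liouville_colift (f f' : Q -> Q) (a : cotQ) v :
  smooth_map A A f -> smooth_map A A f' -> cancel f f' -> cancel f' f ->
  liouville A (colift (A := A) f f' a) (tmap T T (colift (A := A) f f') a v) = liouville A a v.
Proof.
move=> sf sf' fK f'K.
have sL := smooth_map_colift mA sf sf' fK f'K.
have sfst := smooth_map_cotangent_fst mA.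
apply: etrans (liouvilleE _ _) _; apply: etrans (colift2 _ _ _ _) _.
apply: etrans _ (esym (liouvilleE _ _)); apply: (congr1 a.2).
have E1 : tmap T A fst (colift (A := A) f f' a) (tmap T T (colift (A := A) f f') a v) =
          tmap A A f a.1 (tmap T A fst a v).
  apply: etrans (esym (tmap_comp _ v cT cT cA sL sfst)) _.
  exact: (tmap_comp _ v cT cA cA sfst sf).
apply: etrans (congr1 _ E1) _; rewrite -(tmap_comp _ _ cA cA cA sf sf').
have -> : f' \o f = id by apply/funext => q /=; rewrite fK.
exact: tmap_id.
Qed.

End CanonicalForm.

(** * Infinitesimal symmetries of the Liouville form *)

Section ExactMomentum.
Context {R : realType} {k m : nat} {S Q : choiceType}.
Context {B : smooth_structure R k S} {A : smooth_structure R m Q}.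
Hypotheses (mB : manifold B) (mA : manifold A).
Notation T := (cotangent_structure A).
Notation cotQ := (@cotangent R m Q).
Notation PT := (prod_structure B T).
Variables (Psi : S -> cotQ -> cotQ) (e : S).
Hypotheses (sPsi : smooth_map PT T (fun p => Psi p.1 p.2)).
Hypotheses (Psi1 : forall a, Psi e a = a).
Hypothesis Psil : forall s a v,
  liouville A (Psi s a) (tmap T T (Psi s) a v) = liouville A a v.
Variable xi : 'rV[R]_k.

Let cB := manifold_charted mB.
Let mT := cotangent_manifold mA.
Let cT := cotangent_charted mA.

Let c := chart_at B e.
Let z0 := cmap c e.
Let chart2 (i : cidx A) : cidx PT := (c, i).
Let L (i : cidx A) := @rep _ _ _ _ _ PT T (fun p => Psi p.1 p.2) (chart2 i) i.
Let U (i : cidx A) := @rep_dom _ _ _ _ _ PT T (fun p => Psi p.1 p.2) (chart2 i) i.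
(** The velocity field at [e], in the direction [xi], of the family [Psi], in the coordinates of
    chart [i]. *)
Let X (i : cidx A) (y : 'rV[R]_(m + m)) : 'rV[R]_(m + m) :=
  'D_(row_mx xi 0) (L i) (row_mx z0 y).

Definition exact_momentum (a : cotQ) : R :=
  liouville A a (tmap B T (fun s => Psi s a) e xi).

Let ce : cdom c e.
Proof. exact: (charted_chart_at cB). Qed.

Let ze : cinv c z0 = e.
Proof. exact: (charted_cmapK cB ce). Qed.

Let oU (i : cidx A) : open (U i).
Proof. exact: rep_open. Qed.
Arguments oU : clear implicits.

Let sL (i : cidx A) : smooth_on (U i) (L i).
Proof. exact: rep_smooth. Qed.

Lemma smooth_map_orbit a : smooth_map B T (fun s => Psi s a).
Proof.
apply: (@smooth_map_comp _ _ _ _ _ _ _ B PT T (fun s => (s, a)) (fun p => Psi p.1 p.2)) => //.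
  exact: prod_charted.
apply: smooth_map_pair; first exact: smooth_map_id.
exact: smooth_map_cst.
Qed.

Lemma smooth_map_translate s : smooth_map T T (Psi s).
Proof.
apply: (@smooth_map_comp _ _ _ _ _ _ _ T PT T (fun a => (s, a)) (fun p => Psi p.1 p.2)) => //.
  exact: prod_charted.
apply: smooth_map_pair; last exact: smooth_map_id.
exact: smooth_map_cst.
Qed.

Let U0 (i : cidx A) (y : 'rV[R]_(m + m)) : @cimg _ _ _ T i y -> U i (row_mx z0 y).
Proof.
move=> iy; split; first by split; rewrite /= ?row_mxKl ?row_mxKr //; exact: charted_cmap.
change (@cdom _ _ _ T i (Psi (cinv c (lsubmx (row_mx z0 y)))
  (@cinv _ _ _ T i (rsubmx (row_mx z0 y))))).
by rewrite row_mxKl row_mxKr ze Psi1; exact: (charted_cinv cT iy).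
Qed.

Let LE (i : cidx A) z y : L i (row_mx z y) = @cmap _ _ _ T i (Psi (cinv c z) (@cinv _ _ _ T i y)).
Proof. by rewrite /L /rep /= !row_mxKl !row_mxKr. Qed.

Let L0 (i : cidx A) y : @cimg _ _ _ T i y -> L i (row_mx z0 y) = y.
Proof. by move=> iy; rewrite LE ze Psi1; exact: (charted_cinvK cT iy). Qed.

Let gen_tvec (i : cidx A) y : @cimg _ _ _ T i y ->
  tmap B T (fun s => Psi s (@cinv _ _ _ T i y)) e xi = @tvec _ _ _ T i y (X i y).
Proof.
move=> iy; set x := @cinv _ _ _ T i y.
have ix : @cdom _ _ _ T i (Psi e x) by rewrite Psi1; exact: (charted_cinv cT iy).
have := tmap_tvec mB mT xi (smooth_map_orbit x) ce ix.
rewrite (tvec_chart_at mB) Psi1 (charted_cinvK cT iy) => ->.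
rewrite (ldiffE xi cB (smooth_map_orbit x) ce ix).
apply: (congr1 (fun_of_lfun (@tvec _ _ _ T i y))); apply: etrans _ (derive_slice1 _ _ _ _).
by apply: derive_ext => z; rewrite LE.
Qed.

Let sX (i : cidx A) : smooth_on (@cimg _ _ _ T i) (X i).
Proof.
apply: (@smooth_on_compr _ _ (@cimg _ _ _ T i) _ _ (U i) (fun y => row_mx z0 y)
  ('D_(row_mx xi 0) (L i))).
- exact: (charted_open cT i).
- exact: oU.
- by move=> y; exact: U0.
- apply: smooth_row_mx; first exact: (charted_open cT i).
    exact: (smooth_on_cst _ z0).
  exact: smooth_on_id.
- by apply: smooth_on_derive; exact: sL.
Qed.

Let exact_momentum_chart (i : cidx A) y : @cimg _ _ _ T i y ->
  exact_momentum (@cinv _ _ _ T i y) = dot (rsubmx y) (lsubmx (X i y)).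
Proof.
move=> iy; rewrite -(local1_liouville mA (X i y) iy) /local1.
by apply: (congr1 (liouville A _)); exact: gen_tvec.
Qed.

Lemma smooth_exact_momentum : smooth_fun T exact_momentum.
Proof.
move=> i; have oT := charted_open cT i.
apply: (@smooth_on_eq _ _ _ _ (fun y => dot (rsubmx y) (lsubmx (X i y)))) => //.
  by move=> y iy; rewrite /= exact_momentum_chart.
apply: smooth_dot => //; first exact: smooth_rsubmx.
apply: (@smooth_on_compr _ _ (@cimg _ _ _ T i) _ _ setT (X i) lsubmx) => //.
  exact: openT.
exact: smooth_lsubmx.
Qed.

(** This is L_X lambda = 0 in coordinates, obtained by differentiating the invariance of p . dq
    under [Psi s] with respect to s at [e]. *)
Let infinitesimal_liouville (i : cidx A) y v : @cimg _ _ _ T i y ->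
  dot (rsubmx (X i y)) (lsubmx v) + dot (rsubmx y) (lsubmx ('D_v (X i) y)) = 0.
Proof.
move=> iy.
have lr : linear (rsubmx : 'rV[R]_(m + m) -> 'rV[R]_m) by exact: linearP.
have ll : linear (lsubmx : 'rV[R]_(m + m) -> 'rV[R]_m) by exact: linearP.
have PE Z : U i Z -> dot (rsubmx (L i Z)) (lsubmx ('D_(row_mx 0 v) (L i) Z)) =
    dot (rsubmx (rsubmx Z)) (lsubmx v).
  move=> [[cZ iZ] jZ].
  have f2 : @rep_dom _ _ _ _ _ T T (Psi (cinv c (lsubmx Z))) i i (rsubmx Z) by [].
  have := rep_liouville mA (smooth_map_translate _) (Psil _) v f2 => <-.
  apply: (congr2 (fun a b => dot (rsubmx a) (lsubmx b))); rewrite -{1}[Z]hsubmxK.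
    exact: LE.
  apply: etrans (esym (derive_slice2 _ _ _ _)) _.
  by apply: derive_ext => y'; rewrite LE.
have Z0 := U0 iy; set Z := row_mx z0 y in Z0 *.
have dL : differentiable (L i) Z by exact: smooth_on_differentiable Z0 (sL i).
have sDL w : smooth_on (U i) ('D_w (L i)) by apply: smooth_on_derive; exact: sL.
have dDL w : differentiable ('D_w (L i)) Z by exact: smooth_on_differentiable Z0 (sDL w).
(* By invariance the function equals p . v near [Z], which is constant in the parameter
   direction. *)
have E0 : 'D_(row_mx xi 0)
   (fun Z => dot (rsubmx (L i Z)) (lsubmx ('D_(row_mx 0 v) (L i) Z))) Z = 0.
  have l2 : linear (fun Z : 'rV[R]_(k + (m + m)) => dot (rsubmx (rsubmx Z)) (lsubmx v) : R).
    by move=> a u w; rewrite !linearP dotC dot_linear ![dot (lsubmx v) _]dotC.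
  apply: (@etrans _ _ (dot (rsubmx (rsubmx (row_mx xi 0 : 'rV[R]_(k + (m + m))))) (lsubmx v))).
    apply: etrans _ (linear_fun_derive Z _ l2); apply: near_eq_derive.
    exact: (near_open (oU i) Z0 PE).
  by rewrite row_mxKr linear0 dot0l.
have Er : 'D_(row_mx xi 0) (fun Z => rsubmx (L i Z)) Z = rsubmx (X i y).
  exact: derive_linear_comp.
have El : 'D_(row_mx xi 0) (fun Z => lsubmx ('D_(row_mx 0 v) (L i) Z)) Z =
    lsubmx ('D_v (X i) y).
  apply: etrans (derive_linear_comp _ ll (dDL _)) _; apply: (congr1 lsubmx).
  apply: etrans (smooth_derive_swap _ _ (oU i) Z0 (sL i)) _.
  exact: (esym (derive_slice2 _ _ _ _)).
(* At the parameter [e] the family is the identity. *)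
have Ev : 'D_(row_mx 0 v) (L i) Z = v.
  apply: etrans (esym (derive_slice2 _ _ _ _)) _.
  apply: etrans _ (linear_fun_derive y v (linearP idfun)); apply: near_eq_derive.
  apply: filterS (open_nbhs_nbhs (conj (charted_open cT i) iy)) => y' iy'.
  exact: L0.
rewrite -E0; symmetry.
apply: etrans (derive_dot _ (differentiable_linear_comp lr dL)
  (differentiable_linear_comp ll (dDL _))) _.
apply: etrans (congr2 (fun a b => dot a _ + dot _ b) Er El) _.
by rewrite Ev (L0 iy).
Qed.

(** Cartan's formula: 0 = L_X lambda = d(lambda(X)) + i_X d lambda, and the canonical form is - d
    lambda. *)
Lemma exact_momentumP a v :
  std_symplectic (tmap B T (fun s => Psi s a) e xi) v = fdiff T exact_momentum a v.
Proof.
set i := chart_at T a.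
have ia : @cdom _ _ _ T i a by exact: (charted_chart_at cT).
have iy := charted_cmap cT ia; set y := cmap i a in iy.
have ay : @cinv _ _ _ T i y = a by exact: (charted_cmapK cT).
have gX : tmap B T (fun s => Psi s a) e xi = X i y.
  have := gen_tvec iy; rewrite ay => ->; exact: (tvec_chart_at mT).
rewrite gX (fdiffE _ _ cT smooth_exact_momentum).
have ll : linear (lsubmx : 'rV[R]_(m + m) -> 'rV[R]_m) by exact: linearP.
have lr : linear (rsubmx : 'rV[R]_(m + m) -> 'rV[R]_m) by exact: linearP.
have dX : differentiable (X i) y by exact: smooth_on_differentiable iy (sX i).
have E1 : 'D_v (fun y => dot (rsubmx y) (lsubmx (X i y))) y =
    dot (rsubmx v) (lsubmx (X i y)) + dot (rsubmx y) (lsubmx ('D_v (X i) y)).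
  apply: etrans (derive_dot _ (linear_fun_differentiable _ lr)
    (differentiable_linear_comp ll dX)) _.
  apply: (congr2 (fun a b => dot a _ + dot _ b)); first exact: linear_fun_derive.
  exact: derive_linear_comp.
apply: (@etrans _ _ ('D_v (fun y => dot (rsubmx y) (lsubmx (X i y))) y)); last first.
  apply: near_eq_derive.
  apply: filterS (open_nbhs_nbhs (conj (charted_open cT i) iy)) => y' iy'.
  by rewrite /= exact_momentum_chart.
rewrite E1 /std_symplectic (dotC (lsubmx (X i y))).
by have := infinitesimal_liouville v iy => /eqP; rewrite addrC addr_eq0 => /eqP ->.
Qed.

End ExactMomentum.

(** * The extended Hamiltonian *)

Section ExtendedHamiltonian.
Context {R : realType} {n : nat} {Q : choiceType}.
Context {A : smooth_structure R n.+1 Q} {Pi : Q -> R}.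
Hypotheses (mA : manifold A) (fPi : fibration A Pi).
Notation T := (cotangent_structure A).
Notation cotQ := (@cotangent R n.+1 Q).
Notation V := (vdual A Pi).
Notation VS := (@vdual_structure R n Q A Pi).
Notation eta := (eta A Pi).
Let cA := manifold_charted mA.
Let mT := cotangent_manifold mA.
Let cT := cotangent_charted mA.

Let sPi : smooth_fun A Pi.
Proof. exact: (fibration_smooth fPi). Qed.

Lemma mem_vertical q u : (u \in vertical A Pi q) = (eta q u == 0).
Proof. exact: memv_ker. Qed.

Lemma eta_vsval q (w : subvs_of (vertical A Pi q)) : eta q (vsval w) = 0.
Proof. by apply/eqP; rewrite -mem_vertical subvsP. Qed.

Lemma vsproj_vertical q u : eta q u = 0 -> vsval (vsproj (vertical A Pi q) u) = u.
Proof. by move=> e; apply: vsprojK; rewrite mem_vertical e. Qed.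

Lemma vdual_eq q (b b' : 'Hom(subvs_of (vertical A Pi q), R^o)) : (forall w, b w = b' w) ->
  existT (fun q => 'Hom(subvs_of (vertical A Pi q), R^o)) q b = existT _ q b'.
Proof. by move=> bb; congr existT; apply/lfunP. Qed.

Lemma mu_tagged (a : cotQ) w : tagged (mu A Pi a) w = a.2 (vsval w).
Proof.
by apply: etrans (comp_lfunE _ _ _) _; apply: (congr1 a.2); exact: lfunE.
Qed.
Arguments mu_tagged : clear implicits.

Lemma mu_eqP (a b : cotQ) : mu A Pi a = mu A Pi b <->
  a.1 = b.1 /\ forall u, eta a.1 u = 0 -> a.2 u = b.2 u.
Proof.
split=> [E|[]].
  (* Evaluation at a fixed vector is defined on the whole total space because [vsproj] is total; it
     extracts the fibre part without transport along the equality of base points. *)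
  pose ev u (nu : V) : R := tagged nu (vsproj (vertical A Pi (tag nu)) u).
  have evE (c : cotQ) u : eta c.1 u = 0 -> ev u (mu A Pi c) = c.2 u.
    move=> cu.
    exact: (etrans (mu_tagged c (vsproj _ u)) (congr1 c.2 (vsproj_vertical cu))).
  have E1 : a.1 = b.1 := congr1 (@tag _ _) E.
  split; first exact: E1.
  move=> u au; have bu : eta b.1 u = 0 := eq_ind a.1 (fun q => eta q u = 0) au b.1 E1.
  exact: (etrans (esym (evE a u au)) (etrans (congr1 (ev u) E) (evE b u bu))).
case: a b => [q a] [q' b] /= <- ab; apply: vdual_eq => w.
by apply: etrans (mu_tagged (q, a) w) _; rewrite /= ab ?eta_vsval // -(mu_tagged (q, b)).
Qed.

Lemma eta_attains1 q : exists v, eta q v = 1.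
Proof. by have [v] := fibration_submersion fPi q 1; exists v. Qed.

Lemma dPiE (i : cidx A) q j : cdom i q ->
  dPi Pi i q j = 'D_(delta_mx 0 j) (Pi \o cinv i) (cmap i q).
Proof. by move=> iq; exact: (fdiff_tvec _ mA sPi iq). Qed.

Lemma vframe_val (i : cidx A) l q j : dPi Pi i q l != 0 ->
  vsval (vframe Pi i l q j) = tvec i (cmap i q)
    (delta_mx 0 (fintype.lift l j)
     - (dPi Pi i q (fintype.lift l j) / dPi Pi i q l) *: delta_mx 0 l).
Proof.
move=> dl; apply: vsproj_vertical.
rewrite [X in eta q X]linearB [X in _ - X]linearZ lformB.
rewrite -[eta q (tvec i _ (delta_mx 0 (fintype.lift l j)))]/(dPi Pi i q (fintype.lift l j)).
rewrite -[eta q (tvec i _ (delta_mx 0 l))]/(dPi Pi i q l).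
by rewrite divfK // subrr.
Qed.

(** The coefficients of index other than [l] determine a vertical vector, its component of index [l]
    being forced by the equation sum_j c_j d_j Pi = 0. *)
Lemma vframe_sum (i : cidx A) l q (w : subvs_of (vertical A Pi q)) :
  cdom i q -> dPi Pi i q l != 0 ->
  \sum_j (tcoord i q (vsval w)) 0 (fintype.lift l j) *: vframe Pi i l q j = w.
Proof.
move=> iq dl; set c := tcoord i q (vsval w); apply: subvs_inj; rewrite linear_sum /=.
have wE : vsval w = tvec i (cmap i q) c by rewrite /c (tcoordK mA).
have c0 : \sum_j c 0 j * dPi Pi i q j = 0.
  have E := hom_sum (eta q) (tvec i (cmap i q)) c; rewrite -wE eta_vsval in E.
  rewrite -[RHS]E.
  by apply: eq_bigr => j _; rewrite mulrC.
have -> : \sum_j vsval (c 0 (fintype.lift l j) *: vframe Pi i l q j) =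
    tvec i (cmap i q) (\sum_j c 0 (fintype.lift l j) *: (delta_mx 0 (fintype.lift l j)
      - (dPi Pi i q (fintype.lift l j) / dPi Pi i q l) *: delta_mx 0 l)).
  rewrite linear_sum; apply: eq_bigr => j _.
  apply: (@etrans _ _ (c 0 (fintype.lift l j) *: vsval (vframe Pi i l q j))).
    exact: linearZ.
  by rewrite (vframe_val j dl); apply/esym; exact: linearZ.
rewrite wE; apply: (congr1 (tvec i (cmap i q))).
rewrite {2}[c]row_sum_delta (bigD1_ord (P := xpredT) l) //=.
under eq_bigr do rewrite scalerBr scalerA.
rewrite sumrB addrC; congr (_ + _); rewrite -scaler_suml -scaleNr; congr (_ *: _).
move: c0; rewrite (bigD1_ord (P := xpredT) l) //= => /eqP; rewrite addr_eq0 => /eqP c0.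
apply: (mulIf dl); rewrite c0 mulNr mulr_suml; congr (- _).
by apply: eq_bigr => j _; rewrite mulrA divfK.
Qed.

Lemma vdual_cmapK (i : cidx A) l (nu : V) :
  @cdom _ _ _ VS (i, l) nu -> @cinv _ _ _ VS (i, l) (@cmap _ _ _ VS (i, l) nu) = nu.
Proof.
case: nu => q b [/= iq dl].
(* The inverse chart as a function of base point and fibre coordinates, so that the base point can
   be rewritten although the fibre type depends on it. *)
pose G q' (r : 'rV[R]_n) : V := existT (fun q => 'Hom(subvs_of (vertical A Pi q), R^o)) q'
  (linfun (fun u : subvs_of (vertical A Pi q') =>
     (\sum_(j < n) r 0 j * (tcoord i q' (vsval u)) 0 (fintype.lift l j) : R^o))).
rewrite -[LHS]/(G _ _) row_mxKl row_mxKr charted_cmapK //.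
apply: vdual_eq => w; rewrite linfunE.
  rewrite -[in RHS](vframe_sum w iq dl) linear_sum; apply: eq_bigr => j _.
  by apply: etrans _ (esym (lformZ b _ _)); rewrite mxE mulrC.
move=> c u v; rewrite scaler_sumr -big_split; apply: eq_bigr => j _ /=.
by rewrite !linearP !mxE mulrDr mulrCA.
Qed.

Section HamiltonianSection.
Variables (h : V -> cotQ) (hh : hamiltonian_section h).
Notation F := (extended_hamiltonian h).

Lemma hsection1 nu : (h nu).1 = tag nu.
Proof. by have := congr1 (@tag _ _) (hsection_mu hh nu). Qed.

Lemma hsection_vertical (a : cotQ) u : eta a.1 u = 0 -> (h (mu A Pi a)).2 u = a.2 u.
Proof.
have /mu_eqP[E H] := hsection_mu hh (mu A Pi a).
by move=> au; apply: H; rewrite E.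
Qed.

(** The difference a - h(mu(a)) vanishes on ker eta, hence is a multiple of eta; the factor is its
    value on a vector [v] with eta(v) = 1, as seen by subtracting eta(u) v from [u]. *)
Lemma extended_hamiltonian_ex (a : cotQ) :
  exists s : R, a.2 - (h (mu A Pi a)).2 = s *: eta a.1.
Proof.
have [v ev] := eta_attains1 a.1.
have solve (x y x' y' c : R) : x' - c * y' = x - c * y -> x - x' = (y - y') * c.
  by move=> E; lra.
exists ((a.2 - (h (mu A Pi a)).2) v); apply/lfunP => u.
rewrite scale_lfunE add_lfunE opp_lfunE add_lfunE opp_lfunE.
have /hsection_vertical : eta a.1 (u - eta a.1 u *: v) = 0.
  by rewrite lformB ev mulr1 subrr.
rewrite !lformB; move: (a.2 u) (a.2 v) ((h _).2 u) ((h _).2 v) (eta a.1 u).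
exact: solve.
Qed.

Lemma extended_hamiltonianP (a : cotQ) : a.2 - (h (mu A Pi a)).2 = F a *: eta a.1.
Proof. exact: (xgetPex 0 (extended_hamiltonian_ex a)). Qed.

Lemma extended_hamiltonian_unique (a : cotQ) s :
  a.2 - (h (mu A Pi a)).2 = s *: eta a.1 -> F a = s.
Proof.
rewrite extended_hamiltonianP; have [v ev] := eta_attains1 a.1.
move/(congr1 (fun f : 'Hom(_, _) => f v)); rewrite !scale_lfunE ev.
by rewrite -![_ *: _]/(_ * _) !mulr1.
Qed.

(** [mu] does not see a multiple of eta, so h(mu(a)) is unchanged. This is the source of the
    constant rank. *)
Lemma extended_hamiltonian_shift (a : cotQ) s :
  F (a.1, a.2 + s *: eta a.1) = F a + s.
Proof.
have E : mu A Pi ((a.1, a.2 + s *: eta a.1) : cotQ) = mu A Pi a.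
  apply/mu_eqP; split => // u /= au.
  by rewrite add_lfunE scale_lfunE au scaler0 addr0.
apply: extended_hamiltonian_unique; rewrite E /= addrAC extended_hamiltonianP.
by rewrite scalerDl.
Qed.

(** * The extended Hamiltonian in a local frame of the vertical bundle *)

Section SmoothF.
Variables (i : cidx A) (l : 'I_n.+1).
Let d j (q : 'rV[R]_n.+1) : R := 'D_(delta_mx 0 j) (Pi \o cinv i) q.
Let D : set 'rV[R]_(n.+1 + n.+1) := [set y | cimg i (lsubmx y) /\ d l (lsubmx y) != 0].
(** The coordinate expression of [mu] where d_l Pi is nonzero: the covector p evaluated on the
    vertical frame. *)
Let mu_rep (y : 'rV[R]_(n.+1 + n.+1)) : 'rV[R]_(n.+1 + n) := row_mx (lsubmx y)
  (\row_j (rsubmx y 0 (fintype.lift l j)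
           - d (fintype.lift l j) (lsubmx y) / d l (lsubmx y) * rsubmx y 0 l)).
Let H := @rep _ _ _ _ _ VS T h (i, l) i.

Let sd j : smooth_on (cimg i) (d j).
Proof. by apply: smooth_on_derive; exact: sPi. Qed.

Let oD : open D.
Proof.
have -> : D = [set y | (cimg i `&` d l @^-1` [set~ 0]) (lsubmx y)].
  by apply/seteqP; split=> y [iy /eqP dy]; split.
apply: open_lsubmx; apply: open_preimage_on; first exact: (charted_open cA i).
  by rewrite openC; exact: closed_eq.
by move=> q iq; exact: smooth_on_continuous iq (sd l).
Qed.

Let mu_repE y : D y -> @cmap _ _ _ VS (i, l) (mu A Pi (@cinv _ _ _ T i y)) = mu_rep y.
Proof.
move=> [iy dy]; rewrite /mu_rep /=; congr row_mx; first exact: charted_cinvK.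
have iq : cdom i (cinv i (lsubmx y)) by exact: charted_cinv.
have dE j : dPi Pi i (cinv i (lsubmx y)) j = d j (lsubmx y).
  by rewrite dPiE // charted_cinvK.
apply/rowP => j; rewrite [LHS]mxE [RHS]mxE.
apply: etrans (mu_tagged (@cinv _ _ _ T i y) (vframe Pi i l _ j)) _.
apply: etrans (congr1 _ (vframe_val _ _)) _; first by rewrite dE.
rewrite !dE charted_cinvK //.
apply: etrans (cotangent_cinv_tvec mA _ iy) _.
by rewrite lformB !covector_delta.
Qed.

Let D_cdom y : D y -> @cdom _ _ _ VS (i, l) (mu A Pi (@cinv _ _ _ T i y)).
Proof.
move=> [iy dy]; have iq : cdom i (cinv i (lsubmx y)) by exact: charted_cinv.
by split => //=; rewrite dPiE // charted_cinvK.
Qed.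

Let mu_cinv y : D y ->
  @cinv _ _ _ VS (i, l) (mu_rep y) = mu A Pi (@cinv _ _ _ T i y).
Proof. by move=> Dy; rewrite -(mu_repE Dy); exact: (vdual_cmapK (D_cdom Dy)). Qed.

Let D_rep_dom y : D y -> @rep_dom _ _ _ _ _ VS T h (i, l) i (mu_rep y).
Proof.
move=> Dy; split; last first.
  change (@cdom _ _ _ A i (h (@cinv _ _ _ VS (i, l) (mu_rep y))).1).
  by rewrite (mu_cinv Dy) hsection1; exact: (D_cdom Dy).1.
have [iy dy] := Dy; split; rewrite /= row_mxKl //.
by rewrite dPiE; [rewrite charted_cinvK|exact: charted_cinv].
Qed.

(** The defining identity of F evaluated on the coordinate field d_l, on which eta takes the value
    d_l Pi. *)
Let F_rep y : D y -> F (@cinv _ _ _ T i y) =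
  (rsubmx y 0 l - (rsubmx (H (mu_rep y))) 0 l) / d l (lsubmx y).
Proof.
move=> Dy; have [iy dy] := Dy; set a := @cinv _ _ _ T i y.
have iq : cdom i (cinv i (lsubmx y)) by exact: charted_cinv.
have HE : rsubmx (H (mu_rep y)) 0 l = (h (mu A Pi a)).2 (tvec i (lsubmx y) (delta_mx 0 l)).
  have -> : H (mu_rep y) = @cmap _ _ _ T i (h (mu A Pi a)).
    exact: (congr1 (fun nu => @cmap _ _ _ T i (h nu)) (mu_cinv Dy)).
  by rewrite /= row_mxKr mxE hsection1 /= charted_cinvK.
have := extended_hamiltonianP a.
move=> /(congr1 (fun f : 'Hom(_, _) => f (tvec i (lsubmx y) (delta_mx 0 l)))).
rewrite add_lfunE opp_lfunE scale_lfunE -HE (cotangent_cinv_tvec mA _ iy) covector_delta => ->.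
have -> : eta a.1 (tvec i (lsubmx y) (delta_mx 0 l)) = d l (lsubmx y).
  by have := dPiE l iq; rewrite /dPi charted_cinvK.
by rewrite -[_ *: _]/(_ * _) mulfK.
Qed.

Lemma smooth_extended_hamiltonian_frame : smooth_on D (F \o @cinv _ _ _ T i).
Proof.
apply: (@smooth_on_eq _ _ _ _
  (fun y => (rsubmx y 0 l - (rsubmx (H (mu_rep y))) 0 l) * (d l (lsubmx y))^-1)) => //.
  by move=> y Dy; rewrite /= F_rep.
have sdl j : smooth_on D (fun y => d j (lsubmx y)).
  apply: (@smooth_on_comp _ _ _ _ (cimg i) lsubmx (d j)) => //; first by move=> y [].
  exact: smooth_lsubmx.
have sp j : smooth_on D (fun y => rsubmx y 0 j : R).
  by apply: smooth_on_coord => //; exact: smooth_rsubmx.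
have sdV : smooth_on D (fun y => (d l (lsubmx y))^-1).
  by apply: smooth_onV => // y [].
apply: smooth_onM => //; apply: smooth_onB => //.
have smu : smooth_on D mu_rep.
  apply: smooth_row_mx => //; first exact: smooth_lsubmx.
  apply: smooth_on_row => // j.
  under [X in smooth_on _ X]eq_fun do rewrite mxE.
  by apply: smooth_onB => //; apply: smooth_onM => //; apply: smooth_onM.
have sH : smooth_on D (H \o mu_rep).
  apply: (@smooth_on_compr _ _ _ _ _ (@rep_dom _ _ _ _ _ VS T h (i, l) i)) => //.
    exact: (rep_open _ _ (hsection_smooth hh)).
  exact: (rep_smooth _ _ (hsection_smooth hh)).
apply: (@smooth_on_coord _ _ D _ (fun y => rsubmx (H (mu_rep y))) l) => //.
apply: (@smooth_on_compr _ _ D _ _ setT (H \o mu_rep) rsubmx) => //; first exact: openT.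
exact: smooth_rsubmx.
Qed.

End SmoothF.

Lemma smooth_extended_hamiltonian : smooth_fun T F.
Proof.
move=> i; apply: smooth_on_local => y iy.
have iy' : @cimg _ _ _ A i (lsubmx y) := iy.
have iq : @cdom _ _ _ A i (@cinv _ _ _ A i (lsubmx y)) by exact: charted_cinv.
(* Some partial derivative of Pi is nonzero since Pi is a submersion, so the frame domains cover the
   chart. *)
have [l dl] : exists l, 'D_(delta_mx 0 l) (Pi \o @cinv _ _ _ A i) (lsubmx y) != 0.
  apply/existsP; apply: contraT => /existsPn dN.
  have [v ev] := eta_attains1 (@cinv _ _ _ A i (lsubmx y)).
  suff : eta (@cinv _ _ _ A i (lsubmx y)) v = 0 by rewrite ev => /eqP; rewrite oner_eq0.
  rewrite -(tcoordK mA v iq); apply: etrans (fdiff_tvec _ mA sPi iq) _.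
  rewrite charted_cinvK // derive_sum_delta; last first.
    by have := smooth_fun_differentiable cA sPi iq; rewrite charted_cinvK.
  rewrite big1 // => j _; have := dN j; rewrite negbK => /eqP ->; exact: scaler0.
exists [set y | @cimg _ _ _ A i (lsubmx y) /\
  'D_(delta_mx 0 l) (Pi \o @cinv _ _ _ A i) (lsubmx y) != 0].
  by split.
exact: smooth_extended_hamiltonian_frame.
Qed.

End HamiltonianSection.

End ExtendedHamiltonian.

(** * The presymplectic form *)

Section SymplecticRank.
Context {R : realType} {m : nat}.
Implicit Types (u v : 'rV[R]_(m + m)).

(** The symplectic gradient (da/dp, - da/dq), the vector whose contraction with [std_symplectic] is
    [a]. *)
Definition sharp (a : 'Hom('rV[R]_(m + m), R^o)) : 'rV[R]_(m + m) :=
  row_mx (\row_j a (delta_mx 0 (rshift m j))) (- \row_j a (delta_mx 0 (lshift m j))).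

Lemma sharpE a v : std_symplectic (sharp a) v = a v.
Proof.
rewrite /std_symplectic /sharp row_mxKl row_mxKr -(lform_sum a v) big_split_ord /= addrC.
congr (_ + _); first by apply: eq_bigr => j _; rewrite !mxE.
by rewrite -sumrN; apply: eq_bigr => j _; rewrite !mxE mulNr opprK.
Qed.

Lemma std_symplectic_linear u : linear (std_symplectic u : 'rV[R]_(m + m) -> R).
Proof.
move=> c v w; rewrite /std_symplectic !linearP !dot_linear.
by rewrite -![_ *: _]/(_ * _); ring.
Qed.

Lemma std_symplectic_skew u v : std_symplectic u v = - std_symplectic v u.
Proof. by rewrite /std_symplectic opprB dotC [dot (lsubmx v) _]dotC. Qed.

Lemma std_symplectic_nondegenerate u : (forall v, std_symplectic u v = 0) -> u = 0.
Proof.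
move=> H; rewrite -[u]hsubmxK -[RHS]hsubmxK !linear0; congr row_mx; apply/rowP => j.
  have := H (row_mx 0 (delta_mx 0 j)).
  rewrite /std_symplectic row_mxKl row_mxKr dot0r subr0 => e; rewrite [RHS]mxE -[RHS]e.
  by rewrite dotC /dot; have := covector_delta (lsubmx u) j; rewrite covectorE => <-;
    apply: eq_bigr => l _; rewrite mulrC.
have := H (row_mx (delta_mx 0 j) 0).
rewrite /std_symplectic row_mxKl row_mxKr dot0r sub0r => /eqP; rewrite oppr_eq0 => /eqP e.
rewrite [RHS]mxE -[RHS]e.
by rewrite /dot; have := covector_delta (rsubmx u) j; rewrite covectorE => <-.
Qed.

(* The kernel is spanned by [sharp a] and [sharp b]. *)
Lemma rank_symplectic_wedge (a b : 'Hom('rV[R]_(m + m), R^o)) : a (sharp b) = -1 ->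
  \rank (\matrix_(i < m + m, j < m + m)
    (std_symplectic (delta_mx 0 i) (delta_mx 0 j)
     + (a (delta_mx 0 i) * b (delta_mx 0 j) - a (delta_mx 0 j) * b (delta_mx 0 i))))
  = (m + m - 2)%N.
Proof.
move=> ab; set W := \matrix_(i, j) _.
pose w u v : R := std_symplectic u v + (a u * b v - a v * b u).
have ba : b (sharp a) = 1 by rewrite -sharpE std_symplectic_skew sharpE ab opprK.
have aa : a (sharp a) = 0.
  have := sharpE a (sharp a); rewrite std_symplectic_skew sharpE => /eqP.
  by rewrite eq_sym -addr_eq0 -mulr2n mulrn_eq0 /= => /eqP.
have bb : b (sharp b) = 0.
  have := sharpE b (sharp b); rewrite std_symplectic_skew sharpE => /eqP.
  by rewrite eq_sym -addr_eq0 -mulr2n mulrn_eq0 /= => /eqP.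
(* The left kernel of the matrix is thus the kernel of the bilinear form [w]. *)
have uW u j : (u *m W) 0 j = w u (delta_mx 0 j).
  rewrite mxE /w {2 3 4}[u]row_sum_delta.
  have -> : std_symplectic (\sum_i u 0 i *: delta_mx 0 i) (delta_mx 0 j) =
      \sum_i u 0 i * std_symplectic (delta_mx 0 i) (delta_mx 0 j).
    rewrite std_symplectic_skew.
    have lj := std_symplectic_linear (delta_mx 0 j).
    pose fM := GRing.isLinear.Build _ _ _ _ _ lj.
    pose fL : {linear _ -> _} := HB.pack (std_symplectic (delta_mx 0 j)) fM.
    rewrite -[std_symplectic _ (\sum_i _)]/(fL _) linear_sum -sumrN; apply: eq_bigr => i _.
    by rewrite linearZ /= [in RHS]std_symplectic_skew -mulrN.
  have Ha : a (\sum_i u 0 i *: delta_mx 0 i) = \sum_i u 0 i * a (delta_mx 0 i) :> R.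
    by rewrite linear_sum; apply: eq_bigr => i _; exact: lformZ.
  have Hb : b (\sum_i u 0 i *: delta_mx 0 i) = \sum_i u 0 i * b (delta_mx 0 i) :> R.
    by rewrite linear_sum; apply: eq_bigr => i _; exact: lformZ.
  rewrite Ha Hb mulr_suml mulr_sumr -sumrB -big_split; apply: eq_bigr => i _ /=.
  by rewrite mxE; ring.
have w_lin u v : u *m W = 0 -> w u v = 0.
  move=> u0; have wl : linear (w u : 'rV[R]_(m + m) -> R).
    move=> c v1 v2; rewrite /w std_symplectic_linear !lformP.
    by rewrite -![_ *: _]/(_ * _); ring.
  pose fM := GRing.isLinear.Build _ _ _ _ _ wl.
  pose fL : {linear _ -> _} := HB.pack (w u) fM.
  rewrite -[w u v]/(fL v) [v]row_sum_delta linear_sum big1 // => j _.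
  by rewrite linearZ /= -uW u0 mxE scaler0.
pose X := col_mx (sharp a) (sharp b).
have XW : X *m W = 0.
  rewrite mul_col_mx; apply/eqP; rewrite col_mx_eq0; apply/andP; split; apply/eqP/rowP => j.
    by rewrite uW /w sharpE aa ba mxE; ring.
  by rewrite uW /w sharpE ab bb mxE; ring.
have Xfree : row_free X.
  apply: inj_row_free => v; rewrite -[v]hsubmxK mul_row_col.
  set s := lsubmx v; set t := rsubmx v => e.
  have {}e : s 0 0 *: sharp a + t 0 0 *: sharp b = 0.
    by rewrite -e {2}[s]mx11_scalar {2}[t]mx11_scalar !mul_scalar_mx.
  have t0 : t 0 0 = 0.
    have : a (s 0 0 *: sharp a + t 0 0 *: sharp b) = 0 :> R by rewrite e; exact: linear0.
    by rewrite lformP lformZ aa ab mulr0 add0r mulrN1 => /eqP; rewrite oppr_eq0 => /eqP.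
  have s0 : s 0 0 = 0.
    have : b (s 0 0 *: sharp a + t 0 0 *: sharp b) = 0 :> R by rewrite e; exact: linear0.
    by rewrite lformP lformZ ba bb mulr0 addr0 mulr1.
  have -> : s = 0 by apply/rowP => i; rewrite ord1 s0 mxE.
  have -> : t = 0 by apply/rowP => i; rewrite ord1 t0 mxE.
  exact: row_mx0.
have Xker : (X <= kermx W)%MS by apply/sub_kermxP.
have kerX : (kermx W <= X)%MS.
  apply/row_subP => i; set u := row i (kermx W).
  have u0 : u *m W = 0 by apply/sub_kermxP; exact: row_sub.
  (* For [u] in the kernel, contracting it with [std_symplectic] gives b(u) a - a(u) b;
     nondegeneracy then identifies [u]. *)
  have uE : u = b u *: sharp a - a u *: sharp b.
    apply/eqP; rewrite -subr_eq0; apply/eqP; apply: std_symplectic_nondegenerate => v.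
    have -> : u - (b u *: sharp a - a u *: sharp b) = (- b u) *: sharp a + (a u *: sharp b + u).
      by rewrite opprB scaleNr [LHS]addrC [X in X + u]addrC -addrA.
    rewrite std_symplectic_skew !std_symplectic_linear.
    rewrite (std_symplectic_skew v (sharp a)) (std_symplectic_skew v (sharp b)) !sharpE.
    rewrite (std_symplectic_skew v u); have := w_lin u v u0; rewrite /w -![_ *: _]/(_ * _).
    move: (std_symplectic u v) (a u) (a v) (b u) (b v) => x y z y' z' E; lra.
  rewrite uE addmx_sub ?scalemx_sub //; last first.
    by rewrite -scaleNr scalemx_sub //; apply/submxP; exists (row_mx 0 1%:M);
      rewrite mul_row_col mul0mx mul1mx add0r.
  by apply/submxP; exists (row_mx 1%:M 0); rewrite mul_row_col mul0mx mul1mx addr0.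
have : \rank (kermx W) = 2.
  have E : (kermx W == X)%MS by rewrite Xker kerX.
  by rewrite (eqmx_rank E); exact/eqP.
rewrite mxrank_ker => e; have := rank_leq_row W.
by move: e; lia.
Qed.

End SymplecticRank.

Lemma wedge_congr (R : realType) (s a b c d a' b' c' d' : R) :
  a = a' -> b = b' -> c = c' -> d = d' -> s + (a * b - c * d) = s + (a' * b' - c' * d').
Proof. by move=> -> -> -> ->. Qed.

Section PresymplecticForm.
Context {R : realType} {m : nat} {Q : choiceType} {A : smooth_structure R m Q}.
Hypothesis mA : manifold A.
Notation T := (cotangent_structure A).
Notation cotQ := (@cotangent R m Q).
Let cA := manifold_charted mA.
Let mT := cotangent_manifold mA.
Let cT := cotangent_charted mA.

Variables (F G : cotQ -> R).
Hypotheses (sF : smooth_fun T F) (sG : smooth_fun T G).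

(** With the extended Hamiltonian for [F] and Pi \o pi_Q for [G] this is [omega h] by conversion. *)
Definition perturbed_form : @form2 R (m + m) cotQ := fun a u v =>
  canonical_form A a u v + wedge11 (fdiff T F) (fdiff T G) a u v.

Lemma perturbed_formE a u v : perturbed_form a u v =
  std_symplectic u v + (fdiff T F a u * fdiff T G a v - fdiff T F a v * fdiff T G a u).
Proof. by rewrite /perturbed_form canonical_formE. Qed.

Let Fr (i : cidx A) : 'rV[R]_(m + m) -> R := F \o @cinv _ _ _ T i.
Let Gr (i : cidx A) : 'rV[R]_(m + m) -> R := G \o @cinv _ _ _ T i.

Lemma local2_perturbed (i : cidx A) u v y : @cimg _ _ _ T i y ->
  @local2 R _ _ T perturbed_form i u v y =
  std_symplectic u v + ('D_u (Fr i) y * 'D_v (Gr i) y - 'D_v (Fr i) y * 'D_u (Gr i) y).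
Proof.
move=> iy; rewrite /local2 /perturbed_form /wedge11.
rewrite -[canonical_form _ _ _ _]/(@local2 R _ _ T (canonical_form A) i u v y).
rewrite local2_canonical_form //.
have iT : @cdom _ _ _ T i (@cinv _ _ _ T i y) by exact: (charted_cinv cT iy).
have yK : @cmap _ _ _ T i (@cinv _ _ _ T i y) = y by exact: (charted_cinvK cT iy).
have EF w : fdiff T F (@cinv _ _ _ T i y) (@tvec _ _ _ T i y w) = 'D_w (Fr i) y.
  by have := fdiff_tvec w mT sF iT; rewrite yK.
have EG w : fdiff T G (@cinv _ _ _ T i y) (@tvec _ _ _ T i y w) = 'D_w (Gr i) y.
  by have := fdiff_tvec w mT sG iT; rewrite yK.
exact: wedge_congr (EF u) (EG v) (EF v) (EG u).
Qed.

Lemma is_form2_perturbed : is_form2 T perturbed_form.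
Proof.
split.
- move=> a u c v w; rewrite !perturbed_formE.
  (* Linearity reduced to an identity between real numbers, the values of the forms being passed as
     equations. *)
  have key (s s1 s2 x x12 x1 x2 z z12 z1 z2 : R) : s = c * s1 + s2 ->
      x12 = c * x1 + x2 -> z12 = c * z1 + z2 ->
      s + (x * z12 - x12 * z) = c * (s1 + (x * z1 - x1 * z)) + (s2 + (x * z2 - x2 * z)).
    by move=> -> -> ->; ring.
  exact: (key _ _ _ _ _ _ _ _ _ _ _ (std_symplectic_linear u c v w)
    (lformP (fdiff T F a) c v w) (lformP (fdiff T G a) c v w)).
- move=> a u; apply: etrans (perturbed_formE _ _ _) _.
  have -> : std_symplectic u u = 0 by rewrite /std_symplectic dotC subrr.
  by rewrite add0r subrr.
- move=> a u v; rewrite !perturbed_formE.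
  have key (s s' x x' z z' : R) : s = - s' ->
      s + (x * z - x' * z') = - (s' + (x' * z' - x * z)) by move=> ->; ring.
  exact: key (std_symplectic_skew u v).
- move=> i u v; have oT := charted_open cT i.
  have sFr w : smooth_on (@cimg _ _ _ T i) ('D_w (Fr i)).
    by apply: smooth_on_derive; exact: sF.
  have sGr w : smooth_on (@cimg _ _ _ T i) ('D_w (Gr i)).
    by apply: smooth_on_derive; exact: sG.
  apply: (@smooth_on_eq _ _ _ _ (fun y => std_symplectic u v
    + ('D_u (Fr i) y * 'D_v (Gr i) y - 'D_v (Fr i) y * 'D_u (Gr i) y))) => //.
    by move=> y iy; rewrite local2_perturbed.
  apply: smooth_onD => //; first exact: smooth_on_cst.
  by apply: smooth_onB => //; exact: smooth_onM.
Qed.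

Let derive_wedge (i : cidx A) y u v w : @cimg _ _ _ T i y ->
  'D_w (@local2 R _ _ T perturbed_form i u v) y =
   'D_w ('D_u (Fr i)) y * 'D_v (Gr i) y + 'D_u (Fr i) y * 'D_w ('D_v (Gr i)) y
   - ('D_w ('D_v (Fr i)) y * 'D_u (Gr i) y + 'D_v (Fr i) y * 'D_w ('D_u (Gr i)) y).
Proof.
move=> iy; have oT := charted_open cT i.
have dFr z : derivable ('D_z (Fr i)) y w.
  apply: diff_derivable; apply: (smooth_on_differentiable iy).
  by apply: smooth_on_derive; exact: sF.
have dGr z : derivable ('D_z (Gr i)) y w.
  apply: diff_derivable; apply: (smooth_on_differentiable iy).
  by apply: smooth_on_derive; exact: sG.
apply: (@etrans _ _ ('D_w (cst (std_symplectic u v)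
  + ('D_u (Fr i) * 'D_v (Gr i) - 'D_v (Fr i) * 'D_u (Gr i))) y)).
  apply: near_eq_derive; apply: (near_open oT iy) => z iz.
  exact: local2_perturbed.
have d1 : derivable ('D_u (Fr i) * 'D_v (Gr i)) y w by apply: derivableM.
have d2 : derivable ('D_v (Fr i) * 'D_u (Gr i)) y w by apply: derivableM.
have key (d0 dB dP dN x1 x2 x3 x4 z1 z2 z3 z4 : R) : d0 = 0 -> dB = dP - dN ->
    dP = x1 * z1 + x2 * z2 -> dN = x3 * z3 + x4 * z4 ->
    d0 + dB = z2 * x2 + x1 * z1 - (z4 * x4 + x3 * z3).
  by move=> -> -> -> ->; ring.
apply: etrans (deriveD (derivable_cst _ _ _) (derivableB d1 d2)) _.
exact: (key _ _ _ _ _ _ _ _ _ _ _ _ (derive_cst _ _ _) (deriveB d1 d2)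
  (deriveM (dFr u) (dGr v)) (deriveM (dFr v) (dGr u))).
Qed.

(** The canonical part has constant coefficients; in the cyclic sum for dF /\ dG the second
    derivatives of [F] and of [G] cancel in pairs by symmetry. *)
Lemma perturbed_closed a u v w : d2 T perturbed_form a u v w = 0.
Proof.
rewrite /d2; set i := chart_at T a; set y := cmap i a.
have iy : @cimg _ _ _ T i y by exact: (charted_cmap cT (charted_chart_at cT a)).
have oT := charted_open cT i.
rewrite !derive_wedge //.
have SF c d : 'D_c ('D_d (Fr i)) y = 'D_d ('D_c (Fr i)) y.
  exact: (smooth_derive_swapR _ _ oT iy (sF i)).
have SG c d : 'D_c ('D_d (Gr i)) y = 'D_d ('D_c (Gr i)) y.
  exact: (smooth_derive_swapR _ _ oT iy (sG i)).
have key (a1 a2 a3 b1 b2 b3 f1 f2 f3 g1 g2 g3 f1' f2' f3' g1' g2' g3' : R) :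
  f1 = f1' -> f2 = f2' -> f3 = f3' -> g1 = g1' -> g2 = g2' -> g3 = g3' ->
  (f1 * b3 + a2 * g2' - (f2' * b2 + a3 * g1))
  + (f3 * b1 + a3 * g1' - (f1' * b3 + a1 * g3))
  + (f2 * b2 + a1 * g3' - (f3' * b1 + a2 * g2)) = 0.
  by do 6!move=> ->; ring.
exact: (key _ _ _ _ _ _ _ _ _ _ _ _ _ _ _ _ _ _ (SF u v) (SF w u) (SF v w)
  (SG u v) (SG w u) (SG v w)).
Qed.

Lemma perturbed_rank a : fdiff T F a (sharp (fdiff T G a)) = -1 ->
  form2_rank perturbed_form a = (m + m - 2)%N.
Proof.
move=> FG; rewrite -(rank_symplectic_wedge FG) /form2_rank.
by congr (\rank _); apply/matrixP => i j; rewrite !mxE perturbed_formE.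
Qed.

Lemma perturbed_invariant (f : cotQ -> cotQ) c a u v : smooth_map T T f ->
  (forall a v, liouville A (f a) (tmap T T f a v) = liouville A a v) ->
  (forall x, F (f x) = F x) -> (forall x, G (f x) = G x + c) ->
  perturbed_form (f a) (tmap T T f a u) (tmap T T f a v) = perturbed_form a u v.
Proof.
move=> sf fl fF fG; rewrite /perturbed_form canonical_form_preserved // /wedge11.
have EF w : fdiff T F (f a) (tmap T T f a w) = fdiff T F a w.
  apply: etrans (esym (fdiff_comp a w cT cT sf sF)) _.
  have E : F \o f = F by apply/funext => x; exact: fF.
  exact: (congr1 (fun g => fdiff T g a w) E).
have EG w : fdiff T G (f a) (tmap T T f a w) = fdiff T G a w.
  apply: etrans (esym (fdiff_comp a w cT cT sf sG)) _.
  apply: (@etrans _ _ (fdiff T (fun x => G x + c) a w)); last first.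
    apply: etrans (fdiff_add cT a w sG (smooth_fun_cst c)) _.
    by apply: etrans (congr2 +%R erefl (fdiff_cst cT _ _ _)) _; exact: addr0.
  have E : G \o f = (fun x => G x + c) by apply/funext => x; exact: fG.
  exact: (congr1 (fun g => fdiff T g a w) E).
exact: wedge_congr (EF u) (EG v) (EF v) (EG u).
Qed.

End PresymplecticForm.

(** * The action of G *)

Section Connected.
Context {R : realType} {m : nat} {M : choiceType} {A : smooth_structure R m M}.
Hypotheses (mA : manifold A) (Mconn : connected [set: mtop A]).
Let cA := manifold_charted mA.

(** In charts [f] is locally constant ([ball_cst]), so its level sets are open and closed. *)
Lemma fdiff_eq0_cst (f : M -> R) : smooth_fun A f -> (forall x v, fdiff A f x v = 0) ->
  forall x y, f x = f y.
Proof.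
move=> sf df0 x0 x.
have loc (i : cidx A) y : cimg i y -> \forall z \near y, f (cinv i z) = f (cinv i y).
  move=> iy; have /nbhs_ballP[r /= r0 hr] := open_nbhs_nbhs (conj (charted_open cA i) iy).
  apply/nbhs_ballP; exists r => //= z zr.
  apply: (@ball_cst _ _ (f \o cinv i) y r) => // w.
    by move=> /hr iw; exact: smooth_on_differentiable iw (sf i).
  move=> v /hr iw; have := fdiff_tvec v mA sf (charted_cinv cA iw).
  by rewrite charted_cinvK // df0 => <-.
have oP (P : set R) : mopen A [set x | P (f x)].
  by move=> i y iy Py; apply: filterS (loc i y iy) => z /= -> _.
have E : [set x | f x = f x0] = [set: mtop A].
  apply: Mconn; first by exists x0.
    by exists [set x | f x = f x0]; [exact: (oP [set t | t = f x0])|rewrite setTI].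
  exists [set x | f x = f x0]; last by rewrite setTI.
  by rewrite -openC; exact: (oP [set t | ~ t = f x0]).
by have : [set: mtop A] x by []; rewrite -E => /= ->.
Qed.

End Connected.

Lemma derive_translation (R : realType) (V : normedModType R) (g : V -> R) y w :
  differentiable g y -> (forall s, g (y + s *: w) = g y + s) -> 'D_w g y = 1.
Proof.
move=> dg gs.
have := @line_derive _ _ _ g y w 0; rewrite scale0r addr0 => /(_ dg) [_ <-].
have -> : (fun s : R => g (y + s *: w)) = cst (g y) + id by apply/funext.
by rewrite deriveD // derive_cst derive_id add0r.
Qed.

Section Action.
Context {R : realType} {m k : nat} {Q : choiceType} {A : smooth_structure R m Q}.
Context {G : groupType} {AG : smooth_structure R k G} {phi : G -> Q -> Q}.
Hypotheses (mA : manifold A) (hG : lie_group AG) (hphi : smooth_action AG A phi).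
Notation T := (cotangent_structure A).
Notation cotQ := (@cotangent R m Q).
Let cA := manifold_charted mA.
Let mT := cotangent_manifold mA.
Let cT := cotangent_charted mA.
Let mG := lie_group_manifold hG.
Let cG := manifold_charted mG.
Let sphi := smooth_action_smooth hphi.

Lemma action1 : phi 1%g = id.
Proof. by apply/funext => q; exact: (smooth_action1 hphi). Qed.

Lemma actionK g : cancel (phi g) (phi g^-1%g).
Proof. by move=> q; rewrite -(smooth_action1 hphi q) -!(smooth_actionM hphi) mulg1 mulVg. Qed.

Lemma actionVK g : cancel (phi g^-1%g) (phi g).
Proof. by move=> q; rewrite -(smooth_action1 hphi q) -!(smooth_actionM hphi) mulg1 mulgV. Qed.

Lemma smooth_translate g : smooth_map A A (phi g).
Proof.
apply: (@smooth_map_comp _ _ _ _ _ _ _ A (prod_structure AG A) A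
  (fun q => (g, q)) (fun p => phi p.1 p.2)) => //.
  exact: prod_charted.
by apply: smooth_map_pair; [exact: smooth_map_cst|exact: smooth_map_id].
Qed.

Lemma smooth_orbit q : smooth_map AG A (phi^~ q).
Proof.
apply: (@smooth_map_comp _ _ _ _ _ _ _ AG (prod_structure AG A) A
  (fun g => (g, q)) (fun p => phi p.1 p.2)) => //.
  exact: prod_charted.
by apply: smooth_map_pair; [exact: smooth_map_id|exact: smooth_map_cst].
Qed.

Lemma smooth_action_inv : smooth_map (prod_structure AG A) A (fun p => phi p.1^-1%g p.2).
Proof.
have cP := prod_charted cG cA.
apply: (@smooth_map_comp _ _ _ _ _ _ _ (prod_structure AG A) (prod_structure AG A) A
  (fun p => (p.1^-1%g, p.2)) (fun p => phi p.1 p.2)) => //.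
apply: smooth_map_pair; last exact: smooth_map_snd.
apply: (@smooth_map_comp _ _ _ _ _ _ _ (prod_structure AG A) AG AG fst (fun g => g^-1%g)) => //.
  exact: smooth_map_fst.
exact: (lie_group_inv hG).
Qed.

Lemma smooth_conj g : smooth_map AG AG (fun x => (g * x * g^-1)%g).
Proof.
have cP := prod_charted cG cG; have smul := lie_group_mul hG.
apply: (@smooth_map_comp _ _ _ _ _ _ _ AG (prod_structure AG AG) AG
  (fun x => ((g * x)%g, g^-1%g)) (fun p => (p.1 * p.2)%g)) => //.
apply: smooth_map_pair; last exact: smooth_map_cst.
apply: (@smooth_map_comp _ _ _ _ _ _ _ AG (prod_structure AG AG) AG
  (fun x => (g, x)) (fun p => (p.1 * p.2)%g)) => //.
by apply: smooth_map_pair; [exact: smooth_map_cst|exact: smooth_map_id].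
Qed.

Notation Psi := (cotangent_lift A phi).

Lemma cotangent_liftE g : Psi g = colift (A := A) (phi g) (phi g^-1%g).
Proof. by []. Qed.

Lemma cotangent_lift2 g (a : cotQ) u :
  (Psi g a).2 u = a.2 (tmap A A (phi g^-1%g) (phi g a.1) u).
Proof. exact: colift2. Qed.

Lemma cotangent_smooth_action : smooth_action AG T Psi.
Proof.
split.
- by move=> a; rewrite cotangent_liftE invg1 action1; exact: colift_id.
- move=> g h a; apply: cotangent_eq => [|u]; first exact: (smooth_actionM hphi).
  apply: etrans (cotangent_lift2 _ _ _) _; apply: esym.
  apply: etrans (cotangent_lift2 _ _ _) _; apply: etrans (cotangent_lift2 _ _ _) _.
  apply: (congr1 a.2); apply: esym.
  have E : phi (g * h)^-1%g = phi h^-1%g \o phi g^-1%g.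
    by apply/funext => q; rewrite invgM; exact: (smooth_actionM hphi).
  rewrite E (smooth_actionM hphi).
  apply: etrans (tmap_comp _ _ cA cA cA (smooth_translate _) (smooth_translate _)) _.
  by rewrite actionK.
- apply: (@smooth_map_colift_family _ _ _ _ _ _ _ cG mA (fun p => phi p.1 p.2)
    (fun p => phi p.1^-1%g p.2) sphi smooth_action_inv).
  by move=> g q; exact: actionK.
Qed.

Lemma smooth_cotangent_translate g : smooth_map T T (Psi g).
Proof.
apply: (smooth_map_colift mA (smooth_translate g) (smooth_translate _)).
  exact: actionK.
exact: actionVK.
Qed.

Lemma liouville_cotangent_lift g a v :
  liouville A (Psi g a) (tmap T T (Psi g) a v) = liouville A a v.
Proof.
exact: (liouville_colift mA a v (smooth_translate g) (smooth_translate _) (actionK g) (actionVK g)).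
Qed.

(** The projection sends the orbit curve of [a] to that of its base point, hence the generator on
    T^*Q to the generator on Q. *)
Lemma exact_momentum_cotangent (a : cotQ) xi :
  exact_momentum (B := AG) (A := A) Psi 1%g xi a = a.2 (infgen AG A phi a.1 xi).
Proof.
apply: etrans (liouvilleE _ _) _; apply: (congr1 a.2).
have so := smooth_map_orbit mG mA (smooth_action_smooth cotangent_smooth_action) a.
have sfst := smooth_map_cotangent_fst mA.
have E := tmap_comp 1%g xi cG cT cA so sfst.
rewrite (smooth_action1 cotangent_smooth_action) in E.
exact: esym E.
Qed.

(** Differentiate phi_{g^-1} phi_s phi_g = phi_{g^-1 s g} in s at the identity. *)
Lemma infgen_Ad g q xi :
  tmap A A (phi g^-1%g) (phi g q) (infgen AG A phi (phi g q) xi)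
  = infgen AG A phi q (Ad AG g^-1%g xi).
Proof.
have E1 := tmap_comp 1%g xi cG cA cA (smooth_orbit (phi g q)) (smooth_translate g^-1%g).
rewrite action1 /= in E1; apply: etrans (esym E1) _.
have E2 := tmap_comp 1%g xi cG cG cA (smooth_conj g^-1%g) (smooth_orbit q).
rewrite mulg1 mulgV in E2; apply: etrans _ E2.
apply: (congr1 (fun f => tmap AG A f 1%g xi)); apply/funext => s /=.
by rewrite invgK !(smooth_actionM hphi).
Qed.

End Action.

(** * Invariance of omega_h and its momentum map *)

Section Invariance.
Context {R : realType} {n k : nat} {Q : choiceType} {A : smooth_structure R n.+1 Q}.
Context {Pi : Q -> R} {G : groupType} {AG : smooth_structure R k G} {phi : G -> Q -> Q}.
Hypotheses (mA : manifold A) (Qconn : connected [set: mtop A]) (fPi : fibration A Pi).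
Hypotheses (hG : lie_group AG) (hphi : smooth_action AG A phi).
Hypothesis eta_inv : eta_invariant A Pi phi.
Variables (h : vdual A Pi -> @cotangent R n.+1 Q).
Hypotheses (hh : hamiltonian_section h) (h_equiv : section_equivariant phi h).
Notation T := (cotangent_structure A).
Notation cotQ := (@cotangent R n.+1 Q).
Notation Psi := (cotangent_lift A phi).
Notation F := (extended_hamiltonian h).
Let cA := manifold_charted mA.
Let mT := cotangent_manifold mA.
Let cT := cotangent_charted mA.
Let mG := lie_group_manifold hG.
Let cG := manifold_charted mG.
Let hPsi := cotangent_smooth_action mA hG hphi.

Let sPi : smooth_fun A Pi.
Proof. exact: (fibration_smooth fPi). Qed.

Lemma smooth_Pi_fst : smooth_fun T (fun a : cotQ => Pi a.1).
Proof. exact: (smooth_fun_comp cT cA (smooth_map_cotangent_fst mA) sPi). Qed.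

(** The function Pi \o phi_g - Pi has differential phi_g^* eta - eta = 0, hence is constant on the
    connected Q. Thus [translation] denotes the actual m and not the default value 0. *)
Lemma translationP g q : Pi (phi g q) = Pi q + translation Pi phi g.
Proof.
have sg := smooth_translate mA hG hphi g.
have sPg := smooth_fun_comp cA cA sg sPi.
have sN : smooth_fun A (fun q => Pi q * -1).
  by apply: smooth_fun_mul => //; exact: smooth_fun_cst.
have cst (q1 q2 : Q) : Pi (phi g q1) + Pi q1 * -1 = Pi (phi g q2) + Pi q2 * -1.
  apply: (fdiff_eq0_cst mA Qconn (smooth_fun_add cA sPg sN)) => x v.
  apply: etrans (fdiff_add cA x v sPg sN) _.
  have key (a b c d e : R) : a = c -> c = e -> b = d * -1 -> d = e -> a + b = 0.
    by move=> -> -> -> ->; ring.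
  exact: (key _ _ _ _ _ (fdiff_comp x v cA cA sg sPi) (eta_inv g x v)
    (fdiff_mulr cA (-1) x v sPi) erefl).
have H : [set s : R | forall q, Pi (phi g q) = Pi q + s] (Pi (phi g q) + Pi q * -1).
  by move=> q'; rewrite -(cst q' q); ring.
exact: (xgetI 0 H q).
Qed.

Lemma translationM g h' :
  translation Pi phi (g * h')%g = translation Pi phi g + translation Pi phi h'.
Proof.
have [q _] := fibration_surjective fPi 0.
apply: (@addrI _ (Pi q)); rewrite -translationP (smooth_actionM hphi) !translationP.
by rewrite addrAC addrA.
Qed.

(** A homomorphism to the abelian group R does not see conjugation. *)
Lemma translation_conj g x : translation Pi phi (g * x * g^-1)%g = translation Pi phi x.
Proof.
have t1 : translation Pi phi 1%g = 0.
  by apply: (@addrI _ (translation Pi phi 1%g)); rewrite -translationM mulg1 addr0.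
have tV : translation Pi phi g^-1%g = - translation Pi phi g.
  by apply: (@addrI _ (translation Pi phi g)); rewrite -translationM mulgV t1 subrr.
by rewrite !translationM tV addrAC subrr add0r.
Qed.

Lemma smooth_translation : smooth_fun AG (translation Pi phi).
Proof.
have [q _] := fibration_surjective fPi 0.
have -> : translation Pi phi = (fun g => Pi (phi g q) + - Pi q).
  by apply/funext => g; rewrite translationP addrAC subrr add0r.
apply: (smooth_fun_add cG) => //; last exact: smooth_fun_cst.
exact: (smooth_fun_comp cG cA (smooth_orbit mA hG hphi q) sPi).
Qed.

Lemma c_phi_orbit q xi : fdiff AG (fun g => Pi (phi g q)) 1%g xi = c_phi Pi AG phi xi.
Proof.
have -> : (fun g => Pi (phi g q)) = (fun g => translation Pi phi g + Pi q).
  by apply/funext => g; rewrite translationP addrC.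
apply: etrans (fdiff_add cG _ _ smooth_translation (smooth_fun_cst _)) _.
apply: etrans (congr2 +%R erefl (fdiff_cst cG _ _ _)) _; exact: addr0.
Qed.

Lemma c_phi_Ad g xi : c_phi Pi AG phi (Ad AG g xi) = c_phi Pi AG phi xi.
Proof.
have E := fdiff_comp 1%g xi cG cG (smooth_conj hG g) smooth_translation.
rewrite mulg1 mulgV in E; apply: etrans (esym E) _.
apply: (congr1 (fun f => fdiff AG f 1%g xi)); apply/funext => x.
exact: translation_conj.
Qed.

(** Restriction to vertical vectors commutes with the lifts, because by invariance of eta the
    tangent maps preserve them and [vsproj] acts there as the identity. *)
Lemma mu_cotangent_lift g (a : cotQ) : mu A Pi (Psi g a) = vdual_lift phi g (mu A Pi a).
Proof.
apply: vdual_eq => w; apply: etrans (@mu_tagged _ _ _ A Pi (Psi g a) w) _.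
apply: etrans (cotangent_lift2 _ _ _) _; apply: esym.
apply: etrans (comp_lfunE _ _ _) _; apply: etrans (comp_lfunE _ _ _) _.
apply: etrans (comp_lfunE _ _ _) _.
apply: etrans (@mu_tagged _ _ _ A Pi a _) _; apply: (congr1 a.2).
have -> : linfun (vsval : subvs_of (vertical A Pi (phi g a.1)) -> 'rV[R]_n.+1) w = vsval w.
  exact: lfunE.
apply: etrans (congr1 vsval (lfunE _ _)) _.
apply: vsproj_vertical.
have := eta_inv g^-1%g (phi g a.1) (vsval w).
by rewrite (actionK hphi) => ->; exact: eta_vsval.
Qed.

(** By equivariance of [mu] and [h], lifting the identity that defines F at [a] gives the one at the
    image of [a], with the same factor since eta is invariant. *)
Lemma extended_hamiltonian_invariant g (a : cotQ) : F (Psi g a) = F a.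
Proof.
apply: (extended_hamiltonian_unique fPi hh).
rewrite mu_cotangent_lift -h_equiv.
have E1 : (h (mu A Pi a)).1 = a.1 := hsection1 hh _.
apply/lfunP => u; rewrite add_lfunE opp_lfunE scale_lfunE.
apply: etrans (congr2 (fun x y => x - y) (cotangent_lift2 _ _ _) (cotangent_lift2 _ _ _)) _.
rewrite E1; have := extended_hamiltonianP fPi hh a.
move/(congr1 (fun f : 'Hom(_, _) => f (tmap A A (phi g^-1%g) (phi g a.1) u))).
rewrite add_lfunE opp_lfunE scale_lfunE => ->.
apply: (congr1 (fun x => F a *: x)).
by have := eta_inv g^-1%g (phi g a.1) u; rewrite (actionK hphi).
Qed.

Let sF := smooth_extended_hamiltonian mA fPi hh.

(** The differential of Pi \o pi_Q has only base components, those of eta, so its symplectic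
    gradient is the fibre vector (0, - eta); along (0, eta) the derivative of F is 1 by
    [extended_hamiltonian_shift]. *)
Lemma extended_hamiltonian_sharp a :
  fdiff T F a (sharp (fdiff T (fun a : cotQ => Pi a.1) a)) = -1.
Proof.
set i := chart_at T a; set y : 'rV[R]_(n.+1 + n.+1) := cmap i a.
have ia : @cdom _ _ _ T i a by exact: (charted_chart_at cT a).
have iy : @cimg _ _ _ T i y by exact: (charted_cmap cT ia).
have iy' : @cimg _ _ _ A i (lsubmx y) := iy.
have yK : @cinv _ _ _ T i y = a by exact: (charted_cmapK cT ia).
have ylE : lsubmx y = @cmap _ _ _ A i a.1 by rewrite /y /= row_mxKl.
have betaE v : fdiff T (fun a : cotQ => Pi a.1) a v = eta A Pi a.1 (lsubmx v).
  apply: etrans (fdiffE _ _ cT smooth_Pi_fst) _.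
  have ll : linear (lsubmx : 'rV[R]_(n.+1 + n.+1) -> 'rV[R]_n.+1) by exact: linearP.
  have dPi : differentiable (Pi \o @cinv _ _ _ A i) (lsubmx y).
    exact: (smooth_on_differentiable iy' (sPi _)).
  apply: etrans (derive_comp v (linear_fun_differentiable y ll) dPi) _.
  apply: etrans (congr1 (fun w => 'D_w _ _) (linear_fun_derive y v ll)) _.
  apply: esym; apply: etrans (fdiffE _ _ cA sPi) _.
  by rewrite ylE.
set w : 'rV[R]_n.+1 := \row_j eta A Pi a.1 (delta_mx 0 j).
have -> : sharp (fdiff T (fun a : cotQ => Pi a.1) a) = - row_mx 0 w.
  rewrite /sharp opp_row_mx oppr0; congr row_mx; first by
    apply/rowP => j; rewrite mxE betaE delta_mx_rshift row_mxKl linear0 mxE.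
  congr (- _); apply/rowP => j; rewrite !mxE betaE delta_mx_lshift.
  by rewrite row_mxKl.
rewrite linearN; congr (- _); apply: etrans (fdiffE _ _ cT sF) _.
apply: derive_translation; first exact: (smooth_on_differentiable iy (sF i)).
move=> s; rewrite -[RHS]/(F (@cinv _ _ _ T i y) + s) yK.
rewrite -(extended_hamiltonian_shift fPi hh); apply: (congr1 F).
have iq : @cdom _ _ _ A i a.1 := ia.
(* These are the coordinates of the covector a + s eta over the same base point. *)
have YE : y + s *: row_mx 0 w = row_mx (lsubmx y) (rsubmx y + s *: w).
  by rewrite scale_row_mx scaler0 -{1}[y]hsubmxK add_row_mx addr0.
have lY : lsubmx (y + s *: row_mx 0 w) = lsubmx y by rewrite YE row_mxKl.
have rY : rsubmx (y + s *: row_mx 0 w) = rsubmx y + s *: w by rewrite YE row_mxKr.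
have qY : @cinv _ _ _ A i (lsubmx (y + s *: row_mx 0 w)) = a.1.
  by rewrite lY ylE charted_cmapK.
apply: cotangent_eq => [|u]; first exact: qY.
apply: etrans (cotangent_cinv2 _ _ _) _.
apply: etrans (congr1 (fun q => covector (rsubmx (y + s *: row_mx 0 w))
  (@tcoord _ _ _ A i q u)) qY) _.
rewrite rY (tcoord_chart_at mA) covectorE add_lfunE scale_lfunE.
have -> : a.2 u = \sum_j (rsubmx y) 0 j * u 0 j.
  rewrite -(lform_sum a.2 u); apply: eq_bigr => j _.
  by rewrite /y /= row_mxKr mxE (tvec_chart_at mA).
rewrite -(lform_sum (eta A Pi a.1) u) scaler_sumr -big_split; apply: eq_bigr => j _ /=.
have -> : (rsubmx y + s *: w) 0 j = rsubmx y 0 j + s * eta A Pi a.1 (delta_mx 0 j).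
  have wj : w 0 j = eta A Pi a.1 (delta_mx 0 j) by rewrite mxE.
  by rewrite mxE [X in _ + X]mxE wj.
by rewrite mulrDl -mulrA.
Qed.

Lemma omega_presymplectic : presymplectic T (omega h).
Proof.
split.
- exact: mT.
- exact: (is_form2_perturbed mA sF smooth_Pi_fst).
- exact: (perturbed_closed mA sF smooth_Pi_fst).
(* The dimension of T^*Q minus that of the two-dimensional kernel. *)
- exists (n.+1 + n.+1 - 2)%N => a.
  exact: (perturbed_rank mA (extended_hamiltonian_sharp a)).
Qed.

Lemma omega_invariant g a u v :
  omega h (Psi g a) (tmap T T (Psi g) a u) (tmap T T (Psi g) a v) = omega h a u v.
Proof.
apply: (perturbed_invariant (G := fun a : cotQ => Pi a.1) (c := translation Pi phi g)
  mA sF smooth_Pi_fst).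
- exact: (smooth_cotangent_translate mA hG hphi g).
- exact: (liouville_cotangent_lift mA hG hphi g).
- exact: extended_hamiltonian_invariant.
- by move=> x; exact: translationP.
Qed.

Definition momentum (a : cotQ) : 'Hom('rV[R]_k, R^o) :=
  (a.2 \o infgen AG A phi a.1)%VF - F a *: c_phi Pi AG phi.

Lemma momentumE (a : cotQ) xi :
  momentum a xi = a.2 (infgen AG A phi a.1 xi) - F a * c_phi Pi AG phi xi.
Proof. by rewrite /momentum add_lfunE opp_lfunE scale_lfunE comp_lfunE. Qed.

Let J0 xi : cotQ -> R := exact_momentum (B := AG) (A := A) Psi 1%g xi.

Let sJ0 xi : smooth_fun T (J0 xi).
Proof. exact: (smooth_exact_momentum mG mA (smooth_action_smooth hPsi) (smooth_action1 hPsi)). Qed.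

Lemma momentum_split xi : (fun a => momentum a xi : R) =
  (fun a => J0 xi a + F a * - c_phi Pi AG phi xi).
Proof.
apply/funext => a; apply: etrans (momentumE a xi) _.
by rewrite /J0 (exact_momentum_cotangent mA hG hphi) mulrN.
Qed.

Lemma smooth_momentum xi : smooth_fun T (fun a => momentum a xi : R).
Proof.
rewrite momentum_split; apply: (smooth_fun_add cT); first exact: sJ0.
by apply: (smooth_fun_mul cT); [exact: sF|exact: smooth_fun_cst].
Qed.

(** On the generator X, dF vanishes because F is constant on orbits, and the differential of Pi \o
    pi_Q equals c_phi(xi); the wedge contributes - c_phi(xi) dF, which is the second term of
    dJ_xi. *)
Lemma momentumP xi a v :
  omega h a (infgen AG T Psi a xi) v = fdiff T (fun y => momentum y xi : R) a v.
Proof.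
have so := smooth_map_orbit mG mA (smooth_action_smooth hPsi) a.
apply: etrans (perturbed_formE mA _ _ _ _ _) _.
have dF : fdiff T F a (infgen AG T Psi a xi) = 0.
  have E := fdiff_comp 1%g xi cG cT so sF.
  rewrite (smooth_action1 hPsi) in E; apply: etrans (esym E) _.
  have -> : F \o (fun g => Psi g a) = (fun=> F a).
    by apply/funext => g; exact: extended_hamiltonian_invariant.
  exact: fdiff_cst.
have dP : fdiff T (fun a : cotQ => Pi a.1) a (infgen AG T Psi a xi) = c_phi Pi AG phi xi.
  have E := fdiff_comp 1%g xi cG cT so smooth_Pi_fst.
  rewrite (smooth_action1 hPsi) in E; apply: etrans (esym E) _.
  exact: c_phi_orbit.
have dJ := exact_momentumP mG mA (smooth_action_smooth hPsi) (smooth_action1 hPsi)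
  (liouville_cotangent_lift mA hG hphi) xi a v.
rewrite momentum_split; apply: esym.
have sc : smooth_fun T (fun a => F a * - c_phi Pi AG phi xi).
  by apply: (smooth_fun_mul cT); [exact: sF|exact: smooth_fun_cst].
apply: etrans (fdiff_add cT a v (sJ0 xi) sc) _.
have key (s j f f' p q c e : R) : s = j -> f = 0 -> p = c -> e = f' * - c ->
    j + e = s + (f * q - f' * p).
  by move=> -> -> -> ->; ring.
exact: (key _ _ _ _ _ _ _ _ dJ dF dP (fdiff_mulr cT _ a v sF)).
Qed.

(** The two terms are equivariant separately: alpha(xi_Q) by [infgen_Ad], and F c_phi because F is
    invariant under the action and c_phi under Ad. *)
Lemma momentum_equivariant : Ad_equivariant AG Psi momentum.
Proof.
move=> g a xi; apply: etrans (momentumE _ _) _; apply: esym; apply: etrans (momentumE _ _) _.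
have key (x x' f f' c c' : R) : x = x' -> f = f' -> c = c' -> x - f * c = x' - f' * c'.
  by move=> -> -> ->.
apply: (key _ _ _ _ _ _ _ (esym (extended_hamiltonian_invariant g a)) (c_phi_Ad _ _)).
apply: esym; apply: etrans (cotangent_lift2 _ _ _) _; apply: (congr1 a.2).
exact: (infgen_Ad mA hG hphi).
Qed.

End Invariance.

Theorem proposition4p4 (R : realType) (n k : nat)
  (Q : choiceType) (A : smooth_structure R n.+1 Q) (hQ : manifold A)
  (Qconn : connected [set: mtop A])
  (Pi : Q -> R) (hPi : fibration A Pi)
  (G : groupType) (AG : smooth_structure R k G) (hG : lie_group AG)
  (phi : G -> Q -> Q) (hphi : smooth_action AG A phi)
  (phi_free : free_action phi) (phi_proper : proper_action AG A phi)
  (eta_inv : eta_invariant A Pi phi)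
  (h : vdual A Pi -> cotangent) (hh : hamiltonian_section h)
  (h_equiv : section_equivariant phi h)
  (h_transverse : forall a : cotangent,
     form2_ker (omega h) a
       `&` orbit_tangent AG (cotangent_structure A) (cotangent_lift A phi) a
     = [set 0]) :
  exists J : cotangent -> 'Hom('rV[R]_k, R^o),
    [/\ forall (a : cotangent) (xi : 'rV[R]_k),
          J a xi = a.2 (infgen AG A phi a.1 xi)
                   - extended_hamiltonian h a * c_phi Pi AG phi xi,
        symmetric_presymplectic AG (cotangent_structure A) (omega h)
          (cotangent_lift A phi) J
      & Ad_equivariant AG (cotangent_lift A phi) J].
Proof.
exists (momentum (AG := AG) (phi := phi) h); split.
- by move=> a xi; exact: momentumE.
- split.
  + exact: (omega_presymplectic hQ hPi hh).
  + exact: (cotangent_smooth_action hQ hG hphi).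
  + exact: (omega_invariant hQ Qconn hPi hG hphi eta_inv hh h_equiv).
  + exact: h_transverse.
  + move=> i; apply: smooth_on_row; first exact: (charted_open (cotangent_charted hQ) i).
    move=> j; under [X in smooth_on _ X]eq_fun do rewrite /= mxE.
    exact: (smooth_momentum hQ hPi hG hphi hh (delta_mx 0 j) i).
  + by move=> xi a v; exact: momentumP.
- exact: momentum_equivariant.
Qed.
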